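(* Let $\beta=2/\log(e/2)\approx 6.51778$. In the random graph process $G_0,G_1,\dots,G_{\binom n2}$ on $[n]$ the following hold. (i) A.a.s., simultaneously for every $0\le m\le\binom n2$, $T(G_m)=\min\{\delta(G_m),\lfloor m/(n-1)\rfloor\}$. (ii) For any constant $\epsilon>0$, a.a.s. both: $\delta(G_m)\le\lfloor m/(n-1)\rfloor$ for every $0\le m\le \frac{(1-\epsilon)\beta}{2}n\log n$; and $\delta(G_m)>\lfloor m/(n-1)\rfloor$ for every $\frac{(1+\epsilon)\beta}{2}n\log n\le m\le\binom n2$.
   Context: The random graph process is defined by taking a uniformly random ordering $(e_1,\dots,e_{\binom n2})$ of the edges of the complete graph on $[n]$ and letting $G_m$ be the graph on $[n]$ with edge set $\{e_1,\dots,e_m\}$. ''A.a.s.'' means with probability tending to $1$ as $n\to\infty$. For a graph $G$, $\delta(G)$ is the minimum degree and $T(G)$ the maximum number of pairwise edge-disjoint spanning trees of $G$. *)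

(* Defs.v *)
From mathcomp Require Import all_boot fingroup perm.
From Stdlib Require Import Reals.
Set Implicit Arguments. Unset Strict Implicit. Unset Printing Implicit Defensive.

Definition edge (n : nat) := {e : {set 'I_n} | #|e| == 2}.

Definition adj n (S : {set edge n}) : rel 'I_n :=
  fun u v => [exists e in S, val e == [set u; v]].

Definition spanning_tree n (S : {set edge n}) : bool :=
  [forall u : 'I_n, forall v : 'I_n, connect (adj S) u v] && (#|S| == n.-1).

Definition has_k_trees n (F : {set edge n}) (k : nat) : bool :=
  [exists f : {ffun 'I_k -> {set edge n}},
     [forall i, spanning_tree (f i) && (f i \subset F)] &&
     [forall i, forall j, (i != j) ==> [disjoint f i & f j]]].

(* T(G): maximum number of pairwise edge-disjoint spanning trees.
   (For n >= 2 every such family has at most #|{: edge n}| members, so the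
   bound in the \max is harmless.) *)
Definition T n (F : {set edge n}) : nat :=
  \max_(k < #|{: edge n}|.+1 | has_k_trees F k) k.

Definition deg n (F : {set edge n}) (v : 'I_n) : nat :=
  #|[set e in F | v \in val e]|.

(* Minimum degree (for n >= 1; the seed n is never attained since deg <= n-1). *)
Definition mindeg n (F : {set edge n}) : nat :=
  \big[minn/n]_(v : 'I_n) deg F v.

(* Random graph process: a uniformly random ordering of the edges is given by a
   uniformly random permutation s of edge n; edge e has position
   enum_rank (s e) in {0,..,C(n,2)-1}, and G_m consists of the first m edges. *)
Definition G n (s : {perm edge n}) (m : nat) : {set edge n} :=
  [set e | (enum_rank (s e) < m)%N].

Definition prob n (A : pred {perm edge n}) : R :=
  (INR #|[set s | A s]| / INR #|[set: {perm edge n}]|)%R.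

Definition aas (A : forall n, pred {perm edge n}) : Prop :=
  forall eps : R, (0 < eps)%R ->
    exists N : nat, forall n : nat, (N <= n)%N -> (1 - eps <= prob (A n))%R.

Definition Rleb (a b : R) : bool := if Rle_dec a b then true else false.

Definition beta : R := (2 / ln (exp 1 / 2))%R.

(* Main.v *)
Require Import Defs.
From HB Require Import structures.
From mathcomp Require Import all_boot fingroup perm.
From mathcomp Require Import zify.
From Stdlib Require Import Reals Lra.
Set Implicit Arguments. Unset Strict Implicit. Unset Printing Implicit Defensive.

(** Write [Gam_j = G_{j(n-1)}] and [t = min (delta (G_m), floor (m/(n-1)))].  The bound
    [T <= t] is immediate; for [T >= t] we use the Nash-Williams-Tutte condition: every
    partition into [p] parts has at least [t (p-1)] crossing edges.

    With [j = floor (m/(n-1))], suppose that every vertex set [W] missing a constant fraction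
    of the vertices spans at most [j (|W|-1)] edges.  A partition without a giant part then has
    at least [j (n-1) - j (n-p) = j (p-1)] crossing edges.  If there is a giant part with
    complement [U], the cut of [U] alone suffices once it has at least [t |U|] edges.  This
    holds because [U] spans few edges, and vertices of degree close to [t] are pairwise
    nonadjacent without common neighbours, so that only the edges between them and the other
    vertices of [U], at most one per vertex, are lost.

    [t] and these conditions only need control along the grid [Gam_j], by monotonicity.  For
    [j] of order [ln n] the separation of low vertices is obtained without computing any
    degree distribution: let [k] be the threshold at which the expected number of vertices of
    degree less than [k] reaches [n^(1/8)].  By the second moment method [delta <= k], and
    since the probability of a degree less than [k + r] exceeds that of a degree less than [k]
    by a factor of at most a small power of [n] when [r] is a small multiple of [ln n], the expected number
    of close pairs of vertices of degree less than [k + r] tends to 0.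

    The threshold in (ii) comes from [P(deg_{Gam_j} v <= j) = (2/e)^{j (1 + o(1))}]. *)

(** * Packing spanning trees *)

(** The second moment method only gives failure probabilities of a small negative power of [n], far
    too large for a union bound over all [m]. It is used only at the order [ln n] grid points with
    [ln n / 4 <= j < 20 ln n]. Below this range some vertex is still isolated and both sides vanish;
    above it an exponential tail bound lifts every degree so far above [j] that no vertex counts as
    low, with failure probability small enough for all remaining grid points. Edges are drawn
    without replacement, and for stars of size [a = n - 1] among [N] edges [a^2 / N] does not tend
    to 0. The second moment therefore rests on exact sampling weights, compared so that the error is
    only of order [ln n / n]. Sparsity of small sets is asked with [k = j / D] and [b = n / Q]. The
    constant [D] is large so that raising a degree threshold by [3 k + 5] costs a factor at most
    [n^(1/8)]; [Q] is then large in terms of [D] so that sets of at most [b] vertices are sparse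
    enough. The packing theorem is proved by exchanging edges in a maximum family of disjoint
    forests. *)

Lemma connect_ind (U : finType) (e : rel U) (P : U -> Prop) x :
  P x -> (forall y z, P y -> e y z -> P z) -> forall y, connect e x y -> P y.
Proof.
move=> Px IH y /connectP[p]; elim: p x Px => [|z p IHp] x Px /=; first by move=> _ ->.
by case/andP=> exz pth E; apply: (IHp z) => //; apply: IH exz.
Qed.

Lemma leq_card_imset_ker (aT rT rT' : finType) (f : aT -> rT) (g : aT -> rT') :
  (forall a b, f a = f b -> g a = g b) -> #|g @: setT| <= #|f @: setT|.
Proof.
move=> fg.
pose h c := if [pick a | f a == c] is Some a then Some (g a) else None.
rewrite -(card_imset _ (@Some_inj _)).
apply: leq_trans (leq_imset_card h _); apply: subset_leq_card.
apply/subsetP=> _ /imsetP[_ /imsetP[a _ ->] ->].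
apply/imsetP; exists (f a); first exact: imset_f.
rewrite /h; case: pickP => [b /eqP /fg -> // | /(_ a)].
by rewrite eqxx.
Qed.

Lemma card_imset_ker (aT rT rT' : finType) (f : aT -> rT) (g : aT -> rT') :
  (forall a b, (f a == f b) = (g a == g b)) -> #|g @: setT| = #|f @: setT|.
Proof.
move=> fg; apply/eqP; rewrite eqn_leq.
by apply/andP; split; apply: leq_card_imset_ker => a b /eqP; [rewrite fg | rewrite -fg] => /eqP.
Qed.

Lemma leq_card_bigcup (I U : finType) (A : I -> {set U}) :
  #|\bigcup_i A i| <= \sum_i #|A i|.
Proof.
apply: (big_ind2 (fun (X : {set U}) m => #|X| <= m)) => // [|X m Y p Xm Yp]; first by rewrite cards0.
by apply: leq_trans (leq_card_setU X Y) (leq_add Xm Yp).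
Qed.

(** * Components and forests of edge sets *)

Section Components.
Variable n : nat.
Implicit Types (S X D : {set edge n}) (e : edge n) (a b x y : 'I_n).

Lemma edgeP e : exists x y, x != y /\ val e = [set x; y].
Proof. by case: e => e /= /cards2P [x [y [xy ->]]]; exists x, y. Qed.

Lemma edge_neq e x y : val e = [set x; y] -> x != y.
Proof. by move=> E; move: (valP e); rewrite /= -/(val e) E cards2; case: (x == y). Qed.

Lemma adjP S a b : reflect (exists2 e, e \in S & val e = [set a; b]) (adj S a b).
Proof.
apply: (iffP existsP) => [[e /andP[eS /eqP E]] | [e eS E]]; first by exists e.
by exists e; rewrite eS E eqxx.
Qed.

Lemma adj_sym S : symmetric (adj S).
Proof. by move=> a b; rewrite /adj setUC. Qed.

Definition conn S := connect (adj S).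

Lemma conn_csym S : connect_sym (adj S).
Proof. exact/sym_connect_sym/adj_sym. Qed.

Lemma conn_sym S a b : conn S a b = conn S b a.
Proof. exact: conn_csym. Qed.

Lemma conn_trans S b a c : conn S a b -> conn S b c -> conn S a c.
Proof. exact: connect_trans. Qed.

Lemma conn_edge S e a b : e \in S -> val e = [set a; b] -> conn S a b.
Proof. by move=> eS E; apply: connect1; apply/adjP; exists e. Qed.

Lemma conn_gen S X :
  (forall e x y, e \in S -> val e = [set x; y] -> conn X x y) ->
  forall a b, conn S a b -> conn X a b.
Proof. by move=> H; apply: connect_sub => a b /adjP[e eS E]; apply: H eS E. Qed.

Lemma conn_mono S X a b : S \subset X -> conn S a b -> conn X a b.
Proof. by move=> /subsetP sub; apply: conn_gen => e x y /sub; apply: conn_edge. Qed.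

(** A walk need cross the new edge at most once, in one of two directions; the induction maintains
    this along the walk. *)
Lemma conn_add S e x y a b : val e = [set x; y] -> conn (e |: S) a b ->
  [|| conn S a b, conn S a x && conn S y b | conn S a y && conn S x b].
Proof.
move=> E; move: b; apply: connect_ind => [|b c].
  by rewrite /conn connect0.
move=> H /adjP[e']; rewrite in_setU1 => /orP[/eqP -> | e'S] E'.
  have: b \in [set x; y] by rewrite -E E' set21.
  have: c \in [set x; y] by rewrite -E E' set22.
  have bc := edge_neq E'.
  rewrite !inE => /orP[] /eqP cE /orP[] /eqP bE; move: bc H; rewrite cE bE ?eqxx // => _;
  rewrite /conn !connect0 ?andbT -/conn => /or3P H.
    by case: H => [-> | -> | /andP[-> _]]; rewrite ?orbT.
  by case: H => [-> | /andP[-> _] | ->]; rewrite ?orbT.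
have bc := conn_edge e'S E'.
by case/or3P: H => [H | /andP[-> H] | /andP[-> H]]; rewrite (conn_trans H bc) ?orbT.
Qed.

Lemma conn_add_same S e x y : val e = [set x; y] -> conn S x y -> conn (e |: S) =2 conn S.
Proof.
move=> E xy a b; apply/idP/idP; last exact/conn_mono/subsetUr.
case/(conn_add E)/or3P => [// | /andP[ax yb] | /andP[ay xb]].
  exact: conn_trans ax (conn_trans xy yb).
by rewrite conn_sym in xy; apply: conn_trans ay (conn_trans xy xb).
Qed.

Definition nc S := #|root (adj S) @: setT|.

Lemma root_conn S a b : (root (adj S) a == root (adj S) b) = conn S a b.
Proof. exact/root_connect/conn_csym. Qed.

Lemma nc_eq S X : conn S =2 conn X -> nc S = nc X.
Proof. by move=> SX; apply: card_imset_ker => a b; rewrite !root_conn SX. Qed.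

Lemma nc_add S e x y : val e = [set x; y] -> ~~ conn S x y -> (nc (e |: S)).+1 = nc S.
Proof.
move=> E xy; set r := root (adj S).
(* [g] merges the class of [y] into that of [x]: its kernel is connectivity with [e] added, and its
   image is the old set of roots without [r y]. *)
pose g a := if r a == r y then r x else r a.
have rxy : r x != r y by rewrite root_conn.
have -> : nc (e |: S) = #|g @: setT|.
  apply: card_imset_ker => a b; rewrite root_conn /g.
  have cxy : conn (e |: S) x y by apply: (conn_edge _ E); rewrite setU11.
  have up c d : r c = r d -> conn (e |: S) c d.
    by move/eqP; rewrite root_conn; apply: conn_mono; rewrite subsetUr.
  apply/idP/idP.
    have [ay|ay] := eqVneq (r a) (r y); have [yb|yb] := eqVneq (r b) (r y); move/eqP.
    - by move=> _; apply: up; rewrite ay.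
    - by move=> /up xb; rewrite (conn_trans _ xb) // (conn_trans (up _ _ ay)) // conn_sym.
    - by move=> /up ax; rewrite (conn_trans (conn_trans ax cxy)) // up.
    - by move/up.
  case/(conn_add E)/or3P=> [|/andP[]|/andP[]]; rewrite -!root_conn -/r => /eqP ->.
  - by rewrite eqxx.
  - by move/eqP=> <-; rewrite eqxx (negPf rxy).
  - by move/eqP=> <-; rewrite eqxx (negPf rxy).
have -> : g @: setT = (r @: setT) :\ r y.
  apply/setP=> c; rewrite in_setD1; apply/imsetP/andP => [[a _ ->]|[cy /imsetP[a _ ca]]].
    by rewrite /g; case: ifP => [_ | /negbT ay]; split; rewrite ?imset_f ?in_setT.
  by exists a => //; rewrite /g -ca (negPf cy).
by rewrite [nc S](cardsD1 (r y)) imset_f ?in_setT.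
Qed.

Lemma nc_set0 : nc set0 = n.
Proof.
rewrite /nc -[RHS]card_ord -cardsT; apply: card_in_imset => a b _ _ /eqP.
rewrite root_conn; move: b; apply: connect_ind => // b c _ /adjP[e].
by rewrite inE.
Qed.

Lemma set_edge_ind (P : {set edge n} -> Prop) :
  P set0 -> (forall S e, e \notin S -> P S -> P (e |: S)) -> forall S, P S.
Proof.
move=> P0 IH S; move: {2}#|S| (leqnn #|S|) => k; elim: k S => [|k IHk] S.
  by rewrite leqn0 cards_eq0 => /eqP ->.
case: (set_0Vmem S) => [-> // | [e eS]] Sk; rewrite -(setD1K eS).
apply: IH; first by rewrite !inE eqxx.
by apply: IHk; move: Sk; rewrite (cardsD1 e) eS.
Qed.

Lemma nc_ge S : n <= #|S| + nc S.
Proof.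
move: S; apply: set_edge_ind => [|S e eS IH]; first by rewrite nc_set0 leq_addl.
have [x [y [_ E]]] := edgeP e; rewrite cardsU1 eS.
have [xy|xy] := boolP (conn S x y); first by rewrite (nc_eq (conn_add_same E xy)); lia.
by move: (nc_add E xy); lia.
Qed.

(** Acyclicity as the equality case of [nc_ge]: every edge has lowered the number of components by
    one. *)
Definition forest S := #|S| + nc S == n.

Lemma forest_add S e x y :
  val e = [set x; y] -> ~~ conn S x y -> forest S -> forest (e |: S).
Proof.
move=> E xy; rewrite /forest cardsU1 => /eqP fS; have := nc_add E xy.
suff -> : e \notin S by move=> H; apply/eqP; lia.
by apply: contra xy => eS; apply: conn_edge eS E.
Qed.

Lemma forest_bridge S e x y :
  forest S -> e \in S -> val e = [set x; y] -> ~~ conn (S :\ e) x y.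
Proof.
move=> /eqP fS eS E; apply/negP=> xy; move: (nc_ge (S :\ e)).
rewrite -(nc_eq (conn_add_same E xy)) setD1K //; have cS : #|S| = #|S :\ e|.+1 by rewrite (cardsD1 e S) eS.
move: fS cS; lia.
Qed.

Lemma forest_D1 S e : forest S -> forest (S :\ e).
Proof.
have [eS|eS] := boolP (e \in S); last first.
  suff -> : S :\ e = S by [].
  by apply/setDidPl; rewrite disjoint_sym disjoints1.
move=> fS; have [x [y [_ E]]] := edgeP e.
have := nc_add E (forest_bridge fS eS E); rewrite (setD1K eS) /forest.
have cS : #|S| = #|S :\ e|.+1 by rewrite (cardsD1 e S) eS.
by move/eqP: fS cS => fS cS H; apply/eqP; lia.
Qed.

Lemma forest0 : forest set0.
Proof. by rewrite /forest cards0 nc_set0. Qed.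

Lemma nc_gt0 S : 0 < n -> 0 < nc S.
Proof. by move=> n0; apply/card_gt0P; exists (root (adj S) (Ordinal n0)); rewrite imset_f ?in_setT. Qed.

Lemma nc1_conn S a b : nc S <= 1 -> conn S a b.
Proof.
move=> H; rewrite -root_conn; apply/eqP.
by apply: (card_le1_eqP H); rewrite imset_f ?in_setT.
Qed.

Lemma forest_tree S : 0 < n -> forest S -> n.-1 <= #|S| -> spanning_tree S.
Proof.
move=> n0 /eqP fS Sn; have n1 := nc_gt0 S n0.
apply/andP; split; last by apply/eqP; lia.
by apply/'forall_forallP => a b; apply: nc1_conn; lia.
Qed.

(* The edges of the path of the forest [S] joining [x] to [y]. *)
Lemma forest_path S x y : forest S -> conn S x y ->
  conn [set e in S | ~~ conn (S :\ e) x y] x y.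
Proof.
move=> fS; move: (leqnn #|S|); move: {2}#|S| => k.
have : S \subset S by []; move: {1 3 4}S => D.
elim: k D => [|k IH] D DS Dk xy.
  move: Dk; rewrite leqn0 cards_eq0 => /eqP D0; apply: conn_mono xy.
  by rewrite D0 sub0set.
have [H|] := boolP [forall e in D, ~~ conn (D :\ e) x y]; last first.
  rewrite negb_forall_in => /exists_inP[e eD]; rewrite negbK => xy'.
  apply: (IH (D :\ e)) => //; first exact: subset_trans (subsetDl _ _) DS.
  by move: Dk; rewrite (cardsD1 e) eD.
apply: (conn_mono _ xy); apply/subsetP=> e eD; rewrite inE (subsetP DS) //=.
(* [D] is now minimal among edge sets joining [x] to [y]. Were [x] and [y] still joined in [S]
   without [e], the two halves of the path in [D] would close up and join the ends of [e] in
   [S :\ e], against [forest_bridge]. *)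
have De := forall_inP H e eD; apply/negP=> xy'.
have [a [b [_ E]]] := edgeP e.
have /negP[] := forest_bridge fS (subsetP DS _ eD) E.
have sub c d : conn (D :\ e) c d -> conn (S :\ e) c d by apply/conn_mono/setSD.
move: xy; rewrite -{1}(setD1K eD) => /(conn_add E); rewrite (negPf De) /=.
case/orP=> /andP[/sub p /sub q].
  by rewrite conn_sym in p; rewrite conn_sym in q; rewrite (conn_trans p) // (conn_trans xy') // conn_sym conn_sym.
rewrite conn_sym in p; rewrite conn_sym in q.
by rewrite conn_sym (conn_trans p) // (conn_trans xy') // conn_sym.
Qed.

Definition joined S e := [forall x in val e, forall y in val e, conn S x y].

Lemma joinedE S e x y : val e = [set x; y] -> joined S e = conn S x y.
Proof.
move=> E; apply/idP/idP => [/forall_inP H | xy].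
  have xe : x \in val e by rewrite E set21.
  by move/forall_inP: (H x xe); apply; rewrite E set22.
apply/forall_inP => a aE; apply/forall_inP => b; move: aE; rewrite E !inE => /orP[]/eqP-> /orP[]/eqP-> //; rewrite ?[conn S y x]conn_sym //; exact: connect0.
Qed.

(** Both sides agree with [e |: S]. There [e] is redundant because [S] joins its ends, and [e'] is
    redundant because the path of [S] between the ends of [e] runs through [e'], so that [e] closes
    it to a cycle. *)
Lemma conn_exchange S e e' : e' \in S -> joined S e -> ~~ joined (S :\ e') e ->
  conn (e |: (S :\ e')) =2 conn S.
Proof.
have [x [y [_ E]]] := edgeP e; have [a [b [_ E']]] := edgeP e'.
rewrite !(joinedE _ E) => e'S xy nxy u v.
have xy1 : conn (e |: (S :\ e')) x y by apply: (conn_edge _ E); rewrite setU11.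
rewrite -(conn_add_same E xy) -{2}(setD1K e'S) setUCA.
rewrite (conn_add_same E') //.
have up c d : conn (S :\ e') c d -> conn (e |: (S :\ e')) c d by apply/conn_mono/subsetUr.
move: xy; rewrite -{1}(setD1K e'S) => /(conn_add E'); rewrite (negPf nxy) /=.
case/orP=> /andP[/up p /up q]; last first.
  by rewrite conn_sym in xy1; rewrite (conn_trans q) // (conn_trans xy1).
by rewrite conn_sym in p; rewrite conn_sym in q; rewrite (conn_trans p) // (conn_trans xy1).
Qed.

End Components.

(** * The Nash-Williams-Tutte packing theorem *)

Section NashWilliams.
Variables (n : nat) (k : nat) (E : {set edge n}).
Hypothesis n_gt0 : 0 < n.
Implicit Types (F : {ffun 'I_k -> {set edge n}}).

Definition family F :=
  [forall i, forest (F i) && (F i \subset E)] &&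
  [forall i, forall j, (i != j) ==> [disjoint F i & F j]].

Definition upd F i (X : {set edge n}) : {ffun 'I_k -> {set edge n}} := [ffun j => if j == i then X else F j].

Definition step F F' := [exists i, exists e, exists e',
  [&& [&& e \in E, [forall j, e \notin F j] & e' \in F i], joined (F i) e,
   ~~ joined (F i :\ e') e & F' == upd F i (e |: (F i :\ e'))]].

Lemma familyP F : reflect
  [/\ forall i, forest (F i), forall i, F i \subset E &
      forall i j e, e \in F i -> e \in F j -> i = j] (family F).
Proof.
apply: (iffP andP) => [[/forallP H /'forall_forallP D] | [fF sF D]]; split.
- by move=> i; case/andP: (H i).
- by move=> i; case/andP: (H i).
- move=> i j e ei ej; apply/eqP; apply: contraTT ej => ij.
  by have /implyP/(_ ij)/disjointFr/(_ ei) -> := D i j.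
- by apply/forallP => i; rewrite fF sF.
apply/'forall_forallP => i j; apply/implyP => ij.
rewrite disjoint_subset; apply/subsetP => e ei; rewrite inE.
by apply: contra ij => /(D _ _ _ ei) ->.
Qed.

Lemma family_upd F i e (X : {set edge n}) : family F -> e \in E -> (forall j, e \notin F j) ->
  X \subset F i -> forest (e |: X) -> family (upd F i (e |: X)).
Proof.
case/familyP=> fF sF D eE eF XF fX; apply/familyP; split=> [j|j|j l a]; rewrite !ffunE.
- by case: ifP.
- case: ifP => _ //; rewrite subUset sub1set eE; exact: subset_trans XF (sF i).
have H c : c \in e |: X -> c = e \/ c \in F i.
  by rewrite in_setU1 => /orP[/eqP|/(subsetP XF)]; [left | right].
case: eqP => [->|ji]; case: eqP => [->|li] //.
- by case/H=> [->|ai]; [rewrite (negPf (eF l)) | apply: D].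
- by move=> aj /H[ae|]; [rewrite ae (negPf (eF j)) in aj | apply: D].
exact: D.
Qed.

Lemma sum_upd F i (X : {set edge n}) : \sum_j #|upd F i X j| + #|F i| = \sum_j #|F j| + #|X|.
Proof.
rewrite (bigD1 i) //= [in RHS](bigD1 i) //= ffunE eqxx.
rewrite (eq_bigr (fun j => #|F j|)); last by move=> j /negPf ji; rewrite ffunE ji.
by rewrite addnC addnA addnAC.
Qed.

Lemma step_family F F' : family F -> step F F' ->
  family F' /\ \sum_i #|F' i| = \sum_i #|F i|.
Proof.
move=> fF /existsP[i /existsP[e /existsP[e' /and4P[/and3P[eE /forallP eF e'F] xy nxy /eqP ->]]]].
have [ff _ _] := familyP _ fF.
have [x [y [_ Ee]]] := edgeP e; rewrite (joinedE _ Ee) in nxy.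
split; first by apply: family_upd; rewrite ?subD1set //; apply: forest_add nxy (forest_D1 _ _).
have := sum_upd F i (e |: (F i :\ e')); rewrite cardsU1 !inE (negPf (eF i)) andbF /=.
by rewrite (cardsD1 e' (F i)) e'F /=; lia.
Qed.

Section Exchange.
Variable F0 : {ffun 'I_k -> {set edge n}}.
Hypotheses (famF0 : family F0)
  (maxF0 : forall F, family F -> \sum_i #|F i| <= \sum_i #|F0 i|).

(* The components of [missable] form the partition witnessing that a maximum family which is
   not made of spanning trees violates the Nash-Williams condition. *)
Definition missable := [set e in E |
  [exists F, connect step F0 F && [forall i, e \notin F i]]].
Local Notation E0 := missable.

Lemma reach_family F : connect step F0 F -> family F /\ \sum_i #|F i| = \sum_i #|F0 i|.
Proof.
move: F; apply: connect_ind => // F F' [fF sF] /(step_family fF)[fF' sF'].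
by rewrite sF'.
Qed.

(** If [F i] did not join the ends of [e], adding [e] would contradict maximality. Each edge of the
    path joining them can be exchanged for [e], hence is missed by another reachable family, so the
    path lies in [missable]. *)
Lemma missable_joined F i e : connect step F0 F -> e \in E ->
  (forall j, e \notin F j) -> joined (F i :&: E0) e.
Proof.
move=> rF eE eF; have [fF sF] := reach_family rF; have [ff fE _] := familyP _ fF.
have [x [y [_ Ee]]] := edgeP e.
have xy : conn (F i) x y.
  apply/negPn/negP => nxy.
  have := maxF0 (family_upd fF eE eF (subxx _) (forest_add Ee nxy (ff i))).
  by have := sum_upd F i (e |: F i); rewrite cardsU1 (eF i) sF; lia.
rewrite (joinedE _ Ee); apply: conn_mono (forest_path (ff i) xy).
apply/subsetP => e'; rewrite !inE => /andP[e'F nxy]; rewrite e'F (subsetP (fE i)) //=.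
apply/existsP; exists (upd F i (e |: (F i :\ e'))); apply/andP; split.
  apply: connect_trans rF (connect1 _).
  apply/existsP; exists i; apply/existsP; exists e; apply/existsP; exists e'.
  apply/and4P; rewrite !(joinedE _ Ee) eqxx; split=> //.
  by apply/and3P; split=> //; apply/forallP.
have [_ _ D] := familyP _ fF.
apply/forallP => j; rewrite ffunE; case: eqP => [_|ji].
  rewrite !inE eqxx /= orbF; apply: contra (eF i) => /eqP <- //.
by apply/negP => /(D _ _ _ e'F) ij; apply: ji.
Qed.

(* An exchange step replaces an edge of a cycle contained in [missable], so it
   does not change connectivity inside [missable]. *)
Lemma step_conn F F' i : connect step F0 F -> step F F' ->
  conn (F' i :&: E0) =2 conn (F i :&: E0).
Proof.
move=> rF st; have [fF _] := reach_family rF; have rF' := connect_trans rF (connect1 st).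
have [fF' _] := reach_family rF'; have [_ _ D] := familyP _ fF; have [_ _ D'] := familyP _ fF'.
have [_ fE _] := familyP _ fF.
case/existsP: st => l /existsP[e /existsP[e' /and4P[/and3P[eE /forallP eF e'F] xy nxy /eqP F'E]]].
rewrite F'E ffunE; case: eqP => // -> {i}.
have eE0 : e \in E0.
  by rewrite inE eE; apply/existsP; exists F; rewrite rF; apply/forallP.
have e'E0 : e' \in E0.
  rewrite inE (subsetP (fE l)) //; apply/existsP; exists F'; rewrite rF' F'E /=.
  apply/forallP => j; rewrite ffunE; case: eqP => [_|jl].
    by rewrite !inE eqxx orbF; apply: contra (eF l) => /eqP <-.
  by apply/negP => /(D _ _ _ e'F) lj; apply: jl.
have -> : (e |: (F l :\ e')) :&: E0 = e |: ((F l :&: E0) :\ e').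
  apply/setP => a; rewrite !in_setI !in_setU1 !in_setD1 in_setI.
  by case: eqP => [->|_] /=; rewrite ?eE0 // andbA.
apply: conn_exchange; first by rewrite in_setI e'F.
  exact: missable_joined eE eF.
have [x [y [_ Ee]]] := edgeP e; move: nxy; rewrite !(joinedE _ Ee).
by apply: contra; apply/conn_mono/setSD/subsetIl.
Qed.

(** A missable edge has its ends joined inside [F i :&: E0] for a reachable [F] that misses it, and
    by [step_conn] this connectivity is the same all the way back to [F0]. *)
Lemma conn_missable i : conn (F0 i :&: E0) =2 conn E0.
Proof.
move=> a b; apply/idP/idP; first exact/conn_mono/subsetIr.
apply: conn_gen => e x y; rewrite inE => /andP[eE /existsP[F /andP[rF /forallP eF]]] Ee.
have -> : conn (F0 i :&: E0) x y = conn (F i :&: E0) x y.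
  suff : connect step F0 F /\ conn (F i :&: E0) =2 conn (F0 i :&: E0) by case=> _ ->.
  move: F {eF} rF; apply: connect_ind => [|F F' [rF H] st]; first by rewrite connect0.
  split; first exact: connect_trans rF (connect1 st).
  by move=> u v; rewrite (step_conn _ rF st).
by rewrite -(joinedE _ Ee); apply: missable_joined.
Qed.

(** The hypothesis is applied to the components of [missable]. An edge crossing them is not
    missable, so some forest uses it. By [conn_missable] each forest has at least [n - nc E0] edges
    inside [missable], hence at most [nc E0 - 1] outside. The hypothesis forces equality for every
    forest, and equality means [n - 1] edges. *)
Lemma max_family_trees :
  (forall f : 'I_n -> 'I_n,
     k * (#|f @: setT|.-1) <= #|[set e in E | [exists x in val e, exists y in val e, f x != f y]]|) ->
  forall i, spanning_tree (F0 i).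
Proof.
move=> /(_ (root (adj E0))); rewrite -/(nc E0) => hE.
have [ff fE D] := familyP _ famF0.
pose cr := [set e in E | ~~ joined E0 e].
have {hE} hE : k * (nc E0).-1 <= #|cr|.
  apply: leq_trans hE _; apply: subset_leq_card; apply/subsetP => e.
  rewrite !inE => /andP[-> /exists_inP[x xe /exists_inP[y ye]]].
  rewrite root_conn; apply: contra => /forall_inP H; move/forall_inP: (H x xe); exact.
have crU : cr \subset \bigcup_i (F0 i :\: E0).
  apply/subsetP => e; rewrite inE => /andP[eE nj]; apply/bigcupP.
  have [x [y [_ Ee]]] := edgeP e.
  have eE0 : e \notin E0 by apply: contra nj => eE0; rewrite (joinedE _ Ee) (conn_edge eE0 Ee).
  case: (pickP (fun i => e \in F0 i)) => [i ei | H]; first by exists i; rewrite // in_setD eE0.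
  case/negP: eE0; rewrite inE eE; apply/existsP; exists F0; rewrite connect0 /=.
  by apply/forallP => i; rewrite H.
have cF i : n <= #|F0 i :&: E0| + nc E0.
  by have := nc_ge (F0 i :&: E0); rewrite (nc_eq (conn_missable i)).
have crS : #|cr| <= \sum_i (#|F0 i| - (n - nc E0)).
  apply: leq_trans (subset_leq_card crU) _.
  apply: leq_trans (leq_card_bigcup _) _; apply: leq_sum => i _.
  by have := cF i; have := cardsID E0 (F0 i); lia.
have cE i : #|F0 i| - (n - nc E0) <= (nc E0).-1.
  have /eqP := ff i; have := nc_gt0 (F0 i) n_gt0; have := nc_gt0 E0 n_gt0; lia.
move=> i; apply: forest_tree => //.
have k0 : 0 < k by apply: leq_ltn_trans (ltn_ord i).
(* The other [k - 1] forests contribute at most [nc E0 - 1] each, so the forest [i] must reach this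
   maximum. *)
have sumS : \sum_j (#|F0 j| - (n - nc E0)) <= #|F0 i| - (n - nc E0) + k.-1 * (nc E0).-1.
  rewrite (bigD1 i) //= leq_add2l.
  apply: leq_trans (_ : \sum_(j < k | j != i) (nc E0).-1 <= _).
    by apply: leq_sum => j _; apply: cE.
  by rewrite sum_nat_const (cardC1 i) card_ord.
have := leq_trans hE (leq_trans crS sumS).
have -> : k * (nc E0).-1 = (nc E0).-1 + k.-1 * (nc E0).-1 by rewrite -mulSn prednK.
rewrite leq_add2r.
have := cF i; have := cardsID E0 (F0 i); have /eqP := ff i.
have := nc_gt0 (F0 i) n_gt0; have := nc_gt0 E0 n_gt0.
lia.
Qed.
End Exchange.

(** A partition is encoded by a labelling [f] of the vertices: its parts are the nonempty fibres,
    counted by the image. *)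
Lemma nash_williams :
  (forall f : 'I_n -> 'I_n,
     k * (#|f @: setT|.-1) <= #|[set e in E | [exists x in val e, exists y in val e, f x != f y]]|) ->
  has_k_trees E k.
Proof.
move=> hE.
have fam0 : family [ffun => set0].
  apply/familyP; split=> [i|i|i j e]; rewrite ffunE ?sub0set ?forest0 //.
  by rewrite inE.
case: (arg_maxnP (fun F : {ffun 'I_k -> {set edge n}} => \sum_i #|F i|) fam0) => F0 fF0 maxF0.
have [_ fE D] := familyP _ fF0.
apply/existsP; exists F0; apply/andP; split.
  by apply/forallP => i; rewrite fE andbT; apply: max_family_trees.
by case/andP: fF0.
Qed.
End NashWilliams.

(** * Cuts, partitions and the expansion criterion *)

Section Cuts.
Variable n : nat.
Implicit Types (F : {set edge n}) (U W H : {set 'I_n}) (e : edge n).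

Definition einside F W := #|[set e in F | val e \subset W]|.
Definition cut F U := #|[set e in F | ~~ (val e \subset U) && ~~ (val e \subset ~: U)]|.
Definition crossing F (f : 'I_n -> 'I_n) :=
  [set e in F | [exists x in val e, exists y in val e, f x != f y]].

Lemma sum_deg F U : \sum_(v in U) deg F v = (einside F U).*2 + cut F U.
Proof.
have degE v : deg F v = \sum_(e in F) (v \in val e).
  by rewrite /deg -sum1_card [RHS]big_mkcond /= big_mkcond; apply: eq_bigr => e _; rewrite !inE; case: (e \in F).
have insE : einside F U = \sum_(e in F) (val e \subset U).
  by rewrite /einside -sum1_card [RHS]big_mkcond /= big_mkcond; apply: eq_bigr => e _; rewrite !inE; case: (e \in F).
have cutE : cut F U = \sum_(e in F) (~~ (val e \subset U) && ~~ (val e \subset ~: U)).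
  by rewrite /cut -sum1_card [RHS]big_mkcond /= big_mkcond; apply: eq_bigr => e _; rewrite !inE; case: (e \in F).
rewrite (eq_bigr _ (fun v _ => degE v)) exchange_big /= insE cutE -mul2n big_distrr -big_split /=.
apply: eq_bigr => e _; have [x [y [xy ->]]] := edgeP e.
rewrite -big_mkcondr /= sum1_card !subUset !sub1set !in_setC.
have -> : #|[pred v | (v \in U) && (v \in [set x; y])]| = (x \in U) + (y \in U).
  rewrite (cardD1 x) (cardD1 y) !inE !eqxx [y == x]eq_sym (negPf xy) /= !andbT.
  rewrite (eq_card0 (A := [predD1 _ & y])) ?addn0 // => v; rewrite !inE.
  by case: (v == x); case: (v == y); rewrite ?andbF.
by case: (x \in U); case: (y \in U).
Qed.

Lemma sum_fiber_card (f : 'I_n -> 'I_n) :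
  \sum_(c in f @: setT) #|[set v | f v == c]| = n.
Proof.
rewrite -[RHS]card_ord -[RHS]sum1_card.
rewrite [RHS](partition_big f (fun c => c \in f @: setT)) => [|v _]; last exact: imset_f.
apply: eq_bigr => c _; rewrite -sum1_card; apply: eq_bigl => v; by rewrite !inE.
Qed.

Lemma card_crossing F (f : 'I_n -> 'I_n) :
  #|F| <= #|crossing F f| + \sum_(c in f @: setT) einside F [set v | f v == c].
Proof.
apply: leq_trans (_ : #|crossing F f :|: [set e in F | [exists c in f @: setT, val e \subset [set v | f v == c]]]| <= _).
  apply/subset_leq_card/subsetP => e eF; rewrite !inE eF /= -implyNb.
  apply/implyP; rewrite negb_exists_in => /forall_inP H.
  have [x [y [xy E]]] := edgeP e; apply/exists_inP; exists (f x); first exact: imset_f.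
  have xe : x \in val e by rewrite E set21.
  apply/subsetP => z ze; rewrite inE eq_sym.
  by have := H x xe; rewrite negb_exists_in => /forall_inP/(_ z ze); rewrite negbK.
apply: leq_trans (leq_card_setU _ _) _; rewrite leq_add2l.
have -> : \sum_(c in f @: setT) einside F [set v | f v == c] =
  \sum_c (if c \in f @: setT then einside F [set v | f v == c] else 0) by rewrite big_mkcond.
apply: leq_trans (_ : #|\bigcup_c [set e in F | (c \in f @: setT) && (val e \subset [set v | f v == c])]| <= _).
  apply/subset_leq_card/subsetP => e; rewrite inE => /andP[eF /exists_inP[c cf ec]].
  by apply/bigcupP; exists c => //; rewrite inE eF cf.
apply: leq_trans (leq_card_bigcup _) _; apply: leq_sum => c _.
case: ifP => cf; first by apply/subset_leq_card/subsetP => e; rewrite !inE.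
by rewrite leqn0 cards_eq0; apply/eqP/setP => e; rewrite !inE andbF.
Qed.

Lemma cut_crossing F f c : cut F (~: [set v | f v == c]) <= #|crossing F f|.
Proof.
apply/subset_leq_card/subsetP => e; rewrite !inE setCK => /and3P[-> eU eW] /=.
move: eU eW => /subsetPn[x xe]; rewrite !inE negbK => /eqP fx /subsetPn[y ye].
rewrite inE => fy; apply/exists_inP; exists x => //; apply/exists_inP; exists y => //.
by rewrite fx eq_sym.
Qed.

Lemma has_trees_of_expansion F (t j b : nat) : 0 < n -> t <= j -> j * n.-1 <= #|F| ->
  (forall W, 0 < #|W| -> #|W| + b <= n -> einside F W <= j * #|W|.-1) ->
  (forall U, #|U| < b -> t * #|U| <= cut F U) ->
  has_k_trees F t.
Proof.
move=> n_gt0 tj jF inW cutU; apply: nash_williams => // f; rewrite -/(crossing F f).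
set p := #|f @: setT|.
have [/forall_inP small | ] := boolP [forall c in f @: setT, #|[set v | f v == c]| + b <= n].
  apply: leq_trans (leq_mul tj (leqnn _)) _.
  have inside_le : \sum_(c in f @: setT) einside F [set v | f v == c] + j * p <= j * n.
    have -> : j * n = \sum_(c in f @: setT) j * #|[set v | f v == c]|.
      by rewrite -big_distrr /= sum_fiber_card.
    rewrite /p -sum1_card big_distrr -big_split /=.
    apply: leq_sum => c /imsetP[v _ cE]; have cf : c \in f @: setT by rewrite cE imset_f.
    have c0 : 0 < #|[set v | f v == c]| by apply/card_gt0P; exists v; rewrite inE cE.
    by apply: leq_trans (leq_add (inW _ c0 (small _ cf)) (leqnn _)) _; rewrite muln1 addnC -mulnS prednK.
  have p0 : 0 < p by apply/card_gt0P; exists (f (Ordinal n_gt0)); apply: imset_f.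
  have := card_crossing F f; move: inside_le jF; set s := \sum_(c in _) _.
  have jp : j * p = j + j * p.-1 by rewrite -mulnS prednK.
  have jn : j * n = j + j * n.-1 by rewrite -mulnS prednK.
  by rewrite jp jn; move: (j * p.-1) (j * n.-1) => x y; lia.
rewrite negb_forall_in => /exists_inP[c cf]; rewrite -ltnNge => big.
set U := ~: [set v | f v == c].
have Ub : #|U| < b by have := cardsC [set v | f v == c]; rewrite card_ord -/U; lia.
apply: leq_trans (cut_crossing F f c); apply: leq_trans (cutU _ Ub).
rewrite leq_mul2l; apply/orP; right.
(* Outside [U] the only label is [c], so the partition has at most [#|U| + 1] parts and the cut of
   [U] alone provides enough crossing edges. *)
have : p <= (#|f @: U|).+1.
  apply: leq_trans (_ : #|c |: (f @: U)| <= _); last by rewrite cardsU1; case: (_ \notin _).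
  apply/subset_leq_card/subsetP => _ /imsetP[v _ ->]; rewrite in_setU1.
  by have [//|fv] := eqVneq (f v) c; rewrite imset_f ?orbT // !inE.
by move=> pU; rewrite -subn1 leq_subLR add1n (leq_trans pU) // ltnS leq_imset_card.
Qed.

(** With [H = U :\: low], the degrees in [U] sum to at least [t |U| + (2 k + 2) |H|], while [U]
    spans at most [k |H|] edges inside [H] and [|H|] edges meeting [low]. Passing to the cut
    subtracts twice the spanned edges, which is exactly the surplus [2 k + 2] per vertex of [H]. *)
Lemma cut_of_sparse_low F (t k b : nat) (low : {set 'I_n}) :
  (forall v, t <= deg F v) ->
  (forall v, v \notin low -> t + k.*2.+2 <= deg F v) ->
  (forall e, e \in F -> ~~ (val e \subset low)) ->
  (forall e e' w, e \in F -> e' \in F -> w \notin low -> w \in val e -> w \in val e' ->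
     val e :&: low != set0 -> val e' :&: low != set0 -> e = e') ->
  (forall H, #|H| <= b -> einside F H <= k * #|H|) ->
  forall U, #|U| <= b -> t * #|U| <= cut F U.
Proof.
move=> dt dhigh indep sep sparse U Ub.
have degU := sum_deg F U.
pose H := U :\: low.
have Hle : #|H| <= #|U| by apply/subset_leq_card/subsetDl.
have insU : einside F U <= einside F H + #|H|.
  pose X := [set e in F | (val e \subset U) && (val e :&: low != set0)].
  have Xle : #|X| <= #|H|.
    (* No edge lies inside [low], so each edge of [X] has an end in [H]; by [sep] each vertex of [H]
       is the end of at most one of them. *)
    apply: leq_trans (_ : #|\bigcup_(w : 'I_n) (if w \in H then [set e in X | w \in val e] else set0)| <= _).
      apply/subset_leq_card/subsetP => e eX; move: (eX); rewrite inE => /and3P[eF eU _].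
      have /subsetPn[w we wl] := indep e eF.
      have wH : w \in H by rewrite inE wl (subsetP eU).
      by apply/bigcupP; exists w => //; rewrite wH inE eX we.
    apply: leq_trans (leq_card_bigcup _) _.
    rewrite -sum1_card [leqRHS]big_mkcond; apply: leq_sum => w _ /=.
    case: ifP => wH; last by rewrite cards0.
    apply/card_le1_eqP => e e'; rewrite !inE => /andP[/and3P[eF eU el] we] /andP[/and3P[e'F e'U e'l] we'].
    by move: wH; rewrite inE => /andP[wl _]; apply: (sep e' e w).
  apply: leq_trans (leq_add (leqnn _) Xle).
  apply: leq_trans (leq_card_setU _ _); apply/subset_leq_card/subsetP => e.
  rewrite !inE => /andP[-> eU]; rewrite eU /=.
  have [e0|] := eqVneq (val e :&: low) set0; last by rewrite orbT.
  rewrite orbF; apply/subsetP => w we; rewrite inE (subsetP eU) // andbT.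
  by apply/negP => wl; move/setP: e0 => /(_ w); rewrite in_setI in_set0 we wl.
have Hs := sparse H (leq_trans Hle Ub).
have : t * #|U| + k.*2.+2 * #|H| <= \sum_(v in U) deg F v.
  rewrite -!sum1_card !big_distrr /= (big_mkcond (fun v => v \in U)) (big_mkcond (fun v => v \in H)).
  rewrite -big_split [leqRHS]big_mkcond; apply: leq_sum => v _ /=; rewrite inE.
  case: (v \in U); rewrite ?andbF ?andbT // !muln1.
  by have [vl|vl] := boolP (v \in low) => /=; [rewrite addn0 | apply: dhigh].
rewrite degU mulSn mulSn -mul2n -mulnA; lia.
Qed.

End Cuts.

(** * Stars, and the upper bound on the packing number *)

Lemma card_edge n : #|{: edge n}| = 'C(n, 2).
Proof.
rewrite card_sig -[in RHS](card_ord n) -cardsT -cards_draws cardsE.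
apply: eq_card => A; by rewrite unfold_in [RHS]unfold_in subsetT.
Qed.

Definition star n (v : 'I_n) : {set edge n} := [set e : edge n | v \in val e].

Lemma edge_ex n (x y : 'I_n) : x != y -> exists e : edge n, val e = [set x; y].
Proof.
move=> xy; have P : #|[set x; y]| == 2 by rewrite cards2 xy.
by exists (exist _ [set x; y] P).
Qed.

Lemma set2_inj (U : finType) (v x y : U) : v != x -> [set v; x] = [set v; y] -> x = y.
Proof.
move=> vx /setP/(_ x); rewrite !inE eqxx orbT eq_sym (negPf vx) /=.
by move/esym/eqP.
Qed.

Lemma card_star n (v : 'I_n) : #|star v| = n.-1.
Proof.
pose f (e : edge n) : {set 'I_n} := val e; have f_inj : injective f by exact: val_inj.
rewrite -(card_imset _ f_inj).
have -> : f @: star v = (fun w => [set v; w]) @: [set~ v].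
  apply/setP => A; apply/imsetP/imsetP => [[e ev ->]|[w]]; rewrite ?inE.
    have [x [y [xy E]]] := edgeP e; move: ev; rewrite /f E inE E !inE => /orP[]/eqP->.
      by exists y; rewrite // !inE eq_sym.
    by exists x; rewrite ?inE // setUC.
  by rewrite eq_sym => vw ->; have [e E] := edge_ex vw; exists e; rewrite ?inE /f E ?set21.
rewrite card_in_imset ?cardsC1 ?card_ord // => x y.
by rewrite !inE ![_ == v]eq_sym => vx vy; apply: set2_inj.
Qed.

Lemma degE n (F : {set edge n}) v : deg F v = #|F :&: star v|.
Proof. by rewrite /deg; apply: eq_card => e; rewrite !inE. Qed.

Lemma deg_le n (F : {set edge n}) v : deg F v <= n.-1.
Proof. by rewrite degE -(card_star v) subset_leq_card ?subsetIr. Qed.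

Lemma deg_mono n (F F' : {set edge n}) v : F \subset F' -> deg F v <= deg F' v.
Proof. by move=> sub; rewrite !degE subset_leq_card // setSI. Qed.

Lemma has_k_treesP n (F : {set edge n}) k : reflect
  (exists f : {ffun 'I_k -> {set edge n}}, [/\ forall i, spanning_tree (f i),
     forall i, f i \subset F & forall i j, i != j -> [disjoint f i & f j]])
  (has_k_trees F k).
Proof.
apply: (iffP existsP) => -[f].
  case/andP=> /forallP H /forallP D; exists f; split=> [i|i|i j ij].
  - by case/andP: (H i).
  - by case/andP: (H i).
  - by move/forallP: (D i) => /(_ j)/implyP; apply.
case=> H1 H2 D; exists f; apply/andP; split; apply/forallP => i; first by rewrite H1 H2.
by apply/forallP => j; apply/implyP; apply: D.
Qed.

Lemma card_bigcup_disjoint (I U : finType) (A : I -> {set U}) :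
  (forall i j, i != j -> [disjoint A i & A j]) -> #|\bigcup_i A i| = \sum_i #|A i|.
Proof.
move=> D.
rewrite -sum1_card (eq_bigr (fun i => \sum_(x in A i) 1)) => [|i _]; last by rewrite sum1_card.
by rewrite partition_disjoint_bigcup.
Qed.

Lemma has_k_trees_card n (F : {set edge n}) k : has_k_trees F k -> k * n.-1 <= #|F|.
Proof.
case/has_k_treesP=> f [st sF D].
have <- : #|\bigcup_i f i| = k * n.-1.
  rewrite (card_bigcup_disjoint D) (eq_bigr (fun=> n.-1)) => [|i _].
    by rewrite sum_nat_const card_ord.
  by case/andP: (st i) => _ /eqP.
by apply/subset_leq_card/bigcupsP => i _.
Qed.

Lemma has_k_trees_deg n (F : {set edge n}) k v : 1 < n -> has_k_trees F k -> k <= deg F v.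
Proof.
move=> n1 /has_k_treesP[f [st sF D]].
pose A i := [set e in f i | v \in val e].
have <- : \sum_(i < k) 1 = k by rewrite sum1_card card_ord.
apply: (@leq_trans (\sum_i #|A i|)).
  apply: leq_sum => i _; apply/card_gt0P.
  have [w wv] : exists w : 'I_n, w != v.
    have : 0 < #|predC1 v| by rewrite cardC1 card_ord; lia.
    by case/card_gt0P => w; exists w.
  case/andP: (st i) => /forallP/(_ v)/forallP/(_ w)/connectP[[|u p] /=].
    by move=> _ wE; rewrite wE eqxx in wv.
  by case/andP=> /adjP[e ei E] _ _; exists e; rewrite inE ei E set21.
rewrite -card_bigcup_disjoint => [|i j /D dij].
  by apply/subset_leq_card/bigcupsP => i _; apply/subsetP => e; rewrite !inE => /andP[/(subsetP (sF i)) -> ->].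
by apply: disjointWl (disjointWr _ dij); apply/subsetP => e; rewrite inE => /andP[].
Qed.

Lemma T_ge n (F : {set edge n}) k : 1 < n -> has_k_trees F k -> k <= T F.
Proof.
move=> n1 Fk; have := has_k_trees_card Fk => kF.
have kN : k < #|{: edge n}|.+1.
  rewrite ltnS; apply: leq_trans (_ : k * n.-1 <= _); first by rewrite leq_pmulr //; lia.
  by apply: leq_trans kF _; exact: max_card.
exact: (@leq_bigmax_cond _ _ (fun k : 'I_(#|{: edge n}|.+1) => k : nat) (Ordinal kN)).
Qed.

Lemma T_le n (F : {set edge n}) a : (forall k, has_k_trees F k -> k <= a) -> T F <= a.
Proof. by move=> H; apply/bigmax_leqP => k; apply: H. Qed.

Lemma mindeg_le n (F : {set edge n}) v : mindeg F <= deg F v.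
Proof.
rewrite /mindeg; elim: (index_enum _) (mem_index_enum v) => // w r IH.
rewrite big_cons in_cons => /orP[/eqP <-|/IH]; first exact: geq_minl.
exact: leq_trans (geq_minr _ _).
Qed.

Lemma leq_mindeg n (F : {set edge n}) t :
  t <= n -> (forall v, t <= deg F v) -> t <= mindeg F.
Proof.
move=> tn H; rewrite /mindeg; apply: (big_ind (fun m => t <= m)) => //.
by move=> x y tx ty; rewrite leq_min tx.
Qed.

Lemma T_le_min n (F : {set edge n}) : 1 < n -> T F <= minn (mindeg F) (#|F| %/ n.-1).
Proof.
move=> n1; apply: T_le => k Fk; rewrite leq_min leq_divRL ?(has_k_trees_card Fk) ?andbT; last by lia.
apply: leq_mindeg => [|v]; last exact: has_k_trees_deg.
apply: leq_trans (has_k_trees_deg (Ordinal (ltnW n1)) n1 Fk) _.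
by apply: leq_trans (deg_le _ _) (leq_pred _).
Qed.

Lemma mindeg_deg n (F : {set edge n}) t : 0 < n ->
  (t <= mindeg F) = [forall v, t <= deg F v] .
Proof.
move=> n0; apply/idP/forallP => [tF v|H]; first exact: leq_trans tF (mindeg_le F v).
apply: leq_mindeg => //; apply: leq_trans (H (Ordinal n0)) _.
by apply: leq_trans (deg_le _ _) (leq_pred _).
Qed.

(** * Uniform random permutations and sampling without replacement *)

Fact RplusA : associative Rplus. Proof. by move=> x y z; rewrite Rplus_assoc. Qed.
Fact RmultA : associative Rmult. Proof. by move=> x y z; rewrite Rmult_assoc. Qed.
Fact RmultDl : left_distributive Rmult Rplus. Proof. by move=> x y z; apply: Rmult_plus_distr_r. Qed.
Fact RmultDr : right_distributive Rmult Rplus. Proof. by move=> x y z; apply: Rmult_plus_distr_l. Qed.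
HB.instance Definition _ := Monoid.isComLaw.Build R R0 Rplus RplusA Rplus_comm Rplus_0_l.
HB.instance Definition _ := Monoid.isComLaw.Build R R1 Rmult RmultA Rmult_comm Rmult_1_l.
HB.instance Definition _ := Monoid.isMulLaw.Build R R0 Rmult Rmult_0_l Rmult_0_r.
HB.instance Definition _ := Monoid.isAddLaw.Build R Rmult Rplus RmultDl RmultDr.

Local Open Scope R_scope.

Notation "\rsum_ i F" := (\big[Rplus/R0]_i F%R)
  (at level 41, F at level 41, i at level 0, format "'[' \rsum_ i '/  '  F ']'") : R_scope.
Notation "\rsum_ ( i | P ) F" := (\big[Rplus/R0]_(i | P%B) F%R)
  (at level 41, F at level 41, i at level 50) : R_scope.
Notation "\rsum_ ( i : t | P ) F" := (\big[Rplus/R0]_(i : t | P%B) F%R)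
  (at level 41, F at level 41, i at level 50) : R_scope.
Notation "\rsum_ ( i 'in' A ) F" := (\big[Rplus/R0]_(i in A) F%R)
  (at level 41, F at level 41, i, A at level 50) : R_scope.
Notation "\rsum_ ( i < n ) F" := (\big[Rplus/R0]_(i < n) F%R)
  (at level 41, F at level 41, i, n at level 50) : R_scope.


Section Sums.
Variables (I : finType).
Implicit Types (P Q : pred I) (f g : I -> R).

Lemma rsum_le P f g : (forall i, P i -> f i <= g i) ->
  \rsum_(i | P i) f i <= \rsum_(i | P i) g i.
Proof. by move=> H; apply: (big_ind2 Rle) => //; [lra | move=> *; lra]. Qed.

Lemma rsum_ge0 P f : (forall i, P i -> 0 <= f i) -> 0 <= \rsum_(i | P i) f i.
Proof. by move=> H; apply: (big_ind (Rle 0)) => //; [lra | move=> *; lra]. Qed.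

Lemma rsum_const P c : \rsum_(i | P i) c = INR #|P| * c.
Proof.
rewrite big_const; elim: #|P| => [|m IH]; first by rewrite Rmult_0_l.
by rewrite iterS IH S_INR; lra.
Qed.

Lemma rsum_mulr P f c : (\rsum_(i | P i) f i) * c = \rsum_(i | P i) (f i * c).
Proof. exact: big_distrl. Qed.

Lemma rsum_mull P f c : c * (\rsum_(i | P i) f i) = \rsum_(i | P i) (c * f i).
Proof. exact: big_distrr. Qed.

Lemma INR_sum P (h : I -> nat) : INR (\sum_(i | P i) h i) = \rsum_(i | P i) INR (h i).
Proof. by apply: (big_morph INR) => [x y|] //; rewrite plus_INR. Qed.

Lemma INR_card P : INR #|P| = \rsum_i INR (P i).
Proof. by rewrite -sum1_card big_mkcond INR_sum; apply: eq_bigr => i _; rewrite unfold_in; case: (P i). Qed.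
End Sums.

Section Probability.
Variable U : finType.
Local Notation perms := {perm U}.
Implicit Types (A B : pred perms) (X Y : perms -> R).

Definition Pr A : R := INR #|[set s | A s]| / INR #|[set: perms]|.
Definition Ex X : R := (\rsum_s X s) / INR #|[set: perms]|.

Lemma card_perms_gt0 : 0 < INR #|[set: perms]|.
Proof. by apply: lt_0_INR; apply/ltP; apply/card_gt0P; exists 1%g; rewrite inE. Qed.

Lemma PrE A : Pr A = Ex (fun s => INR (A s)).
Proof. by rewrite /Pr /Ex cardsE INR_card. Qed.

Lemma Ex_le X Y : (forall s, X s <= Y s) -> Ex X <= Ex Y.
Proof.
move=> H; apply: Rmult_le_compat_r; first by apply: Rlt_le; apply: Rinv_0_lt_compat card_perms_gt0.
exact: rsum_le.
Qed.

Lemma eq_Ex X Y : X =1 Y -> Ex X = Ex Y.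
Proof. by move=> H; rewrite /Ex (eq_bigr _ (fun s _ => H s)). Qed.

Lemma eq_Pr A B : A =1 B -> Pr A = Pr B.
Proof. by move=> H; rewrite !PrE; apply: eq_Ex => s; rewrite H. Qed.

Lemma ExD X Y : Ex (fun s => X s + Y s) = Ex X + Ex Y.
Proof. by rewrite /Ex big_split /= -Rmult_plus_distr_r. Qed.

Lemma ExZ c X : Ex (fun s => c * X s) = c * Ex X.
Proof. by rewrite /Ex -rsum_mull /Rdiv Rmult_assoc. Qed.

Lemma Ex1 c : Ex (fun=> c) = c.
Proof.
have := card_perms_gt0; rewrite /Ex rsum_const.
have -> : #|(fun _ : perms => true)| = #|[set: perms]| by apply: eq_card => s; rewrite inE.
by move=> H; field; lra.
Qed.

Lemma Ex_sum (I : finType) (P : pred I) (X : I -> perms -> R) :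
  Ex (fun s => \rsum_(i | P i) X i s) = \rsum_(i | P i) Ex (X i).
Proof. by rewrite /Ex exchange_big /= /Rdiv rsum_mulr. Qed.

Lemma Pr_le A B : (forall s, A s -> B s) -> Pr A <= Pr B.
Proof.
move=> H; rewrite !PrE; apply: Ex_le => s; apply: le_INR.
by apply/leP; case: (A s) (H s) => // ->.
Qed.

Lemma Pr_ge0 A : 0 <= Pr A.
Proof. by rewrite PrE -(Ex1 0); apply: Ex_le => s; apply: pos_INR. Qed.

Lemma Pr_le1 A : Pr A <= 1.
Proof. by rewrite PrE -(Ex1 1); apply: Ex_le => s; case: (A s) => /=; lra. Qed.

Lemma PrC A : Pr (fun s => ~~ A s) = 1 - Pr A.
Proof.
have : Pr (fun s => ~~ A s) + Pr A = 1.
  by rewrite !PrE -ExD -(Ex1 1); apply: eq_Ex => s; case: (A s) => /=; lra.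
lra.
Qed.

Lemma PrU A B : Pr (fun s => A s || B s) <= Pr A + Pr B.
Proof.
by rewrite !PrE -ExD; apply: Ex_le => s; case: (A s); case: (B s) => /=; lra.
Qed.

Lemma Pr_exists (I : finType) (P : pred I) (A : I -> pred perms) :
  Pr (fun s => [exists i, P i && A i s]) <= \rsum_(i | P i) Pr (A i).
Proof.
have -> : \rsum_(i | P i) Pr (A i) = \rsum_(i | P i) Ex (fun s => INR (A i s)).
  by apply: eq_bigr => i _; rewrite PrE.
rewrite -Ex_sum PrE; apply: Ex_le => s; case: existsP => [[i /andP[Pi Ai]]|_].
  rewrite (bigD1 i) //= Ai.
  have := @rsum_ge0 _ (fun j => P j && (j != i)) (fun i => INR (A i s)) (fun _ _ => pos_INR _).
  by move=> /=; lra.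
by apply: rsum_ge0 => i _; apply: pos_INR.
Qed.

Lemma markov A X c : 0 < c -> (forall s, 0 <= X s) -> (forall s, A s -> c <= X s) ->
  Pr A <= Ex X / c.
Proof.
move=> c0 X0 AX; rewrite PrE /Rdiv Rmult_comm -ExZ; apply: Ex_le => s.
have ic := Rinv_0_lt_compat _ c0.
case As: (A s) => /=; last by apply: Rmult_le_pos => //; lra.
rewrite -(Rinv_l c); last lra.
by apply: Rmult_le_compat_l; [lra | apply: AX].
Qed.

Lemma Ex_mull (t : perms) X : Ex (fun s => X (t * s)%g) = Ex X.
Proof. by rewrite /Ex [in RHS](reindex_inj (mulgI t)). Qed.

Section Window.
Variable W : {set U}.
Local Notation N := (INR #|U|).
Local Notation M := (INR #|W|).

Implicit Types (I J : {set U}) (x y : U) (s : perms).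

(** [W] is a set of positions in the ordering. Allowing any [W], not only initial segments, lets the
    same estimates serve the complement and the edges added between two grid points. *)
Definition sampled (s : perms) : {set U} := [set x | s x \in W].

Lemma card_sampled s : #|sampled s| = #|W|.
Proof.
rewrite -(card_imset _ (@perm_inj _ s)); apply: eq_card => y.
apply/imsetP/idP => [[x] | yW]; first by rewrite inE => ? ->.
by exists (s^-1 y)%g; rewrite ?inE permKV.
Qed.

Definition hits (I J : {set U}) (s : perms) := (I \subset sampled s) && [disjoint J & sampled s].

Lemma sampled_tperm x y s : sampled (tperm x y * s)%g = [set z | tperm x y z \in sampled s].
Proof. by apply/setP => z; rewrite !inE permM. Qed.

(** Composing with the transposition of [x] and [y] preserves the uniform law and fixes [I] and [J]
    pointwise. *)
Lemma hits_sym (I J : {set U}) x y : x \notin I :|: J -> y \notin I :|: J ->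
  Pr (hits (x |: I) J) = Pr (hits (y |: I) J).
Proof.
rewrite !in_setU !negb_or => /andP[xI xJ] /andP[yI yJ].
rewrite !PrE -[RHS](Ex_mull (tperm x y)); apply: eq_Ex => s; congr (INR (nat_of_bool _)).
rewrite /hits sampled_tperm !subUset !sub1set inE tpermR.
have tI z : z \in I -> tperm x y z = z.
  by move=> zI; apply: tpermD; [apply: contraNneq xI | apply: contraNneq yI] => ->.
have tJ z : z \in J -> tperm x y z = z.
  by move=> zJ; apply: tpermD; [apply: contraNneq xJ | apply: contraNneq yJ] => ->.
congr (_ && _ && _).
  by apply/subsetP/subsetP => H z zI; have := H z zI; rewrite inE tI.
rewrite !disjoint_subset; apply/subsetP/subsetP => H z zJ; have := H z zJ; rewrite !inE.
  by rewrite tJ.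
by rewrite tJ.
Qed.

Lemma hits_count I J s : [disjoint I & J] -> hits I J s ->
  \sum_(y | y \notin I :|: J) nat_of_bool (y \in sampled s) = (#|W| - #|I|)%nat.
Proof.
move=> IJ /andP[Is Js].
rewrite -big_mkcondr /= sum1_card -(card_sampled s).
rewrite -(cardsID I (sampled s)) (setIidPr Is) addKn.
apply: eq_card => y; rewrite unfold_in /= !inE negb_or.
have [yW|] := boolP (s y \in W); rewrite ?andbF // !andbT.
have -> : y \in J = false by apply: (disjointFl Js); rewrite inE.
by rewrite andbT.
Qed.

(* By symmetry the probability does not depend on [x]; summed over all admissible [x] it
   counts the elements still to be hit. *)
Lemma hits_in I J x : [disjoint I & J] -> x \notin I :|: J ->
  (N - INR (#|I| + #|J|)) * Pr (hits (x |: I) J) = (M - INR #|I|) * Pr (hits I J).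
Proof.
move=> IJ xIJ.
have -> : N - INR (#|I| + #|J|) = INR #|[pred y | y \notin I :|: J]|.
  have -> : #|U| = (#|I| + #|J| + #|[pred y | y \notin I :|: J]|)%nat.
    rewrite -(cardC (mem (I :|: J))) cardsU.
    by have := IJ; rewrite -setI_eq0 => /eqP ->; rewrite cards0 subn0.
  by rewrite !plus_INR; lra.
rewrite -rsum_const.
have -> : \rsum_(i in [pred y | y \notin I :|: J]) Pr (hits (x |: I) J) =
   \rsum_(y | y \notin I :|: J) Ex (fun s => INR (hits (y |: I) J s)).
  by apply: eq_bigr => y yIJ; rewrite -PrE; apply: hits_sym.
rewrite -Ex_sum PrE -ExZ; apply: eq_Ex => s.
rewrite -INR_sum.
have -> : (\sum_(y | y \notin I :|: J) hits (y |: I) J s =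
   hits I J s * \sum_(y | y \notin I :|: J) (y \in sampled s))%nat.
  rewrite big_distrr; apply: eq_bigr => y _.
  rewrite /hits subUset sub1set.
  by case: (y \in sampled s); case: (I \subset _); case: [disjoint _ & _].
case h : (hits I J s); last by rewrite mul0n /=; lra.
rewrite mul1n (hits_count IJ h) minus_INR /=; first lra.
by apply/leP; rewrite -(card_sampled s); apply: subset_leq_card; case/andP: h.
Qed.

Lemma hits_split I J x :
  Pr (hits (x |: I) J) + Pr (hits I (x |: J)) = Pr (hits I J).
Proof.
rewrite !PrE -ExD; apply: eq_Ex => s; rewrite /hits subUset sub1set.
have -> : [disjoint x |: J & sampled s] = (x \notin sampled s) && [disjoint J & sampled s].
  by rewrite -disjointU1; apply: eq_disjoint => y; rewrite !inE.
by case: (x \in sampled s); case: (I \subset _); case: [disjoint _ & _] => /=; lra.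
Qed.

Lemma hits_out I J x : [disjoint I & J] -> x \notin I :|: J ->
  (N - INR (#|I| + #|J|)) * Pr (hits I (x |: J)) = (N - M - INR #|J|) * Pr (hits I J).
Proof.
move=> IJ xIJ; have := hits_in IJ xIJ; have := hits_split I J x; rewrite plus_INR; nra.
Qed.

End Window.
End Probability.

(** * Exponential tail bounds for sampling without replacement *)

Lemma pow_le_exp x m : 0 <= 1 + x -> (1 + x) ^ m <= exp (INR m * x).
Proof.
move=> x0; elim: m => [|m IH]; first by rewrite Rmult_0_l exp_0; lra.
rewrite S_INR -tech_pow_Rmult.
have -> : (INR m + 1) * x = x + INR m * x by ring.
rewrite exp_plus.
apply: Rmult_le_compat => //; first exact: pow_le.
exact: exp_ineq1_le.
Qed.

Section Concentration.
Variables (U : finType) (W : {set U}).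
Local Notation N := (INR #|U|).
Local Notation M := (INR #|W|).
Implicit Types (A B I J : {set U}) (s : {perm U}).
Local Notation F := (sampled W).

Lemma card_window_le : M <= N.
Proof. by apply: le_INR; apply/leP; apply: max_card. Qed.

(** Once [I] is hit, a further element is hit with probability [(M - |I|) / (N - |I|) <= M / N].
    This negative correlation is what lets the moment generating function be dominated by the
    binomial one. *)
Lemma hits_sub_in I x : x \notin I -> Pr (hits W (x |: I) set0) <= M / N * Pr (hits W I set0).
Proof.
move=> xI; have := @hits_in _ W I set0 x; rewrite setU0 cards0 addn0.
have -> : [disjoint I & set0] by rewrite -setI_eq0 setI0.
move=> /(_ isT xI) H; have MN := card_window_le; have i0 := pos_INR #|I|.
have iN : INR #|I| < N.
  apply: lt_INR; apply/ltP; rewrite -cardsT; apply: proper_card; apply/properP; split=> //.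
  by exists x; rewrite ?inE.
have P0 := Pr_ge0 (hits W I set0); have P1 := Pr_ge0 (hits W (x |: I) set0).
apply: (Rmult_le_reg_l ((N - INR #|I|) * N)); first by apply: Rmult_lt_0_compat; lra.
have -> : (N - INR #|I|) * N * (M / N * Pr (hits W I set0)) = (N - INR #|I|) * M * Pr (hits W I set0) by field; lra.
have -> : (N - INR #|I|) * N * Pr (hits W (x |: I) set0) = N * ((M - INR #|I|) * Pr (hits W I set0)) by rewrite -H; ring.
rewrite -Rmult_assoc; apply: Rmult_le_compat_r => //; nra.
Qed.

(* The expectation on the left is restricted to the event [I \subset F s] so that the
   induction on [A] can condition on the elements of [A] already known to be hit. *)
Lemma mgf_cond x A I : 1 <= x -> [disjoint I & A] ->
  Ex (fun s => INR (I \subset F s) * x ^ #|F s :&: A|) <=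
  Pr (hits W I set0) * (1 + (x - 1) * (M / N)) ^ #|A|.
Proof.
move=> x1; move: {2}#|A| (erefl #|A|) => m; elim: m A I => [|m IH] A I.
  move=> cA _; rewrite cA Rmult_1_r PrE; right; apply: eq_Ex => s.
  rewrite /hits -setI_eq0 set0I eqxx andbT.
  by move/eqP: cA; rewrite cards_eq0 => /eqP ->; rewrite setI0 cards0 Rmult_1_r.
case: (set_0Vmem A) => [-> | [y yA]]; first by rewrite cards0.
rewrite (cardsD1 y) yA => -[cA] IA.
have yI : y \notin I by rewrite (disjointFl IA yA).
have dI : [disjoint I & A :\ y] by apply: disjointWr IA; apply: subsetDl.
have dyI : [disjoint y |: I & A :\ y].
  by rewrite -setI_eq0 setIUl; move: dI; rewrite -setI_eq0 => /eqP ->; rewrite setU0 setI_eq0 disjoints1 !inE eqxx.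
have P0 := Pr_ge0 (hits W I set0).
have MN : 0 <= M / N.
  by case: (Rle_lt_or_eq_dec 0 N (pos_INR _)) => [n0|<-]; [apply: Rmult_le_pos; [apply: pos_INR | apply/Rlt_le/Rinv_0_lt_compat] | rewrite /Rdiv Rinv_0; lra].
(* The factor of [y] is 1 plus [x - 1] times the indicator that [y] is hit; the second term moves
   [y] into the conditioning set. *)
have -> : Ex (fun s => INR (I \subset F s) * x ^ #|F s :&: A|) =
  Ex (fun s => INR (I \subset F s) * x ^ #|F s :&: (A :\ y)|) +
  (x - 1) * Ex (fun s => INR ((y |: I) \subset F s) * x ^ #|F s :&: (A :\ y)|).
  rewrite -ExZ -ExD; apply: eq_Ex => s.
  rewrite (cardsD1 y (F s :&: A)) in_setI yA andbT subUset sub1set.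
  have -> : (F s :&: A) :\ y = F s :&: (A :\ y) by rewrite setIDA.
  by case: (y \in F s); rewrite ?add1n ?add0n /=; ring.
have H1 := IH _ _ cA dI; have H2 := IH _ _ cA dyI; have H3 := hits_sub_in yI.
rewrite add1n -tech_pow_Rmult.
set p := (1 + _) ^ _ in H1 H2 *.
have p0 : 0 <= p by apply: pow_le; nra.
apply: (Rle_trans _ (Pr (hits W I set0) * p + (x - 1) * (M / N * Pr (hits W I set0) * p))); last by right; ring.
apply: Rplus_le_compat => //; apply: Rmult_le_compat_l; first lra.
apply: Rle_trans H2 _; exact: Rmult_le_compat_r.
Qed.

Lemma mgf_bound x A : 1 <= x ->
  Ex (fun s => x ^ #|F s :&: A|) <= (1 + (x - 1) * (M / N)) ^ #|A|.
Proof.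
move=> x1; have d0 : [disjoint set0 & A] by rewrite -setI_eq0 set0I.
have := mgf_cond x1 d0.
have -> : Pr (hits W set0 set0) = 1.
  by rewrite PrE -(Ex1 U 1); apply: eq_Ex => s; rewrite /hits sub0set -setI_eq0 set0I eqxx.
rewrite Rmult_1_l; apply: Rle_trans; right; apply: eq_Ex => s.
by rewrite sub0set Rmult_1_l.
Qed.

Lemma chernoff_upper x A k : 1 <= x ->
  Pr (fun s => (k <= #|F s :&: A|)%nat) <= exp ((x - 1) * (M / N) * INR #|A|) / x ^ k.
Proof.
move=> x1.
apply: Rle_trans (markov (X := fun s => x ^ #|F s :&: A|) (c := x ^ k) _ _ _) _.
- by apply: pow_lt; lra.
- by move=> s; apply: pow_le; lra.
- by move=> s ks; apply: Rle_pow => //; apply/leP.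
apply: Rmult_le_compat_r; first by apply/Rlt_le/Rinv_0_lt_compat/pow_lt; lra.
apply: Rle_trans (mgf_bound A x1) _; rewrite (Rmult_comm _ (INR _)); apply: pow_le_exp.
have : 0 <= (x - 1) * (M / N); last lra.
apply: Rmult_le_pos; first lra.
case: (Rle_lt_or_eq_dec 0 N (pos_INR _)) => [n0|<-]; last by rewrite /Rdiv Rinv_0; lra.
by apply: Rmult_le_pos; [apply: pos_INR | apply/Rlt_le/Rinv_0_lt_compat].
Qed.
End Concentration.

Lemma sampled_setC (U : finType) (W : {set U}) s : sampled (~: W) s = ~: sampled W s.
Proof. by apply/setP => x; rewrite !inE. Qed.

(* The factor [2 ^ k] is [x ^ k] for [x = 2], in a Chernoff bound for the complementary window. *)
Lemma chernoff_lower (U : finType) (W A : {set U}) k : (0 < #|U|)%nat ->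
  Pr (fun s => (#|sampled W s :&: A| <= k)%nat) <=
  2 ^ k * exp (- (INR #|W| * INR #|A| / (2 * INR #|U|))).
Proof.
move=> U0; have N0 : 0 < INR #|U| by apply: lt_0_INR; apply/ltP.
have WU := card_window_le W; have W0 := pos_INR #|W|.
have x12 : 1 <= 2 by lra.
have p2 m : 0 < 2 ^ m by apply: pow_lt; lra.
apply: Rle_trans (markov (X := fun s => 2 ^ k * 2 ^ #|sampled (~: W) s :&: A|) (c := 2 ^ #|A|) (p2 _) _ _) _.
- by move=> s; apply: Rmult_le_pos; apply: Rlt_le.
- move=> s ks; rewrite -pow_add; apply: Rle_pow => //; apply/leP.
  by rewrite sampled_setC -(cardsID (sampled W s) A) setIC leq_add // setDE setIC.
rewrite ExZ /Rdiv Rmult_assoc; apply: Rmult_le_compat_l; first exact: Rlt_le.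
have := mgf_bound (~: W) A x12; set E := Ex _ => HE.
have WC : INR #|~: W| = INR #|U| - INR #|W|.
  by rewrite -(cardsC W) plus_INR; lra.
rewrite WC in HE.
have {HE} HE : E <= (2 * (1 + - (INR #|W| / (2 * INR #|U|)))) ^ #|A|.
  apply: Rle_trans HE _; right; congr (_ ^ _); field; lra.
rewrite Rpow_mult_distr in HE.
apply: (Rmult_le_reg_l (2 ^ #|A|)) => //.
have -> : 2 ^ #|A| * (E * / 2 ^ #|A|) = E by field; have := p2 #|A|; lra.
apply: Rle_trans HE _; apply: Rmult_le_compat_l; first exact: Rlt_le.
apply: Rle_trans (pow_le_exp _ _) _.
  have : INR #|W| / (2 * INR #|U|) <= 1; last lra.
  apply: (Rmult_le_reg_l (2 * INR #|U|)); first lra.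
  have -> : 2 * INR #|U| * (INR #|W| / (2 * INR #|U|)) = INR #|W| by field; lra.
  lra.
by right; congr exp; rewrite /Rdiv; ring.
Qed.

(** * Exact sampling weights and near independence *)

Lemma exp_le_mono x y : x <= y -> exp x <= exp y.
Proof. by case=> [/exp_increasing|->]; lra. Qed.

(** The falling factorial [x (x - 1) ... (x - k + 1)]. *)
Fixpoint ff (x : R) (k : nat) : R := if k is m.+1 then ff x m * (x - INR m) else 1.

Lemma ff_ge0 m k : 0 <= ff (INR m) k.
Proof.
elim: k => [|k IH] /=; first lra.
have [km|mk] := leqP k m.
  by apply: Rmult_le_pos => //; have := le_INR _ _ (elimT leP km); lra.
suff -> : ff (INR m) k = 0 by lra.
elim: k mk {IH} => // k IH; rewrite ltnS leq_eqVlt => /orP[/eqP <- /=|/IH /= ->]; ring.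
Qed.

Lemma ff_gt0 m k : (k <= m)%nat -> 0 < ff (INR m) k.
Proof.
elim: k => [|k IH] km /=; first lra.
apply: Rmult_lt_0_compat; first exact/IH/ltnW.
by have := lt_INR _ _ (elimT ltP km); lra.
Qed.

(* [weight N M i j] is the probability that [i] given elements belong, and [j] other
   given elements do not belong, to a uniform [M]-subset of an [N]-set. *)
Definition weight (N M i j : nat) : R :=
  ff (INR M) i * ff (INR (N - M)) j / ff (INR N) (i + j).

Section Weights.
Variables N M : nat.
Hypothesis MN : (M <= N)%nat.
Local Notation wt := (weight N M).
Local Notation Nr := (INR N).
Local Notation Mr := (INR M).

Lemma wt_ge0 i j : (i + j <= N)%nat -> 0 <= wt i j.
Proof.
move=> ij; apply: Rmult_le_pos; last exact/Rlt_le/Rinv_0_lt_compat/ff_gt0.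
by apply: Rmult_le_pos; apply: ff_ge0.
Qed.

Lemma wt_gt0 i j : (i <= M)%nat -> (j <= N - M)%nat -> 0 < wt i j.
Proof.
move=> iM jM; apply: Rmult_lt_0_compat; last by apply/Rinv_0_lt_compat/ff_gt0; lia.
by apply: Rmult_lt_0_compat; apply: ff_gt0.
Qed.

Lemma wtSl i j : (i + j < N)%nat -> wt i.+1 j = wt i j * ((Mr - INR i) / (Nr - INR (i + j))).
Proof.
move=> ij; have f0 := ff_gt0 (ltnW ij).
have d0 : Nr - INR (i + j) > 0 by have := lt_INR _ _ (elimT ltP ij); lra.
by rewrite /weight addSn /=; field; lra.
Qed.

Lemma wtSr i j : (i + j < N)%nat -> wt i j.+1 = wt i j * ((Nr - Mr - INR j) / (Nr - INR (i + j))).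
Proof.
move=> ij; have f0 := ff_gt0 (ltnW ij).
have d0 : Nr - INR (i + j) > 0 by have := lt_INR _ _ (elimT ltP ij); lra.
by rewrite /weight addnS /= minus_INR; [field; lra | apply/leP].
Qed.

Lemma wt00 : wt 0 0 = 1.
Proof. by rewrite /weight /=; field. Qed.

Section QuasiIndependence.
Variables a k : nat.
Hypotheses (aN : (4 * a <= N)%nat) (M4 : (4 * M <= N)%nat) (kM : (k <= M)%nat) (ka : (k <= a)%nat).
Hypothesis a0 : (0 < a)%nat.

Let aNr : 4 * INR a <= Nr.
Proof. by have := le_INR _ _ (elimT leP aN); rewrite mult_INR /=; lra. Qed.
Let M4r : 4 * Mr <= Nr.
Proof. by have := le_INR _ _ (elimT leP M4); rewrite mult_INR /=; lra. Qed.
Let a0r : 1 <= INR a.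
Proof. by have := le_INR _ _ (elimT leP a0). Qed.

(** At most [3 a <= 3 N / 4] elements are already decided, so each further hit has conditional
    probability at most [M / (N - 3 a) <= 4 M / N]. *)
Lemma wt_more c i j : (i + j <= 2 * a)%nat -> (c <= a)%nat ->
  wt (i + c) j <= (4 * Mr / Nr) ^ c * wt i j.
Proof.
move=> ij; elim: c => [|c IH] ca; first by rewrite addn0 /=; lra.
rewrite addnS wtSl; last lia.
have w0 : 0 <= wt (i + c) j by apply: wt_ge0; lia.
have {}IH := IH (ltnW ca).
have q0 : 0 <= 4 * Mr / Nr.
  apply: Rmult_le_pos; [have := pos_INR M; lra | apply/Rlt_le/Rinv_0_lt_compat; lra].
have q : (Mr - INR (i + c)) / (Nr - INR (i + c + j)) <= 4 * Mr / Nr.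
  have h1 : INR (i + c + j) <= 3 * INR a.
    have : (i + c + j <= 3 * a)%nat by lia.
    by move/leP/le_INR; rewrite mult_INR /=; lra.
  have h2 := pos_INR (i + c); have h3 := pos_INR M.
  apply: (Rmult_le_reg_r (Nr - INR (i + c + j))); first lra.
  rewrite /Rdiv Rmult_assoc Rinv_l ?Rmult_1_r; last lra.
  apply: (Rmult_le_reg_r Nr); first lra.
  have -> : 4 * Mr * / Nr * (Nr - INR (i + c + j)) * Nr = 4 * Mr * (Nr - INR (i + c + j)) by field; lra.
  nra.
rewrite -tech_pow_Rmult Rmult_comm.
apply: Rle_trans (Rmult_le_compat_r _ _ _ w0 q) _.
rewrite Rmult_assoc; exact: Rmult_le_compat_l.
Qed.

Lemma wt_join_in i i' j : (i + i' <= a)%nat -> (j <= k)%nat ->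
  wt (i + j) i' <= (1 + 2 * INR a / Nr) ^ j * (wt i i' * wt j 0).
Proof.
move=> ia; elim: j => [|j IH] jk; first by rewrite addn0 wt00 /=; lra.
have {}IH := IH (ltnW jk).
rewrite addnS wtSl; last lia. rewrite (@wtSl j); last lia.
have w0 : 0 <= wt (i + j) i' by apply: wt_ge0; lia.
have w1 : 0 <= wt i i' by apply: wt_ge0; lia.
have w2 : 0 <= wt j 0 by apply: wt_ge0; lia.
have jM : INR j <= Mr by apply/le_INR/leP; lia.
have ja : INR j <= INR a by apply/le_INR/leP; lia.
have ia' : INR i + INR i' <= INR a by rewrite -plus_INR; apply/le_INR/leP.
have hi := pos_INR i; have hi' := pos_INR i'; have hj := pos_INR j.
rewrite addn0 !plus_INR.
set d := 1 + 2 * INR a / Nr.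
have d0 : 0 <= 2 * INR a / Nr by apply: Rmult_le_pos; [lra | apply/Rlt_le/Rinv_0_lt_compat; lra].
have q : (Mr - (INR i + INR j)) / (Nr - (INR i + INR j + INR i')) <= d * ((Mr - INR j) / (Nr - INR j)).
  apply: (Rmult_le_reg_r (Nr - (INR i + INR j + INR i'))); first lra.
  rewrite /Rdiv Rmult_assoc Rinv_l ?Rmult_1_r; last lra.
  apply: Rle_trans (_ : Mr - INR j <= _); first lra.
  have -> : d * ((Mr - INR j) * / (Nr - INR j)) * (Nr - (INR i + INR j + INR i')) =
    (Mr - INR j) * (d * ((Nr - (INR i + INR j + INR i')) / (Nr - INR j))) by field; lra.
  rewrite -{1}(Rmult_1_r (Mr - INR j)); apply: Rmult_le_compat_l; first lra.
  apply: (Rmult_le_reg_r (Nr - INR j)); first lra.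
  have -> : d * ((Nr - (INR i + INR j + INR i')) / (Nr - INR j)) * (Nr - INR j) = d * (Nr - (INR i + INR j + INR i')) by field; lra.
  apply: Rle_trans (_ : d * (Nr - INR j - INR a) <= _); last by apply: Rmult_le_compat_l; rewrite /d; lra.
  have : 2 * INR a / Nr * (Nr - INR j - INR a) >= INR a; last by rewrite /d; lra.
  apply: Rle_ge; apply: (Rmult_le_reg_r Nr); first lra.
  have -> : 2 * INR a / Nr * (Nr - INR j - INR a) * Nr = 2 * INR a * (Nr - INR j - INR a) by field; lra.
  nra.
have q0 : 0 <= (Mr - INR j) / (Nr - INR j) by apply: Rmult_le_pos; [lra | apply/Rlt_le/Rinv_0_lt_compat; lra].
apply: Rle_trans (Rmult_le_compat_l _ _ _ w0 q) _.
have -> : d ^ j.+1 * (wt i i' * (wt j 0 * ((Mr - INR j) / (Nr - INR j)))) =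
  d ^ j * (wt i i' * wt j 0) * (d * ((Mr - INR j) / (Nr - INR j))) by rewrite /=; ring.
apply: Rmult_le_compat_r => //; apply: Rmult_le_pos => //; rewrite /d; lra.
Qed.

(* The cross-multiplied difference of the two ratios of consecutive weights is
   [i y + a j - i j - M a] with [y = N - j'] and [a = i + i']: the dominant terms cancel, which
   makes the error of the two-point estimate [O (k a / N)] rather than [O (a^2 / N)]. *)
Lemma wt_join_out i i' j j' : (i + i' <= a)%nat -> (i <= k)%nat -> (j <= k)%nat -> (j + j' <= a)%nat ->
  wt (i + j) (i' + j') * wt j 0 <= (1 + 8 * INR k / Nr) ^ j' * (wt (i + j) i' * wt j j').
Proof.
move=> ia ik jk; elim: j' => [|j' IH] jj; first by rewrite !addn0 /=; lra.
have {}IH := IH (ltac:(lia)).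
rewrite addnS wtSr; last lia. rewrite (@wtSr j); last lia.
have w0 : 0 <= wt (i + j) (i' + j') by apply: wt_ge0; lia.
have w1 : 0 <= wt (i + j) i' by apply: wt_ge0; lia.
have w2 : 0 <= wt j 0 by apply: wt_ge0; lia.
have w3 : 0 <= wt j j' by apply: wt_ge0; lia.
have ia' : INR i + INR i' <= INR a by rewrite -plus_INR; apply/le_INR/leP.
have ja' : INR j + INR j' <= INR a by rewrite -plus_INR; apply/le_INR/leP; lia.
have ikr : INR i <= INR k by apply/le_INR/leP.
have jkr : INR j <= INR k by apply/le_INR/leP.
have kar : INR k <= INR a by apply/le_INR/leP.
have kMr : INR k <= Mr by apply/le_INR/leP.
have hi := pos_INR i; have hi' := pos_INR i'; have hj := pos_INR j; have hj' := pos_INR j'.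
rewrite !plus_INR.
set d := 1 + 8 * INR k / Nr.
have d0 : 0 <= 8 * INR k / Nr by apply: Rmult_le_pos; [lra | apply/Rlt_le/Rinv_0_lt_compat; lra].
set x1 := Nr - Mr - INR j'; set y1 := Nr - (INR j + INR j').
set x2 := Nr - Mr - (INR i' + INR j'); set y2 := Nr - (INR i + INR j + (INR i' + INR j')).
have q : x2 / y2 <= d * (x1 / y1).
  have y2p : y2 >= Nr / 2 by rewrite /y2; lra.
  have y1p : y1 > 0 by rewrite /y1; lra.
  have x1p : x1 >= Nr / 2 by rewrite /x1; lra.
  apply: (Rmult_le_reg_r (y1 * y2)); first by apply: Rmult_lt_0_compat; lra.
  have -> : x2 / y2 * (y1 * y2) = x2 * y1 by field; lra.
  have -> : d * (x1 / y1) * (y1 * y2) = d * (x1 * y2) by field; lra.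
  have e1 : x2 * y1 - x1 * y2 <= INR k * Nr + INR a * INR k.
    have -> : x2 * y1 - x1 * y2 = INR i * (Nr - INR j') + (INR i + INR i') * INR j - INR i * INR j - Mr * (INR i + INR i').
      by rewrite /x1 /x2 /y1 /y2; ring.
    have : INR i * (Nr - INR j') <= INR k * Nr by apply: Rmult_le_compat; lra.
    have : (INR i + INR i') * INR j <= INR a * INR k by apply: Rmult_le_compat; lra.
    have : 0 <= INR i * INR j by apply: Rmult_le_pos.
    have : 0 <= Mr * (INR i + INR i') by apply: Rmult_le_pos; lra.
    lra.
  have e2 : Nr / 2 * (Nr / 2) <= x1 * y2 by apply: Rmult_le_compat; lra.
  have e3 : 8 * INR k / Nr * (Nr / 2 * (Nr / 2)) <= 8 * INR k / Nr * (x1 * y2) by apply: Rmult_le_compat_l.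
  have e4 : 8 * INR k / Nr * (Nr / 2 * (Nr / 2)) = 2 * INR k * Nr by field; lra.
  have e5 : INR a * INR k <= INR k * Nr by nra.
  rewrite /d; lra.
have q0 : 0 <= x1 / y1 by apply: Rmult_le_pos; [rewrite /x1; lra | apply/Rlt_le/Rinv_0_lt_compat; rewrite /y1; lra].
have -> : wt (i + j) (i' + j') * (x2 / y2) * wt j 0 = wt (i + j) (i' + j') * wt j 0 * (x2 / y2) by ring.
apply: Rle_trans (Rmult_le_compat_l _ _ _ _ q) _; first exact: Rmult_le_pos.
have -> : d ^ j'.+1 * (wt (i + j) i' * (wt j j' * (x1 / y1))) =
  d ^ j' * (wt (i + j) i' * wt j j') * (d * (x1 / y1)) by rewrite /=; ring.
apply: Rmult_le_compat_r => //; apply: Rmult_le_pos => //; rewrite /d; lra.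
Qed.

(** The exponent collects [8 k a / N] from at most [a] misses, each costing [1 + 8 k / N] in
    [wt_join_out], and [2 k a / N] from at most [k] hits, each costing [1 + 2 a / N] in
    [wt_join_in]. *)
Definition qi_const := exp (10 * INR k * INR a / Nr).

Lemma wt_join c i i' j j' : (i + i' <= a)%nat -> (j + j' <= a)%nat -> (i <= k)%nat -> (j <= k)%nat ->
  (c <= a)%nat ->
  wt (i + j + c) (i' + j') <= qi_const * (4 * Mr / Nr) ^ c * (wt i i' * wt j j').
Proof.
move=> ia ja ik jk ca.
have N0 : 0 < Nr by lra.
have q0 : 0 <= 4 * Mr / Nr.
  apply: Rmult_le_pos; [have := pos_INR M; lra | apply/Rlt_le/Rinv_0_lt_compat; lra].
apply: Rle_trans (wt_more (i := i + j) (j := i' + j') _ ca) _; first lia.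
rewrite (Rmult_comm qi_const) Rmult_assoc; apply: Rmult_le_compat_l; first exact: pow_le.
have w0 : 0 < wt j 0 by apply: wt_gt0; lia.
apply: (Rmult_le_reg_r (wt j 0)) => //.
apply: Rle_trans (wt_join_out ia ik jk ja) _.
have w1 : 0 <= wt i i' by apply: wt_ge0; lia.
have w2 : 0 <= wt (i + j) i' by apply: wt_ge0; lia.
have w3 : 0 <= wt j j' by apply: wt_ge0; lia.
have k0 := pos_INR k.
have d1 : 0 <= 2 * INR a / Nr by apply: Rmult_le_pos; [lra | apply/Rlt_le/Rinv_0_lt_compat; lra].
have d2 : 0 <= 8 * INR k / Nr by apply: Rmult_le_pos; [lra | apply/Rlt_le/Rinv_0_lt_compat; lra].
set D1 := (1 + 8 * INR k / Nr) ^ j'.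
have D1p : 0 <= D1 by apply: pow_le; lra.
apply: Rle_trans (_ : D1 * ((1 + 2 * INR a / Nr) ^ j * (wt i i' * wt j 0) * wt j j') <= _).
  apply: Rmult_le_compat_l => //; apply: Rmult_le_compat_r => //; exact: wt_join_in.
have -> : D1 * ((1 + 2 * INR a / Nr) ^ j * (wt i i' * wt j 0) * wt j j') =
  D1 * (1 + 2 * INR a / Nr) ^ j * (wt i i' * wt j j') * wt j 0 by ring.
apply: Rmult_le_compat_r; first lra.
apply: Rmult_le_compat_r; first exact: Rmult_le_pos.
have b1 : D1 <= exp (INR j' * (8 * INR k / Nr)) by apply: pow_le_exp; lra.
have b2 : (1 + 2 * INR a / Nr) ^ j <= exp (INR j * (2 * INR a / Nr)) by apply: pow_le_exp; lra.
apply: Rle_trans (Rmult_le_compat _ _ _ _ D1p _ b1 b2) _; first by apply: pow_le; lra.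
rewrite -exp_plus; apply: exp_le_mono.
have jkr : INR j <= INR k by apply/le_INR/leP.
have jar : INR j' <= INR a by apply/le_INR/leP; lia.
have -> : 10 * INR k * INR a / Nr = INR a * (8 * INR k / Nr) + INR k * (2 * INR a / Nr) by field; lra.
by apply: Rplus_le_compat; apply: Rmult_le_compat_r.
Qed.
End QuasiIndependence.
End Weights.

Section Distribution.
Variables (U : finType) (W : {set U}).
Implicit Types (A B C I J : {set U}) (s : {perm U}).
Local Notation F := (sampled W).
Local Notation wt := (weight #|U| #|W|).

Let MN : (#|W| <= #|U|)%nat. Proof. exact: max_card. Qed.

Lemma Pr_hits I J : [disjoint I & J] -> Pr (hits W I J) = wt #|I| #|J|.
Proof.
move: {2}(#|I| + #|J|)%nat (erefl (#|I| + #|J|)%nat) => m; elim: m I J => [|m IH] I J.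
  move/eqP; rewrite addn_eq0 !cards_eq0 => /andP[/eqP -> /eqP ->] _.
  rewrite !cards0 wt00 PrE -(Ex1 U 1); apply: eq_Ex => s.
  by rewrite /hits sub0set -setI_eq0 set0I eqxx.
have room I' J' x : [disjoint I' & J'] -> x \notin I' :|: J' -> (#|I'| + #|J'| < #|U|)%nat.
  move=> d x_n; have -> : (#|I'| + #|J'| = #|I' :|: J'|)%nat.
    by rewrite cardsU; move: d; rewrite -setI_eq0 => /eqP ->; rewrite cards0 subn0.
  by rewrite -cardsT; apply: proper_card; apply/properP; split=> //; exists x; rewrite ?in_setT.
case: (set_0Vmem I) => [-> | [x xI]].
  rewrite cards0 add0n; case: (set_0Vmem J) => [->|[x xJ]]; first by rewrite cards0.
  rewrite (cardsD1 x) xJ => -[cJ] _.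
  have d : [disjoint (set0 : {set U}) & J :\ x] by rewrite -setI_eq0 set0I.
  have xn : x \notin set0 :|: J :\ x by rewrite !inE eqxx.
  have := hits_out W d xn; rewrite setD1K // (IH set0 (J :\ x)) ?cards0 // ?cards0.
  have := room _ _ _ d xn; rewrite cards0 add1n => r; rewrite wtSr //.
  have r' : INR #|U| - INR (0 + #|J :\ x|) > 0 by have := lt_INR _ _ (elimT ltP r); lra.
  move=> H; apply: (Rmult_eq_reg_l (INR #|U| - INR (0 + #|J :\ x|))); last lra.
  by rewrite H; field; lra.
rewrite (cardsD1 x) xI => -[cI] IJ.
have d : [disjoint I :\ x & J] by apply: disjointWl IJ; apply: subsetDl.
have xn : x \notin I :\ x :|: J by rewrite !inE eqxx /= (disjointFr IJ xI).
have := hits_in W d xn; rewrite setD1K // (IH (I :\ x) J) //.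
have := room _ _ _ d xn; rewrite add1n => r; rewrite wtSl //.
have r' : INR #|U| - INR (#|I :\ x| + #|J|) > 0 by have := lt_INR _ _ (elimT ltP r); lra.
move=> H; apply: (Rmult_eq_reg_l (INR #|U| - INR (#|I :\ x| + #|J|))); last lra.
by rewrite H; field; lra.
Qed.

Lemma hits_trace I A s : I \subset A -> hits W I (A :\: I) s = (F s :&: A == I).
Proof.
move=> IA; rewrite /hits -setI_eq0; apply/andP/eqP => [[IF /eqP AF]|<-].
  apply/eqP; rewrite eqEsubset; apply/andP; split; last by rewrite subsetI IF.
  apply/subsetP => x; rewrite in_setI => /andP[xF xA]; apply: contraT => xI.
  by move/setP: AF => /(_ x); rewrite in_setI in_setD in_set0 xI xA xF.
by rewrite subsetIl; split=> //; apply/eqP/setP => x; rewrite !inE; case: (s x \in W); case: (x \in A).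
Qed.

Lemma trace_sum (P : pred {set U}) A s :
  INR (P (F s :&: A)) = \rsum_(I : {set U} | (I \subset A) && P I) INR (hits W I (A :\: I) s).
Proof.
case PF : (P (F s :&: A)).
  rewrite (bigD1 (F s :&: A)) /=; last by rewrite subsetIr.
  rewrite hits_trace ?subsetIr // eqxx /= big1 ?Rplus_0_r // => I /andP[/andP[IA _] nI].
  by rewrite hits_trace // eq_sym (negPf nI).
rewrite big1 // => I /andP[IA PI]; rewrite hits_trace //.
by case: eqP => // FI; rewrite FI PI in PF.
Qed.

Lemma Pr_trace (P : pred {set U}) A :
  Pr (fun s => P (F s :&: A)) = \rsum_(I : {set U} | (I \subset A) && P I) wt #|I| (#|A| - #|I|).
Proof.
rewrite PrE (eq_Ex (Y := fun s => \rsum_(I : {set U} | (I \subset A) && P I) INR (hits W I (A :\: I) s))); last first.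
  by move=> s; apply: trace_sum.
rewrite Ex_sum; apply: eq_bigr => I /andP[IA _]; rewrite -PrE Pr_hits.
  by rewrite cardsD (setIidPr IA).
by rewrite -setI_eq0 setIDA setIC setDE; apply/eqP/setP => x; rewrite !inE; case: (x \in I); rewrite ?andbF.
Qed.

Definition hypergeom_pmf a l := INR 'C(a, l) * wt l (a - l).
Definition hypergeom_cdf a k := \rsum_(l < k) hypergeom_pmf a l.

Lemma Pr_eq A l : Pr (fun s => #|F s :&: A| == l) = hypergeom_pmf #|A| l.
Proof.
rewrite (Pr_trace (fun X => #|X| == l)) /hypergeom_pmf -cards_draws.
rewrite (eq_bigr (fun=> wt l (#|A| - l))) => [|I /andP[_ /eqP ->] //].
by rewrite rsum_const; congr (INR _ * _); apply: eq_card => I; rewrite inE unfold_in.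
Qed.

Lemma Pr_lt A k : Pr (fun s => (#|F s :&: A| < k)%nat) = hypergeom_cdf #|A| k.
Proof.
rewrite /hypergeom_cdf (eq_bigr (fun l : 'I_k => Ex (fun s => INR (#|F s :&: A| == l)))); last first.
  by move=> l _; rewrite -Pr_eq PrE.
rewrite -Ex_sum PrE; apply: eq_Ex => s.
have [lk|kl] := ltnP #|F s :&: A| k.
  rewrite (bigD1 (Ordinal lk)) //= eqxx big1 => [|l ll]; first by rewrite Rplus_0_r.
  by case: eqP => // E; case/eqP: ll; apply/val_inj; rewrite /= E.
by rewrite big1 // => l _; case: eqP => // E; move: kl; rewrite leqNgt E ltn_ord.
Qed.

(** Both sides are expanded over the traces [I] and [J] of the sample on [A] and [B]; the two sums
    are then compared term by term through [wt_join], the set [C] supplying the extra hits. *)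
Lemma quasi_independence a k A B C :
  (4 * a <= #|U|)%nat -> (4 * #|W| <= #|U|)%nat -> (k <= #|W|)%nat -> (k <= a)%nat -> (0 < a)%nat ->
  (#|A| <= a)%nat -> (#|B| <= a)%nat -> (#|C| <= a)%nat ->
  [disjoint A & B] -> [disjoint A :|: B & C] ->
  Pr (fun s => [&& C \subset F s, (#|F s :&: A| < k)%nat & (#|F s :&: B| < k)%nat]) <=
  qi_const #|U| a k * (4 * INR #|W| / INR #|U|) ^ #|C| * (hypergeom_cdf #|A| k * hypergeom_cdf #|B| k).
Proof.
move=> aN M4 kM ka a0 Aa Ba Ca AB ABC.
rewrite -!Pr_lt (Pr_trace (fun X => #|X| < k)%nat A) (Pr_trace (fun X => #|X| < k)%nat B).
rewrite rsum_mulr rsum_mull PrE.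
set PA := fun I : {set U} => (I \subset A) && (#|I| < k)%nat.
set PB := fun I : {set U} => (I \subset B) && (#|I| < k)%nat.
rewrite (eq_Ex (Y := fun s => \rsum_(I : {set U} | PA I) \rsum_(J : {set U} | PB J)
   INR (hits W (I :|: J :|: C) ((A :\: I) :|: (B :\: J)) s))); last first.
  move=> s.
  have -> : INR [&& C \subset F s, (#|F s :&: A| < k)%nat & (#|F s :&: B| < k)%nat] =
    INR (C \subset F s) * (INR (#|F s :&: A| < k)%nat * INR (#|F s :&: B| < k)%nat).
    by case: (C \subset _); case: (_ < _)%nat; case: (_ < _)%nat => /=; lra.
  rewrite (trace_sum (fun X => #|X| < k)%nat A) (trace_sum (fun X => #|X| < k)%nat B).
  rewrite rsum_mulr rsum_mull; apply: eq_bigr => I _; rewrite rsum_mull rsum_mull; apply: eq_bigr => J _.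
  rewrite /hits !subUset.
  have -> : [disjoint (A :\: I) :|: (B :\: J) & F s] = [disjoint A :\: I & F s] && [disjoint B :\: J & F s].
    by rewrite -!setI_eq0 setIUl setU_eq0.
  by case: (C \subset _); case: (I \subset _); case: (J \subset _); case: [disjoint _ & _]; case: [disjoint _ & _] => /=; lra.
rewrite Ex_sum; apply: rsum_le => I /andP[IA Ik]; rewrite Ex_sum rsum_mull rsum_mull.
apply: rsum_le => J /andP[JB Jk]; rewrite -PrE.
have dis (X Y : {set U}) : [disjoint X & Y] -> forall x : U, x \in X -> x \in Y -> False.
  by move=> d x xX; rewrite (disjointFr d xX).
have dAB := dis _ _ AB; have dC := dis _ _ ABC.
have sI := subsetP IA; have sJ := subsetP JB.
rewrite Pr_hits; last first.
  rewrite -setI_eq0; apply/eqP/setP => x; rewrite !inE; apply/negP.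
  case/andP=> /orP[/orP[xI|xJ]|xC] /orP[/andP[xnI xA]|/andP[xnJ xB]].
  - by rewrite xI in xnI.
  - exact: (dAB x (sI _ xI) xB).
  - exact: (dAB x xA (sJ _ xJ)).
  - by rewrite xJ in xnJ.
  - by apply: (dC x) xC; rewrite inE xA.
  - by apply: (dC x) xC; rewrite inE xB orbT.
have cardU (X Y : {set U}) : (forall x : U, x \in X -> x \in Y -> False) -> #|X :|: Y| = (#|X| + #|Y|)%nat.
  move=> d; rewrite cardsU; suff -> : X :&: Y = set0 by rewrite cards0 subn0.
  by apply/setP => x; rewrite !inE; apply/negP => /andP[/d].
have -> : #|I :|: J :|: C| = (#|I| + #|J| + #|C|)%nat.
  rewrite !cardU // => x; first by move=> /sI xA /sJ; apply: dAB.
  by rewrite inE => /orP[/sI xA|/sJ xB]; apply: dC; rewrite inE ?xA ?xB ?orbT.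
have -> : #|(A :\: I) :|: (B :\: J)| = (#|A| - #|I| + (#|B| - #|J|))%nat.
  rewrite cardU; last by move=> x; rewrite !inE => /andP[_ xA] /andP[_]; apply: dAB.
  by rewrite !cardsD (setIidPr IA) (setIidPr JB).
have IAc := subset_leq_card IA; have JBc := subset_leq_card JB.
by apply: wt_join => //; lia.
Qed.
End Distribution.

(** * Factorial and binomial estimates *)

Lemma Rinv_ge0 x : 0 <= x -> 0 <= / x.
Proof. by case=> [/Rinv_0_lt_compat/Rlt_le|<-] //; rewrite Rinv_0; lra. Qed.

Lemma Rdiv_ge0 x y : 0 <= x -> 0 <= y -> 0 <= x / y.
Proof. by move=> x0 y0; apply: Rmult_le_pos => //; apply: Rinv_ge0. Qed.

Lemma exp_mulnat m x : exp x ^ m = exp (INR m * x).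
Proof.
elim: m => [|m IH]; first by rewrite Rmult_0_l exp_0.
by rewrite S_INR -tech_pow_Rmult IH -exp_plus; congr exp; ring.
Qed.

Lemma fact_ge i : INR i ^ i <= INR i`! * exp (INR i).
Proof.
elim: i => [|i IH]; first by rewrite /= exp_0; lra.
have i0 := pos_INR i; have fp : 0 < INR i`! by apply/lt_0_INR/ltP/fact_gt0.
rewrite factS mult_INR -tech_pow_Rmult Rmult_assoc; apply: Rmult_le_compat_l; first exact: pos_INR.
case: (posnP i) => [->|ipos].
  by rewrite /= Rmult_1_l; have := exp_ineq1_le 1; lra.
have ir : 0 < INR i by apply/lt_0_INR/ltP.
have -> : INR i.+1 = INR i * (1 + / INR i) by rewrite S_INR; field; lra.
rewrite Rpow_mult_distr.
have H : (1 + / INR i) ^ i <= exp 1.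
  have -> : 1 = INR i * / INR i by field; lra.
  by rewrite {1}(Rinv_r (INR i)); [apply: pow_le_exp; have := Rinv_0_lt_compat _ ir; lra | lra].
have -> : INR i`! * exp (INR i * (1 + / INR i)) = INR i`! * exp (INR i) * exp 1.
  by rewrite Rmult_assoc -exp_plus; congr (_ * exp _); field; lra.
by apply: Rmult_le_compat => //; apply: pow_le; have := Rinv_0_lt_compat _ ir; lra.
Qed.

(** A single term of the exponential series, obtained from [fact_ge] and [1 + v <= exp v] at
    [v = u / i - 1]. *)
Lemma pow_le_fact_exp u i : 0 <= u -> u ^ i <= INR i`! * exp u.
Proof.
move=> u0; case: (posnP i) => [->|ipos]; first by rewrite /= Rmult_1_l; have := exp_ineq1_le u; lra.
have ir : 0 < INR i by apply/lt_0_INR/ltP.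
have h : u <= INR i * exp (u / INR i - 1).
  have := exp_ineq1_le (u / INR i - 1) => H.
  have -> : u = INR i * (1 + (u / INR i - 1)) by field; lra.
  by rewrite {2}(_ : INR i * (1 + (u / INR i - 1)) = u); [apply: Rmult_le_compat_l; lra | field; lra].
apply: Rle_trans (pow_incr _ _ i (conj u0 h)) _.
have -> : (INR i * exp (u / INR i - 1)) ^ i = INR i ^ i * exp (u - INR i).
  rewrite Rpow_mult_distr; congr (_ * _).
  by rewrite exp_mulnat; congr exp; field; lra.
apply: Rle_trans (Rmult_le_compat_r _ _ _ _ (fact_ge i)) _; first exact/Rlt_le/exp_pos.
by right; rewrite Rmult_assoc -exp_plus; congr (_ * exp _); ring.
Qed.

Lemma fact_le i : (0 < i)%nat -> INR i`! * exp (INR i) <= exp 1 * INR i ^ i.+1.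
Proof.
elim: i => // -[|i] IH _; first by rewrite /=; lra.
have {}IH := IH isT; set m := i.+1 in IH *.
have mr : 0 < INR m by apply/lt_0_INR/ltP.
rewrite factS mult_INR -tech_pow_Rmult.
have -> : INR m.+1 * INR m`! * exp (INR m.+1) = INR m.+1 * (exp 1 * (INR m`! * exp (INR m))).
  by rewrite S_INR exp_plus; ring.
have -> : exp 1 * (INR m.+1 * INR m.+1 ^ m.+1) = INR m.+1 * (exp 1 * INR m.+1 ^ m.+1) by ring.
apply: Rmult_le_compat_l; first exact: pos_INR.
apply: Rmult_le_compat_l; first exact/Rlt_le/exp_pos.
apply: Rle_trans IH _.
have m1r : 0 < INR m.+1 by rewrite S_INR; lra.
have H : INR m / INR m.+1 <= exp (- / INR m.+1).
  apply: Rle_trans (exp_ineq1_le _); right; rewrite S_INR; field; lra.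
have q0 : 0 <= INR m / INR m.+1 by apply: Rdiv_ge0; lra.
have := pow_incr _ _ m.+1 (conj q0 H); rewrite exp_mulnat.
have -> : INR m.+1 * - / INR m.+1 = - 1 by field; lra.
move=> H2.
have -> : INR m ^ m.+1 = INR m.+1 ^ m.+1 * (INR m / INR m.+1) ^ m.+1.
  by rewrite -Rpow_mult_distr; congr (_ ^ _); field; lra.
have p0 : 0 <= INR m.+1 ^ m.+1 by apply: pow_le; lra.
apply: Rle_trans (_ : exp 1 * (INR m.+1 ^ m.+1 * exp (-1)) <= _).
  by apply: Rmult_le_compat_l; [apply/Rlt_le/exp_pos | apply: Rmult_le_compat_l].
have -> : exp 1 * (INR m.+1 ^ m.+1 * exp (-1)) = INR m.+1 ^ m.+1 * (exp 1 * exp (-1)) by ring.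
by rewrite -exp_plus Rplus_opp_r exp_0; lra.
Qed.

Lemma bin_le_exp n h : (0 < h)%nat -> INR 'C(n, h) <= (exp 1 * INR n / INR h) ^ h.
Proof.
move=> h0; have hr : 0 < INR h by apply/lt_0_INR/ltP.
have fp : 0 < INR h`! by apply/lt_0_INR/ltP/fact_gt0.
have H1 : INR 'C(n, h) * INR h`! <= INR n ^ h.
  rewrite -mult_INR multE bin_ffact.
  elim: h {h0 hr fp} => [|h IH]; first by rewrite /=; lra.
  rewrite ffactnSr mult_INR Rmult_comm -tech_pow_Rmult.
  by apply: Rmult_le_compat => //; try exact: pos_INR; apply/le_INR/leP/leq_subr.
have -> : (exp 1 * INR n / INR h) ^ h = INR n ^ h * (exp (INR h) / INR h ^ h).
  rewrite /Rdiv !Rpow_mult_distr pow_inv exp_mulnat Rmult_1_r; ring.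
have hh : 0 < INR h ^ h by apply: pow_lt.
have H2 : 1 <= INR h`! * (exp (INR h) / INR h ^ h).
  apply: (Rmult_le_reg_r (INR h ^ h)) => //; rewrite Rmult_1_l.
  by apply: Rle_trans (fact_ge h) _; right; field; lra.
have e0 := exp_pos (INR h).
have H3 : 0 <= exp (INR h) / INR h ^ h by apply: Rdiv_ge0; lra.
apply: Rle_trans (_ : INR 'C(n, h) * INR h`! * (exp (INR h) / INR h ^ h) <= _); last exact: Rmult_le_compat_r.
have := pos_INR 'C(n, h); nra.
Qed.

(** * The hypergeometric law: second moment, growth and lower bounds *)

Section MoreDistribution.
Variables (U : finType) (W : {set U}).
Implicit Types (A B C : {set U}) (s : {perm U}).
Local Notation F := (sampled W).
Local Notation N := (INR #|U|).
Local Notation M := (INR #|W|).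
Local Notation wt := (weight #|U| #|W|).
Local Notation pmf := (hypergeom_pmf W).
Local Notation cdf := (hypergeom_cdf W).

Lemma pmf_ge0 a l : (a <= #|U|)%nat -> 0 <= pmf a l.
Proof.
move=> aU; have [la|al] := leqP l a; last by rewrite /hypergeom_pmf bin_small //= Rmult_0_l; lra.
apply: Rmult_le_pos; first exact: pos_INR.
by apply: wt_ge0; lia.
Qed.

Lemma cdfS a k : cdf a k.+1 = cdf a k + pmf a k.
Proof. by rewrite /hypergeom_cdf big_ord_recr. Qed.

Section SecondMoment.
Variables (V : finType) (A : V -> {set U}) (a k : nat).
Hypotheses (aN : (4 * a <= #|U|)%nat) (M4 : (4 * #|W| <= #|U|)%nat) (kM : (k <= #|W|)%nat) (ka : (k <= a)%nat).
Hypothesis a0 : (0 < a)%nat.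
Hypothesis cardA : forall v, #|A v| = a.
Hypothesis cardAA : forall u v, u != v -> #|A u :&: A v| = 1%nat.
Local Notation K := (qi_const #|U| a k).
Local Notation y := (4 * M / N).

(** Returning one element [e] to the set can destroy the event of fewer than [k] hits only if [e] is
    hit, which costs a factor of at most [K y]. *)
Lemma cdf_pred B : #|B| = a -> (0 < #|U|)%nat -> cdf a.-1 k * (1 - K * y) <= cdf a k.
Proof.
move=> Ba _; have [e eB] : exists e, e \in B by apply/card_gt0P; rewrite Ba.
have cB : #|B :\ e| = a.-1 by move: Ba; rewrite (cardsD1 e) eB add1n => <-.
have := @quasi_independence _ W a k (B :\ e) set0 [set e] aN M4 kM ka a0.
rewrite cB cards0 cards1 setU0 -!setI_eq0 setI0 eqxx.
have -> : (B :\ e) :&: [set e] == set0 by apply/eqP/setP => x; rewrite !inE; case: eqP; rewrite ?andbF.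
move=> /(_ (leq_pred _) isT a0 isT isT); rewrite pow_1.
have K0 : 0 < K by apply: exp_pos.
have y0 : 0 <= y by apply: Rdiv_ge0; have := pos_INR #|W|; have := pos_INR #|U|; lra.
have c0 : cdf 0 k <= 1 by rewrite -(cards0 U) -Pr_lt; apply: Pr_le1.
have q0 : 0 <= cdf a.-1 k by rewrite -cB -Pr_lt; apply: Pr_ge0.
have Ky : 0 <= K * y by apply: Rmult_le_pos; lra.
have H : K * y * (cdf a.-1 k * cdf 0 k) <= K * y * cdf a.-1 k.
  by apply: Rmult_le_compat_l => //; nra.
set P := Pr _ => HP.
have : cdf a.-1 k <= cdf a k + P; last lra.
rewrite -cB -Ba -!Pr_lt; apply: Rle_trans (PrU _ _); apply: Pr_le => s sk.
rewrite sub1set setI0 cards0 sk (leq_ltn_trans (leq0n _) sk) /=.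
have := cardsD1 e (F s :&: B); rewrite in_setI eB andbT.
have -> : (F s :&: B) :\ e = F s :&: (B :\ e) by rewrite setIDA.
move=> ->; case eF : (e \in F s); last by rewrite add0n sk.
by rewrite orbT.
Qed.

(** Distinct [A u] and [A v] share one element. Removing it makes the sets disjoint and only
    enlarges the event; this is why the bound involves [a - 1]. *)
Lemma pair_bound u v : u != v ->
  Pr (fun s => (#|F s :&: A u| < k)%nat && (#|F s :&: A v| < k)%nat) <= K * (cdf a.-1 k * cdf a.-1 k).
Proof.
move=> uv.
have c1 : #|A u :\: A v| = a.-1 by rewrite cardsD cardA cardAA // subn1.
have c2 : #|A v :\: A u| = a.-1 by rewrite cardsD cardA cardAA ?subn1 // eq_sym.
have := @quasi_independence _ W a k (A u :\: A v) (A v :\: A u) set0 aN M4 kM ka a0.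
rewrite c1 c2 cards0 -!setI_eq0 setI0 eqxx Rmult_1_r.
have -> : (A u :\: A v) :&: (A v :\: A u) == set0.
  by apply/eqP/setP => x; rewrite !inE; case: (x \in A u); case: (x \in A v).
move=> /(_ (leq_pred _) (leq_pred _) isT isT isT); apply: Rle_trans; apply: Pr_le => s /andP[h1 h2].
rewrite sub0set /=; apply/andP; split.
  by apply: leq_ltn_trans h1; apply/subset_leq_card/setIS/subsetDl.
by apply: leq_ltn_trans h2; apply/subset_leq_card/setIS/subsetDl.
Qed.

(* Chebyshev; the last two terms bound the relative error of the pair correlation. *)
Lemma second_moment :
  10 * INR k * INR a / N <= / 2 -> y <= / 12 -> 0 < cdf a k -> (0 < #|V|)%nat ->
  Pr (fun s => [forall v, (k <= #|F s :&: A v|)%nat]) <=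
  / (INR #|V| * cdf a k) + 2 * (10 * INR k * INR a / N) + 16 * y.
Proof.
set x := 10 * _ * _ / _; move=> x1 y1 q0 V0.
have [v0 _] : exists v, v \in V by apply/card_gt0P.
have Nn : (0 < #|U|)%nat by lia.
set q := cdf a k in q0 *; set q' := cdf a.-1 k.
have qq := cdf_pred (cardA v0) Nn; rewrite -/q -/q' in qq.
have q'0 : 0 <= q'.
  have [e eB] : exists e, e \in A v0 by apply/card_gt0P; rewrite cardA.
  have cB : #|A v0 :\ e| = a.-1 by move: (cardA v0); rewrite (cardsD1 e) eB add1n => <-.
  by rewrite /q' -cB -Pr_lt; apply: Pr_ge0.
have y0 : 0 <= y by apply: Rdiv_ge0; have := pos_INR #|W|; have := pos_INR #|U|; lra.
have x0 : 0 <= x.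
  by apply: Rdiv_ge0; [apply: Rmult_le_pos; [have := pos_INR k; lra|apply: pos_INR] | apply: pos_INR].
have K1 : K <= 1 + 2 * x.
  have := exp_ineq1_le (- x); rewrite exp_Ropp => H.
  have e0 := exp_pos x; rewrite /qi_const -/x.
  apply: (Rmult_le_reg_r (1 - x)); first lra.
  apply: Rle_trans (_ : 1 <= _); last nra.
  have <- : exp x * / exp x = 1 by apply: Rinv_r; lra.
  by apply: Rmult_le_compat_l; rewrite ?Rinv_r; lra.
have K0 : 0 < K by apply: exp_pos.
set kap := K * y in qq.
have kap0 : 0 <= kap by apply: Rmult_le_pos; lra.
have kap1 : kap <= 2 * y by apply: Rmult_le_compat_r => //; lra.
(* Here [kap <= 2 y <= 1/6], and for such values [(1 - kap)^2 (1 + 4 kap) >= 1]. *)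
have q2 : q' * q' <= q * q * (1 + 4 * kap).
  have h1 : q' * (1 - kap) * (q' * (1 - kap)) <= q * q.
    by apply: Rmult_le_compat => //; apply: Rmult_le_pos => //; lra.
  have h2 : 1 <= (1 - kap) * (1 - kap) * (1 + 4 * kap) by nra.
  have h3 : 0 <= q' * q' by apply: Rmult_le_pos.
  apply: Rle_trans (_ : q' * q' * ((1 - kap) * (1 - kap) * (1 + 4 * kap)) <= _); first nra.
  have -> : q' * q' * ((1 - kap) * (1 - kap) * (1 + 4 * kap)) = q' * (1 - kap) * (q' * (1 - kap)) * (1 + 4 * kap) by ring.
  by apply: Rmult_le_compat_r => //; lra.
set n := INR #|V|; have n0 : 0 < n by apply/lt_0_INR/ltP.
pose X s := \rsum_v INR (#|F s :&: A v| < k)%nat.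
have EX : Ex X = n * q.
  rewrite Ex_sum (eq_bigr (fun=> q)) => [|v _]; first by rewrite rsum_const.
  by rewrite -PrE Pr_lt cardA.
have EX2 : Ex (fun s => X s * X s) <= n * q + n * n * (K * (q' * q')).
  rewrite (eq_Ex (Y := fun s => \rsum_u \rsum_v INR ((#|F s :&: A u| < k)%nat && (#|F s :&: A v| < k)%nat))); last first.
    move=> s; rewrite /X rsum_mulr; apply: eq_bigr => u _; rewrite rsum_mull; apply: eq_bigr => v _.
    by case: (_ < _)%nat; case: (_ < _)%nat => /=; lra.
  rewrite Ex_sum.
  have -> : n * q + n * n * (K * (q' * q')) = \rsum_(u in V) (q + n * (K * (q' * q'))).
    by rewrite rsum_const -/n; ring.
  apply: rsum_le => u _; rewrite Ex_sum (bigD1 u) //=; apply: Rplus_le_compat.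
    rewrite (eq_Ex (Y := fun s => INR (#|F s :&: A u| < k)%nat)) => [|s]; last by rewrite andbb.
    by rewrite -PrE Pr_lt cardA; apply: Rle_refl.
  have Kq : 0 <= K * (q' * q') by apply: Rmult_le_pos; [lra | apply: Rmult_le_pos].
  apply: Rle_trans (_ : \rsum_(v | v != u) (K * (q' * q')) <= _).
    by apply: rsum_le => v vu; rewrite -PrE; apply: pair_bound; rewrite eq_sym.
  rewrite rsum_const; apply: Rmult_le_compat_r => //.
  by apply/le_INR/leP/max_card.
have nq0 : 0 < n * q by apply: Rmult_lt_0_compat.
apply: Rle_trans (markov (X := fun s => (X s - n * q) * (X s - n * q)) (c := (n * q) * (n * q)) _ _ _) _.
- exact: Rmult_lt_0_compat.
- by move=> s; apply: (Rle_0_sqr (X s - n * q)).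
- move=> s /forallP H; have -> : X s = 0; last by lra.
  by rewrite /X big1 // => v _; rewrite ltnNge H.
have -> : Ex (fun s => (X s - n * q) * (X s - n * q)) = Ex (fun s => X s * X s) - n * q * (n * q).
  have -> : Ex (fun s => X s * X s) - n * q * (n * q) =
    Ex (fun s => X s * X s) + - (2 * (n * q)) * Ex X + Ex (fun _ : {perm U} => n * q * (n * q)).
    by rewrite Ex1 EX; ring.
  by rewrite -ExZ -!ExD; apply: eq_Ex => s; ring.
apply: (Rmult_le_reg_r (n * q * (n * q))); first exact: Rmult_lt_0_compat.
move: y y0 y1 kap kap0 kap1 q2 {qq} EX2 => z z0 z1 kap kap0 kap1 q2 EX2.
have -> : forall e, e / (n * q * (n * q)) * (n * q * (n * q)) = e by move=> e; field; lra.
have -> : (/ (n * q) + 2 * x + 16 * z) * (n * q * (n * q)) = n * q + n * n * (q * q) * (2 * x + 16 * z) by field; lra.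
have : n * n * (K * (q' * q')) <= n * n * (q * q * (1 + 2 * x + 16 * z)); last lra.
apply: Rmult_le_compat_l; first nra.
apply: Rle_trans (_ : K * (q * q * (1 + 4 * kap)) <= _); first by apply: Rmult_le_compat_l; lra.
have -> : K * (q * q * (1 + 4 * kap)) = q * q * (K * (1 + 4 * kap)) by ring.
apply: Rmult_le_compat_l; first nra.
(* [4 kap <= 8 z], and the factor [1 + 2 x <= 2] turns [8 z] into at most [16 z]. *)
apply: Rle_trans (_ : (1 + 2 * x) * (1 + 8 * z) <= _); last nra.
by apply: Rmult_le_compat; lra.
Qed.
End SecondMoment.

(** The ratio of consecutive probabilities is [(a - l) (M - l) / ((l + 1) (N - M - a + l + 1))]; it
    is dominated by the ratio [D / (l + 1)] of a Poisson law of mean [D]. *)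
Lemma pmf_step a l D : (a <= #|U|)%nat -> 0 <= D ->
  INR a * M <= D * (N - M - INR a) -> 0 < N - M - INR a ->
  pmf a l.+1 <= D / INR l.+1 * pmf a l.
Proof.
move=> aU D0 HD NM0.
have l1 : 0 < INR l.+1 by rewrite S_INR; have := pos_INR l; lra.
have p0 := pmf_ge0 l aU.
have Dl : 0 <= D / INR l.+1 by apply: Rdiv_ge0; lra.
have [la|al] := ltnP l a; last first.
  by rewrite {1}/hypergeom_pmf bin_small ?ltnS //= Rmult_0_l; apply: Rmult_le_pos.
rewrite /hypergeom_pmf in p0 *.
have binE : INR 'C(a, l.+1) = (INR a - INR l) / INR l.+1 * INR 'C(a, l).
  have : (l.+1 * 'C(a, l.+1) = (a - l) * 'C(a, l))%nat by rewrite mul_bin_left.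
  move/(congr1 INR); rewrite !mult_INR minus_INR; last by apply/leP/ltnW.
  by move=> H; apply: (Rmult_eq_reg_l (INR l.+1)); [rewrite H; field; lra | lra].
have -> : (a - l = (a - l.+1).+1)%nat by lia.
set b := (a - l.+1)%nat.
have lb : (l + b < #|U|)%nat by rewrite /b; lia.
rewrite wtSl // wtSr //; last exact: max_card.
have w0 : 0 <= wt l b by apply: wt_ge0; lia.
have d0 : 0 < N - INR (l + b) by have := lt_INR _ _ (elimT ltP lb); lra.
have br : INR b <= INR a by apply/le_INR/leP; rewrite /b; lia.
have c0 := pos_INR 'C(a, l); have b0 := pos_INR b; have l0 := pos_INR l; have M0 := pos_INR #|W|.
rewrite binE.
have -> : (INR a - INR l) / INR l.+1 * INR 'C(a, l) * (wt l b * ((M - INR l) / (N - INR (l + b)))) =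
   (INR 'C(a, l) * wt l b / INR l.+1 / (N - INR (l + b))) * ((INR a - INR l) * (M - INR l)) by field; lra.
have -> : D / INR l.+1 * (INR 'C(a, l) * (wt l b * ((N - M - INR b) / (N - INR (l + b))))) =
   (INR 'C(a, l) * wt l b / INR l.+1 / (N - INR (l + b))) * (D * (N - M - INR b)) by field; lra.
apply: Rmult_le_compat_l.
  by apply: Rdiv_ge0; [apply: Rdiv_ge0; [apply: Rmult_le_pos|] |]; lra.
apply: Rle_trans (_ : INR a * M <= _).
  have := lt_INR _ _ (elimT ltP la); nra.
by apply: Rle_trans HD _; apply: Rmult_le_compat_l; lra.
Qed.

Lemma pmf_growth a l D i : (a <= #|U|)%nat -> 0 <= D ->
  INR a * M <= D * (N - M - INR a) -> 0 < N - M - INR a ->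
  INR i`! * pmf a (l + i) <= D ^ i * pmf a l.
Proof.
move=> aU D0 HD NM0; elim: i => [|i IH]; first by rewrite addn0 /=; lra.
have i1 : 0 < INR i.+1 by rewrite S_INR; have := pos_INR i; lra.
have p0 := pmf_ge0 (l + i) aU; have p1 := pmf_ge0 l aU.
rewrite addnS factS mult_INR -tech_pow_Rmult.
have H : INR i.+1 * pmf a (l + i).+1 <= D * pmf a (l + i).
  have H1 := pmf_step (l + i) aU D0 HD NM0.
  have le1 : INR i.+1 <= INR (l + i).+1 by apply/le_INR/leP; lia.
  apply: Rle_trans (Rmult_le_compat_l _ _ _ (Rlt_le _ _ i1) H1) _.
  have -> : INR i.+1 * (D / INR (l + i).+1 * pmf a (l + i)) =
    D * pmf a (l + i) * (INR i.+1 / INR (l + i).+1) by field; lra.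
  have x0 : 0 <= D * pmf a (l + i) by apply: Rmult_le_pos.
  have : INR i.+1 / INR (l + i).+1 <= 1; last nra.
  apply: (Rmult_le_reg_r (INR (l + i).+1)); first lra.
  by rewrite /Rdiv Rmult_assoc Rinv_l; lra.
have -> : INR i.+1 * INR i`! * pmf a (l + i).+1 = INR i`! * (INR i.+1 * pmf a (l + i).+1) by ring.
apply: Rle_trans (Rmult_le_compat_l _ _ _ (pos_INR _) H) _.
have -> : INR i`! * (D * pmf a (l + i)) = D * (INR i`! * pmf a (l + i)) by ring.
by rewrite Rmult_assoc; apply: Rmult_le_compat_l.
Qed.

(** By [pmf_growth], moving up [i] steps costs at most [D^i / i! = X^i (D / X)^i / i! <= X^i exp (D
    / X)]. The free parameter [X] balances the two costs: when [D] is of order [ln n] and [r] is a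
    small multiple of it, a large constant [X] makes both factors small powers of [n]. *)
Lemma cdf_growth a k r D X : (a <= #|U|)%nat -> 0 <= D -> 1 <= X ->
  INR a * M <= D * (N - M - INR a) -> 0 < N - M - INR a ->
  cdf a (k.+1 + r) <= (1 + INR r) * (X ^ r * exp (D / X)) * cdf a k.+1.
Proof.
move=> aU D0 X1 HD NM0.
have c0 m : 0 <= cdf a m by apply: rsum_ge0 => l _; apply: pmf_ge0.
have E1 : 1 <= exp (D / X).
  have : 0 <= D / X by apply: Rdiv_ge0; lra.
  by have := exp_ineq1_le (D / X); lra.
have Xp m : 1 <= X ^ m by apply: pow_R1_Rle.
have step i : pmf a (k + i) <= X ^ i * exp (D / X) * cdf a k.+1.
  have f0 : 0 < INR i`! by apply/lt_0_INR/ltP/fact_gt0.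
  apply: (Rmult_le_reg_l (INR i`!)) => //.
  apply: Rle_trans (pmf_growth k i aU D0 HD NM0) _.
  have pk : pmf a k <= cdf a k.+1 by rewrite cdfS; have := c0 k; lra.
  have H : D ^ i <= INR i`! * (X ^ i * exp (D / X)).
    have -> : D = X * (D / X) by field; lra.
    rewrite Rpow_mult_distr.
    have -> : X * (D / X) / X = D / X by field; lra.
    have := pow_le_fact_exp i (Rdiv_ge0 D0 (Rle_trans _ _ _ Rle_0_1 X1)) => H.
    have -> : INR i`! * (X ^ i * exp (D / X)) = X ^ i * (INR i`! * exp (D / X)) by ring.
    by apply: Rmult_le_compat_l => //; have := Xp i; lra.
  rewrite -Rmult_assoc; apply: Rmult_le_compat => //; [exact: pow_le | exact: pmf_ge0].
elim: r => [|r IH]; first by rewrite addn0 /= Rplus_0_r; have := c0 k.+1; nra.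
rewrite addnS cdfS addSnnS.
have H := step r.+1; rewrite addSnnS in IH.
have le1 : X ^ r * exp (D / X) <= X ^ r.+1 * exp (D / X).
  by apply: Rmult_le_compat_r; [lra | rewrite -tech_pow_Rmult; have := Xp r; nra].
have r0 : 0 <= 1 + INR r by have := pos_INR r; lra.
rewrite [INR r.+1]S_INR.
have : (1 + INR r) * (X ^ r * exp (D / X)) * cdf a k.+1 <= (1 + INR r) * (X ^ r.+1 * exp (D / X)) * cdf a k.+1.
  by apply: Rmult_le_compat_r => //; apply: Rmult_le_compat_l.
lra.
Qed.

(** A lower bound of Poisson type: [i! C(a, i) >= (a - i)^i], each of the [i] hits has conditional
    probability at least [(M - i) / N], and each of at most [a] misses at least [1 - z]. *)
Lemma pmf_lower a i z : (i <= a)%nat -> (i <= #|W|)%nat -> (a < #|U|)%nat -> 0 <= z -> z <= / 2 ->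
  M <= z * (N - INR a) ->
  ((INR a - INR i) * (M - INR i) / N) ^ i * exp (- (INR a * (z + z * z * 2))) <= INR i`! * pmf a i.
Proof.
move=> ia iW aU z0 z1 Mz.
have f0 : 0 < INR i`! by apply/lt_0_INR/ltP/fact_gt0.
have aUr := lt_INR _ _ (elimT ltP aU); have iar := le_INR _ _ (elimT leP ia).
have iWr := le_INR _ _ (elimT leP iW); have i0 := pos_INR i.
have wi j : (j <= i)%nat -> ((M - INR i) / N) ^ j <= wt j 0.
  elim: j => [|j IH] ji; first by rewrite wt00 /=; lra.
  rewrite wtSl; last lia.
  rewrite addn0 -tech_pow_Rmult Rmult_comm; have jir := lt_INR _ _ (elimT ltP ji); have j0 := pos_INR j.
  apply: Rmult_le_compat; [apply: pow_le; apply: Rdiv_ge0; lra | apply: Rdiv_ge0; lra | exact/IH/ltnW |].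
  apply: Rmult_le_compat; [lra | apply/Rlt_le/Rinv_0_lt_compat; lra | lra |].
  by apply: Rinv_le_contravar; lra.
have zN : 0 <= 1 - z by lra.
have wo b : (i + b <= a)%nat -> ((M - INR i) / N) ^ i * (1 - z) ^ b <= wt i b.
  elim: b => [|b IH] ib; first by rewrite Rmult_1_r; apply: wi.
  rewrite wtSr; [|exact: max_card|lia].
  rewrite -tech_pow_Rmult.
  have -> : ((M - INR i) / N) ^ i * ((1 - z) * (1 - z) ^ b) = ((M - INR i) / N) ^ i * (1 - z) ^ b * (1 - z) by ring.
  have b0 := pos_INR b; have ba : INR i + INR b <= INR a by rewrite -plus_INR; apply/le_INR/leP; lia.
  apply: Rmult_le_compat => //; [apply: Rmult_le_pos; apply: pow_le => //; apply: Rdiv_ge0; lra | apply: IH; lia |].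
  rewrite plus_INR; apply: (Rmult_le_reg_r (N - (INR i + INR b))); first lra.
  rewrite /Rdiv Rmult_assoc Rinv_l ?Rmult_1_r; last lra.
  nra.
have Hb := wo (a - i)%nat (ltac:(lia)).
(* Since [(1 - z) (1 + z + 2 z^2) = 1 + z^2 (1 - 2 z)], this is where [z <= 1/2] enters. *)
have z2 : exp (- (z + z * z * 2)) <= 1 - z.
  have H := exp_ineq1_le (z + z * z * 2); rewrite exp_Ropp.
  have e0 := exp_pos (z + z * z * 2).
  apply: (Rmult_le_reg_l (exp (z + z * z * 2))) => //; rewrite Rinv_r; last lra.
  nra.
have H2 : exp (- (INR a * (z + z * z * 2))) <= (1 - z) ^ (a - i).
  apply: Rle_trans (_ : exp (- (z + z * z * 2)) ^ (a - i) <= _); last first.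
    by apply: pow_incr; split => //; apply/Rlt_le/exp_pos.
  rewrite exp_mulnat; apply: exp_le_mono; rewrite minus_INR; last exact/leP.
  by have : 0 <= z + z * z * 2; nra.
have H3 : (INR a - INR i) ^ i <= INR i`! * INR 'C(a, i).
  rewrite -mult_INR multE mulnC bin_ffact.
  suff H m : (m <= i)%nat -> (INR a - INR i) ^ m <= INR (a ^_ m) by exact: H.
  elim: m => [|m IH] mi; first by rewrite /=; lra.
  rewrite ffactnSr mult_INR Rmult_comm -tech_pow_Rmult.
  apply: Rmult_le_compat; [lra | apply: pow_le; lra | | exact/IH/ltnW].
  by rewrite minus_INR; [have := lt_INR _ _ (elimT ltP mi); lra | apply/leP; lia].
have -> : (INR a - INR i) * (M - INR i) / N = (INR a - INR i) * ((M - INR i) / N) by rewrite /Rdiv; ring.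
rewrite Rpow_mult_distr /hypergeom_pmf Rmult_assoc.
have M0 : 0 <= (M - INR i) / N by apply: Rdiv_ge0; lra.
have Mp : 0 <= ((M - INR i) / N) ^ i by apply: pow_le.
rewrite -(Rmult_assoc (INR i`!)); apply: Rmult_le_compat => //.
- by apply: pow_le; lra.
- by apply: Rmult_le_pos => //; apply/Rlt_le/exp_pos.
by apply: Rle_trans Hb; apply: Rmult_le_compat_l.
Qed.
End MoreDistribution.

(** * Degrees and densities in the random graph process *)

Lemma probE n (A : pred {perm edge n}) : prob A = Pr A.
Proof. by []. Qed.

Lemma card_enum_rank_lt (U : finType) m :
  #|[set x : U | (enum_rank x < m)%nat]| = minn m #|U|.
Proof.
rewrite -(card_imset _ (@enum_rank_inj _)).
have -> : [set enum_rank x | x in [set x : U | (enum_rank x < m)%nat]] = [set i : 'I_#|U| | (i < m)%nat].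
  apply/setP => i; apply/imsetP/idP => [[x]|]; rewrite !inE; first by move=> xm ->.
  by move=> im; exists (enum_val i); rewrite ?inE enum_valK.
have [mN|Nm] := leqP m #|U|.
  rewrite -sum1_card -[RHS]card_ord -[RHS]sum1_card (big_ord_widen _ (fun=> 1%nat) mN).
  by apply: eq_bigl => i; rewrite inE.
rewrite -[RHS]card_ord; apply: eq_card => i.
by rewrite !inE (ltn_trans (ltn_ord i) Nm).
Qed.

Section Grid.
Variable n : nat.
Hypothesis n2 : (1 < n)%nat.
Implicit Types (s : {perm edge n}) (W H : {set 'I_n}) (e : edge n) (u v w : 'I_n).
Local Notation nr := (INR n).

Lemma n2r : 2 <= nr.
Proof. by have := le_INR _ _ (elimT leP n2). Qed.

Lemma INR_pred : INR n.-1 = nr - 1.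
Proof. by rewrite -subn1 minus_INR //; apply/leP; lia. Qed.

Lemma bin2_double m : ('C(m, 2) * 2 = m * m.-1)%nat.
Proof. by rewrite mulnC mul_bin_left bin1 subn1 mulnC. Qed.

Lemma bin2_le k h : (h <= 2 * k)%nat -> ('C(h, 2) <= k * h)%nat.
Proof. by have := bin2_double h; case: h => [|h] /=; [rewrite bin0n|nia]. Qed.

Lemma INR_bin2 m : INR 'C(m, 2) = INR m * (INR m - 1) / 2.
Proof.
have := bin2_double m.
move/(congr1 INR); rewrite !mult_INR; case: m => [|m] /=; first lra.
rewrite -/(INR m.+1) S_INR; lra.
Qed.

Lemma INR_card_edge : INR #|{: edge n}| = nr * (nr - 1) / 2.
Proof. by rewrite card_edge INR_bin2. Qed.

Definition win m : {set edge n} := [set x | (enum_rank x < m)%nat].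

Lemma G_sampled s m : G s m = sampled (win m) s.
Proof. by apply/setP => e; rewrite !inE. Qed.

Lemma card_win m : #|win m| = minn m 'C(n, 2).
Proof. by rewrite -card_edge -card_enum_rank_lt. Qed.

Lemma G_mono s m m' : (m <= m')%nat -> G s m \subset G s m'.
Proof. by move=> mm; apply/subsetP => e; rewrite !inE => H; apply: leq_trans H mm. Qed.

Lemma card_starI u v : u != v -> #|star u :&: star v| = 1%nat.
Proof.
move=> uv; have [e E] := edge_ex uv.
have -> : star u :&: star v = [set e]; last by rewrite cards1.
apply/setP => e'; rewrite !inE; apply/andP/eqP => [[ue ve]|->]; last by rewrite E !inE !eqxx orbT.
apply: val_inj; rewrite E; apply/eqP; rewrite eq_sym eqEcard subUset !sub1set ue ve /=.
by rewrite cards2 uv (eqP (valP e')).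
Qed.

Definition clique W : {set edge n} := [set e : edge n | val e \subset W].

Lemma card_clique W : #|clique W| = 'C(#|W|, 2).
Proof.
pose f (e : edge n) : {set 'I_n} := val e; have f_inj : injective f by exact: val_inj.
rewrite -(card_imset _ f_inj) -cards_draws; congr #|pred_of_set _|; apply/setP => A.
apply/imsetP/idP => [[e]|]; rewrite !inE; first by move=> eW ->; rewrite eW (valP e).
by case/andP=> AW A2; exists (exist _ A A2); rewrite ?inE.
Qed.

Lemma einsideE s m W : einside (G s m) W = #|sampled (win m) s :&: clique W|.
Proof. by rewrite /einside; apply: eq_card => e; rewrite !inE. Qed.

Lemma degsE s m v : deg (G s m) v = #|sampled (win m) s :&: star v|.
Proof. by rewrite degE G_sampled. Qed.

Lemma win_ratio j : INR #|win (j * n.-1)| / INR #|{: edge n}| <= 2 * INR j / nr.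
Proof.
have n2' := n2r; rewrite INR_card_edge.
have : INR #|win (j * n.-1)| <= INR j * (nr - 1).
  by rewrite -INR_pred -mult_INR; apply/le_INR/leP; rewrite card_win geq_minl.
move=> H; apply: (Rmult_le_reg_r (nr * (nr - 1) / 2)); first by apply: Rdiv_lt_0_compat; [apply: Rmult_lt_0_compat|]; lra.
rewrite /Rdiv Rmult_assoc Rinv_l; last by nra.
have -> : 2 * INR j * / nr * (nr * (nr - 1) * / 2) = INR j * (nr - 1) by field; lra.
by rewrite Rmult_1_r.
Qed.

Lemma einside_tail j W x k : 1 <= x ->
  Pr (fun s => (k <= einside (G s (j * n.-1)) W)%nat) <=
  exp ((x - 1) * (INR j * INR #|W| * (INR #|W| - 1) / nr)) / x ^ k.
Proof.
move=> x1; rewrite (eq_Pr (B := fun s => (k <= #|sampled (win (j * n.-1)) s :&: clique W|)%nat)); last first.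
  by move=> s; rewrite einsideE.
apply: Rle_trans (chernoff_upper _ _ _ x1) _.
apply: Rmult_le_compat_r; first by apply/Rinv_ge0/pow_le; lra.
apply: exp_le_mono; rewrite Rmult_assoc; apply: Rmult_le_compat_l; first lra.
rewrite card_clique INR_bin2; have n2' := n2r.
have w0 : 0 <= INR #|W| * (INR #|W| - 1) / 2 by rewrite -INR_bin2; apply: pos_INR.
apply: Rle_trans (Rmult_le_compat_r _ _ _ w0 (win_ratio j)) _.
by right; field; lra.
Qed.

Lemma rsum_by_card (g : nat -> R) :
  \rsum_(H : {set 'I_n} | true) g #|H| = \rsum_(h < n.+1) (INR 'C(n, h) * g h).
Proof.
have cH (H : {set 'I_n}) : (#|H| < n.+1)%nat by rewrite ltnS -[leqRHS]card_ord max_card.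
rewrite (partition_big (fun H => Ordinal (cH H)) xpredT) //=; apply: eq_bigr => h _.
rewrite (eq_bigr (fun=> g h)) => [|H /eqP <- //].
have <- : #|[set H : {set 'I_n} | #|H| == h]| = 'C(n, h).
  have := cards_draws [set: 'I_n] h; rewrite cardsT card_ord => <-.
  by apply: eq_card => H; rewrite !inE subsetT.
by rewrite rsum_const; congr (INR _ * _); apply: eq_card => H; rewrite !inE unfold_in.
Qed.

Lemma rsum_ord_const m c : \rsum_(i < m) c = INR m * c.
Proof. by rewrite rsum_const card_ord. Qed.

(** For a set of size [h] the tail bound is [(e c h / n)^(k h)], which beats the number
    [(e n / h)^h] of such sets. The resulting term is at most [exp (- k h)], and only [h > 2 k]
    matters, whence [exp (- 2 k^2)]. *)
Lemma dense_small_sets j k b c :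
  0 < c -> INR j <= c * INR k -> (0 < k)%nat ->
  exp 1 * c * INR b <= exp (-2) * nr -> exp 1 * c * exp 3 <= exp (INR k) ->
  Pr (fun s => [exists H : {set 'I_n},
     (#|H| <= b)%nat && (k * #|H| < einside (G s (j * n.-1)) H)%nat]) <=
  (nr + 1) * exp (- (2 * INR k * INR k)).
Proof.
move=> c0 jk k0 bn kbig; set Z := exp 1 * c.
have n2' := n2r; have kr : 1 <= INR k by have := le_INR _ _ (elimT leP k0).
have e1 := exp_pos 1; have Z0 : 0 < Z by apply: Rmult_lt_0_compat.
(* A set of at most [2 k] vertices has at most [k h] pairs, so it can never be too dense. *)
pose g h := if (2 * k < h <= b)%nat then (Z * INR h / nr) ^ (k * h) else 0.
apply: Rle_trans (_ : \rsum_(H : {set 'I_n} | true) g #|H| <= _).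
  apply: Rle_trans (Pr_exists xpredT _) _; apply: rsum_le => H _; rewrite /g.
  have [hb|bh] := leqP #|H| b; last first.
    rewrite andbF PrE (eq_Ex (Y := fun=> 0)) => [|s]; first by rewrite Ex1; lra.
    by [].
  have [kh|hk] := ltnP (2 * k) #|H|; last first.
    rewrite PrE (eq_Ex (Y := fun=> 0)) => [|s]; first by rewrite Ex1 /=; lra.
    rewrite ltnNge (_ : (einside _ _ <= _)%nat) // einsideE.
    apply: leq_trans (subset_leq_card (subsetIr _ _)) _; rewrite card_clique.
    by apply: bin2_le.
  apply: Rle_trans (_ : (Z * INR #|H| / nr) ^ (k * #|H|) <= _); last exact: Rle_refl.
  have hr : 0 < INR #|H| by apply/lt_0_INR/ltP; lia.
  (* This [x] turns the exponent of the tail bound into [(j / c) (h - 1)], at most [k h], while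
     [x^(k h)] is at least [(n / (c h))^(k h)]. *)
  set x := 1 + nr / (c * INR #|H|).
  have x1 : 1 <= x by rewrite /x; have := Rdiv_ge0 (x := nr) (y := c * INR #|H|); nra.
  apply: Rle_trans (Pr_le (B := fun s => (k * #|H| <= einside (G s (j * n.-1)) H)%nat) _) _.
    by move=> s /ltnW.
  apply: Rle_trans (einside_tail _ _ _ x1) _.
  have y0 : 0 < nr / (c * INR #|H|) by apply: Rdiv_lt_0_compat; nra.
  have up : exp ((x - 1) * (INR j * INR #|H| * (INR #|H| - 1) / nr)) <= exp (INR (k * #|H|)).
    apply: exp_le_mono; rewrite mult_INR.
    have -> : (x - 1) * (INR j * INR #|H| * (INR #|H| - 1) / nr) = INR j / c * (INR #|H| - 1).
      by rewrite /x; field; lra.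
    have jc : INR j / c <= INR k.
      by apply: (Rmult_le_reg_r c) => //; rewrite /Rdiv Rmult_assoc Rinv_l; lra.
    have j0 : 0 <= INR j / c by apply: Rdiv_ge0; [apply: pos_INR | lra].
    nra.
  have xp : 0 < (nr / (c * INR #|H|)) ^ (k * #|H|) by apply: pow_lt.
  apply: Rle_trans (_ : exp (INR (k * #|H|)) / (nr / (c * INR #|H|)) ^ (k * #|H|) <= _).
    apply: Rmult_le_compat => //; [exact/Rlt_le/exp_pos | by apply/Rinv_ge0/pow_le; lra |].
    apply: Rinv_le_contravar => //; apply: pow_incr; rewrite /x; lra.
  right; rewrite -(Rmult_1_r (INR (k * _))) -exp_mulnat /Rdiv -pow_inv -Rpow_mult_distr.
  by congr (_ ^ _); rewrite /Z; field; lra.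
rewrite rsum_by_card.
apply: Rle_trans (_ : \rsum_(h < n.+1) exp (- (2 * INR k * INR k)) <= _); last first.
  by rewrite rsum_ord_const S_INR; lra.
apply: rsum_le => h _; rewrite /g.
have E0 := exp_pos (- (2 * INR k * INR k)).
case: ifP => [/andP[kh hb]|_]; last lra.
have h0 : (0 < h)%nat by lia.
have hr : 0 < INR h by apply/lt_0_INR/ltP.
have hbr : INR h <= INR b by apply/le_INR/leP.
set t := Z * INR h / nr.
have t0 : 0 < t by apply: Rdiv_lt_0_compat; [apply: Rmult_lt_0_compat|lra].
have t1 : t <= exp (-2).
  apply: (Rmult_le_reg_r nr); first lra.
  have -> : t * nr = Z * INR h by rewrite /t; field; lra.
  by apply: Rle_trans bn; apply: Rmult_le_compat_l; lra.
have tk : 0 <= t ^ (k * h) by apply: pow_le; lra.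
apply: Rle_trans (Rmult_le_compat_r _ _ _ tk (bin_le_exp n h0)) _.
rewrite pow_mult -Rpow_mult_distr.
(* One factor [t] absorbs [n / h]; the other [k - 1] are at most [exp (-2)] each, giving
   [Z exp 3 exp (- 2 k)]. This is the origin of [exp 3] in the hypothesis on [k]. *)
have base : exp 1 * nr / INR h * t ^ k <= exp (- INR k).
  have -> : exp 1 * nr / INR h = exp 1 * Z / t by rewrite /t; field; lra.
  have -> : exp 1 * Z / t * t ^ k = exp 1 * Z * t ^ k.-1.
    by rewrite -{1}(prednK k0) -tech_pow_Rmult; field; lra.
  apply: Rle_trans (_ : exp 1 * Z * exp (-2) ^ k.-1 <= _).
    by apply: Rmult_le_compat_l; [nra | apply: pow_incr; lra].
  rewrite exp_mulnat.
  have -> : INR k.-1 = INR k - 1 by rewrite -subn1 minus_INR //; apply/leP.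
  have -> : exp 1 * Z * exp ((INR k - 1) * -2) = Z * exp 3 * exp (- (2 * INR k)).
    have -> : exp 1 * Z * exp ((INR k - 1) * -2) = Z * (exp 1 * exp ((INR k - 1) * -2)) by ring.
    by rewrite Rmult_assoc -!exp_plus; congr (_ * exp _); ring.
  have -> : exp (- INR k) = exp (INR k) * exp (- (2 * INR k)) by rewrite -exp_plus; congr exp; ring.
  by apply: Rmult_le_compat_r => //; apply/Rlt_le/exp_pos.
have base0 : 0 <= exp 1 * nr / INR h * t ^ k.
  by apply: Rmult_le_pos; [apply: Rdiv_ge0; nra | apply: pow_le; lra].
apply: Rle_trans (pow_incr _ _ h (conj base0 base)) _.
rewrite exp_mulnat; apply: exp_le_mono.
by have : 2 * INR k <= INR h; [have /ltnW/leP/le_INR := kh; rewrite mult_INR /=; lra | nra].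
Qed.

End Grid.

Lemma pow2_le_exp m : 2 ^ m <= exp (INR m).
Proof.
rewrite -(Rmult_1_r (INR m)) -exp_mulnat; apply: pow_incr.
by have := exp_ineq1_le 1; lra.
Qed.

Lemma exp_le_quad x : 0 <= x <= / 2 -> exp x <= 1 + x + 2 * x * x.
Proof.
move=> x01; have := exp_ineq1_le (- x); rewrite exp_Ropp => H.
have e0 := exp_pos x.
have h1 : exp x * (1 - x) <= 1.
  by apply: Rle_trans (_ : exp x * / exp x <= _); [apply: Rmult_le_compat_l; lra | rewrite Rinv_r; lra].
apply: (Rmult_le_reg_r (1 - x)); first lra.
apply: Rle_trans h1 _; nra.
Qed.

Section Grid.
Variable n : nat.
Hypothesis n2 : (1 < n)%nat.
Implicit Types (s : {perm edge n}) (W H : {set 'I_n}) (e : edge n) (u v w : 'I_n).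
Local Notation nr := (INR n).
Local Notation win := (win n).

(** A set with [w <= (1 - c) n] vertices is expected to span at most about [(1 - c) j (w - 1)]
    edges. Tilting by [exp (c / 4)] bounds the probability of exceeding [j (w - 1)] by
    [exp (- c^3 n j / 16)], which is set against all [2^n] subsets. The condition [4 <= c j] pays
    for using [j + 1] blocks of edges against the bound with [j]. *)
Lemma dense_large_sets j b c :
  0 < c <= 1 -> c * nr <= INR b -> 4 <= c * INR j ->
  Pr (fun s => [exists W : {set 'I_n},
     [&& (b < #|W|)%nat, (#|W| + b <= n)%nat &
        (j * #|W|.-1 < einside (G s (j.+1 * n.-1)) W)%nat]]) <=
  exp (nr - c * c * c * nr * INR j / 16).
Proof.
move=> c01 cb cj; have n2' := n2r n2.
have j0 : 0 <= INR j by apply: pos_INR.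
apply: Rle_trans (_ : \rsum_(W : {set 'I_n} | true) exp (- (c * c * c * nr * INR j / 16)) <= _); last first.
  rewrite rsum_const.
  have -> : INR #|(fun _ : {set 'I_n} => true)| = 2 ^ n.
    have -> : #|(fun _ : {set 'I_n} => true)| = expn 2 n.
      have := card_powerset [set: 'I_n]; rewrite cardsT card_ord => <-.
      by apply: eq_card => W; rewrite inE subsetT.
    by elim: n => // m IH; rewrite expnS mult_INR IH.
  rewrite /Rminus exp_plus; apply: Rmult_le_compat_r; first exact/Rlt_le/exp_pos.
  exact: pow2_le_exp.
apply: Rle_trans (Pr_exists xpredT _) _; apply: rsum_le => W _.
apply: Rle_trans (_ : exp (- (c * c * c * nr * INR j / 16)) <= _); last exact: Rle_refl.
have e0 := exp_pos (- (c * c * c * nr * INR j / 16)).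
have [bW|Wb] := ltnP b #|W|; last first.
  by rewrite PrE (eq_Ex (Y := fun=> 0)) => [|s]; first by rewrite Ex1; lra.
have [Wn|nW] := leqP (#|W| + b) n; last first.
  by rewrite PrE (eq_Ex (Y := fun=> 0)) => [|s]; first by rewrite Ex1; lra.
set th := c / 4; have x1 : 1 <= exp th by have := exp_ineq1_le th; rewrite /th; lra.
apply: Rle_trans (Pr_le (B := fun s => (j * #|W|.-1 <= einside (G s (j.+1 * n.-1)) W)%nat) _) _.
  by move=> s /ltnW.
apply: Rle_trans (einside_tail n2 _ _ _ x1) _.
have -> : INR j.+1 * INR #|W| * (INR #|W| - 1) / nr = (INR j + 1) * (INR #|W| / nr) * (INR #|W| - 1).
  by rewrite S_INR; field; lra.
set w := INR #|W|.
have w1 : INR b <= w - 1 by rewrite /w; have := le_INR _ _ (elimT leP bW); rewrite S_INR; lra.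
have wn : w / nr <= 1 - c.
  apply: (Rmult_le_reg_r nr); first lra.
  rewrite /Rdiv Rmult_assoc Rinv_l; last lra.
  by have := le_INR _ _ (elimT leP Wn); rewrite plus_INR -/w; lra.
have w0 : 0 <= w / nr by apply: Rdiv_ge0; [apply: pos_INR | lra].
rewrite exp_mulnat mult_INR.
have -> : INR #|W|.-1 = w - 1 by rewrite /w -subn1 minus_INR //; apply/leP; lia.
rewrite /Rdiv -exp_Ropp -exp_plus; apply: exp_le_mono.
have th0 : 0 <= th <= / 2 by rewrite /th; lra.
have := exp_le_quad th0 => eq.
have cn : c * nr <= w - 1 by lra.
have cn0 : 0 <= c * nr by apply: Rmult_le_pos; lra.
have h1 : (exp th - 1) * ((INR j + 1) * (w / nr)) <= th * (INR j - c * INR j / 4).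
  apply: Rle_trans (_ : (th * (1 + 2 * th)) * ((INR j + 1) * (1 - c)) <= _).
    apply: Rmult_le_compat; [lra | by apply: Rmult_le_pos; lra | lra |].
    by apply: Rmult_le_compat_l; lra.
  rewrite Rmult_assoc; apply: Rmult_le_compat_l; first lra.
  have -> : (1 + 2 * th) * ((INR j + 1) * (1 - c)) = (INR j + 1) * ((1 + 2 * th) * (1 - c)) by ring.
  have h2 : (1 + 2 * th) * (1 - c) <= 1 - c / 2 by rewrite /th; nra.
  apply: Rle_trans (_ : (INR j + 1) * (1 - c / 2) <= _); first by apply: Rmult_le_compat_l; lra.
  lra.
have h3 : (exp th - 1) * ((INR j + 1) * (w / nr) * (w - 1)) <= th * (INR j - c * INR j / 4) * (w - 1).
  by rewrite -Rmult_assoc; apply: Rmult_le_compat_r => //; lra.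
apply: Rle_trans (Rplus_le_compat_r _ _ _ h3) _.
have -> : th * (INR j - c * INR j / 4) * (w - 1) + - (INR j * (w - 1) * th) = - (c * c * INR j / 16 * (w - 1)).
  by rewrite /th; field.
apply: Ropp_le_contravar.
have -> : c * c * c * nr * INR j * / 16 = c * c * INR j / 16 * (c * nr) by field.
by apply: Rmult_le_compat_l => //; apply: Rdiv_ge0; [apply: Rmult_le_pos => //; nra | lra].
Qed.

(** The mean degree is [2 j (n - 1) / n]. For [k = j] the threshold is about half the mean, where
    the base 2 of [chernoff_lower] is the optimal tilt, so the exponent is sharp. *)
Lemma low_degree j k : (j * n.-1 <= 'C(n, 2))%nat ->
  Pr (fun s => [exists v, (deg (G s (j * n.-1)) v <= k)%nat]) <=
  nr * (2 ^ k * exp (- (INR j * (nr - 1) / nr))).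
Proof.
move=> jN; have n2' := n2r n2.
have edge0 : (0 < #|{: edge n}|)%nat by rewrite card_edge bin_gt0.
apply: Rle_trans (Pr_exists xpredT (fun v s => (deg (G s (j * n.-1)) v <= k)%nat)) _.
rewrite -[X in INR X * _](card_ord n) -rsum_const; apply: rsum_le => v _.
rewrite (eq_Pr (B := fun s => (#|sampled (win (j * n.-1)) s :&: star v| <= k)%nat)); last first.
  by move=> s; rewrite degsE.
apply: Rle_trans (chernoff_lower _ _ _ edge0) _; right; congr (_ * exp (- _)).
rewrite card_star card_win (minn_idPl jN) INR_card_edge mult_INR INR_pred //.
by field; lra.
Qed.

Definition window j : {set edge n} := win (j.+1 * n.-1) :\: win (j * n.-1).

Lemma card_window j : (#|window j| <= n.-1)%nat.
Proof.
rewrite cardsD (setIidPr _); last by apply/subsetP => e; rewrite !inE mulSn => H; apply: leq_trans H (leq_addl _ _).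
by rewrite !card_win mulSn; lia.
Qed.

Lemma deg_window s j v :
  (deg (G s (j.+1 * n.-1)) v <= deg (G s (j * n.-1)) v + #|sampled (window j) s :&: star v|)%nat.
Proof.
rewrite !degsE; apply: leq_trans (leq_card_setU _ _); apply/subset_leq_card/subsetP => e.
by rewrite !inE => /andP[-> ->]; case: (enum_rank _ < j * _)%nat.
Qed.

(** A vertex gains fewer than 2 edges on average in one block; [x] stays free so that the tail in
    [g] can be made to decay at any exponential rate. *)
Lemma window_gain j g x : 1 <= x ->
  Pr (fun s => [exists v, (g <= #|sampled (window j) s :&: star v|)%nat]) <=
  nr * (exp (2 * (x - 1)) / x ^ g).
Proof.
move=> x1; have n2' := n2r n2.
apply: Rle_trans (Pr_exists xpredT (fun v s => (g <= #|sampled (window j) s :&: star v|)%nat)) _.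
rewrite -[X in INR X * _](card_ord n) -rsum_const; apply: rsum_le => v _.
apply: Rle_trans (chernoff_upper _ _ _ x1) _.
apply: Rmult_le_compat_r; first by apply/Rinv_ge0/pow_le; lra.
apply: exp_le_mono; rewrite card_star INR_pred // INR_card_edge Rmult_assoc Rmult_comm.
apply: Rmult_le_compat_r; first lra.
have W1 : INR #|window j| <= nr - 1 by rewrite -INR_pred //; apply/le_INR/leP/card_window.
apply: Rle_trans (_ : (nr - 1) / (nr * (nr - 1) / 2) * (nr - 1) <= _).
  apply: Rmult_le_compat_r; first lra.
  apply: Rmult_le_compat_r => //; apply: Rinv_ge0; nra.
have -> : (nr - 1) / (nr * (nr - 1) / 2) * (nr - 1) = 2 * ((nr - 1) / nr) by field; lra.
have : (nr - 1) / nr <= 1; last lra.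
by apply: (Rmult_le_reg_r nr); [lra | rewrite /Rdiv Rmult_assoc Rinv_l; lra].
Qed.
End Grid.

Lemma edge_other n (e : edge n) w : w \in val e -> exists2 u, u != w & val e = [set w; u].
Proof.
have [x [y [xy E]]] := edgeP e; rewrite E !inE => /orP[]/eqP->.
  by exists y; rewrite // eq_sym.
by exists x; rewrite // setUC.
Qed.

(** * Separation of low-degree vertices *)

Section Separation.
Variable n : nat.
Implicit Types (s : {perm edge n}) (W C F : {set edge n}) (e : edge n) (u v w : 'I_n).
Local Notation nr := (INR n).

Definition low F k := [set v | (deg F v < k)%nat].
Definition low_edge F k := [exists e, (e \in F) && (val e \subset low F k)].
Definition low_cherry F k := [exists w, [exists e, [exists e',
  [&& e \in star w, e' \in star w & e != e'] &&
  [&& e \in F, e' \in F, (val e :\ w) :&: low F k != set0 & (val e' :\ w) :&: low F k != set0]]]].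

Section Fixed.
Variables (W : {set edge n}) (k : nat).
Local Notation N := #|{: edge n}|.
Hypotheses (aN : (4 * n.-1 <= N)%nat) (M4 : (4 * #|W| <= N)%nat)
  (kM : (k <= #|W|)%nat) (ka : (k <= n.-1)%nat) (a0 : (1 < n.-1)%nat).
Local Notation K := (qi_const N n.-1 k).
Local Notation y := (4 * INR #|W| / INR N).
Local Notation cdf := (hypergeom_cdf W).

(** The stars are made disjoint from each other and from [C] by deleting their common edge and [C],
    at most three edges; putting them back raises the threshold from [k] to [k + 3]. *)
Lemma two_low C u v : u != v -> (#|C| <= 2)%nat ->
  Pr (fun s => [&& C \subset sampled W s, (deg (sampled W s) u < k)%nat & (deg (sampled W s) v < k)%nat])
  <= K * y ^ #|C| * (cdf n.-1 (k + 3) * cdf n.-1 (k + 3)).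
Proof.
move=> uv C2.
pose A := star u :\: (star v :|: C); pose B := star v :\: (star u :|: C).
have Aa : (#|A| <= n.-1)%nat by rewrite -(card_star u) subset_leq_card ?subsetDl.
have Ba : (#|B| <= n.-1)%nat by rewrite -(card_star v) subset_leq_card ?subsetDl.
have dAB : [disjoint A & B].
  by rewrite -setI_eq0; apply/eqP/setP => e; rewrite !inE; case: (u \in _); case: (v \in _); rewrite ?andbF.
have dC : [disjoint A :|: B & C].
  by rewrite -setI_eq0; apply/eqP/setP => e; rewrite !inE; case: (e \in C); rewrite ?orbT ?andbF.
have y0 : 0 <= y by apply: Rdiv_ge0; [have := pos_INR #|W|; lra | apply: pos_INR].
apply: Rle_trans (_ : K * y ^ #|C| * (cdf #|A| k * cdf #|B| k) <= _).
  apply: Rle_trans (quasi_independence aN M4 kM ka (ltnW a0) Aa Ba (leq_trans C2 a0) dAB dC).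
  apply: Pr_le => s /and3P[-> du dv] /=; apply/andP; split.
    by apply: leq_ltn_trans du; rewrite degE; apply/subset_leq_card/setIS/subsetDl.
  by apply: leq_ltn_trans dv; rewrite degE; apply/subset_leq_card/setIS/subsetDl.
have near (x z : 'I_n) : x != z -> cdf #|star x :\: (star z :|: C)| k <= cdf n.-1 (k + 3).
  move=> xz; rewrite -(card_star x) -!Pr_lt; apply: Pr_le => s H.
  rewrite -(cardsID (star x :\: (star z :|: C)) (sampled W s :&: star x)).
  have h1 : (#|sampled W s :&: star x :&: (star x :\: (star z :|: C))| < k)%nat.
    by apply: leq_ltn_trans H; apply/subset_leq_card/subsetP => e; rewrite !inE => /andP[/andP[-> _]].
  have h2 : (#|(sampled W s :&: star x) :\: (star x :\: (star z :|: C))| <= 3)%nat.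
    apply: leq_trans (_ : #|(star x :&: star z) :|: C| <= _)%nat.
      apply/subset_leq_card/subsetP => e; rewrite !inE.
      by case: (x \in _); case: (z \in _); case: (e \in C); rewrite ?andbF.
    by apply: leq_trans (leq_card_setU _ _) _; rewrite card_starI //; apply: (leq_add (leqnn 1) C2).
  by apply: leq_trans (leq_add h1 h2); rewrite addSn.
have c0 (X : {set edge n}) m : 0 <= cdf #|X| m by rewrite -Pr_lt; apply: Pr_ge0.
apply: Rmult_le_compat_l; first by apply: Rmult_le_pos; [apply/Rlt_le/exp_pos | apply: pow_le].
by apply: Rmult_le_compat => //; apply: near; rewrite // eq_sym.
Qed.

Lemma low_edge_bound :
  Pr (fun s => low_edge (sampled W s) k) <= INR N * (K * y * (cdf n.-1 (k + 3) * cdf n.-1 (k + 3))).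
Proof.
apply: Rle_trans (Pr_exists xpredT (fun e s => (e \in sampled W s) && (val e \subset low (sampled W s) k))) _.
rewrite -rsum_const; apply: rsum_le => e _.
have [u [v [uv E]]] := edgeP e.
have c1 : (#|[set e]| <= 2)%nat by rewrite cards1.
have := two_low uv c1; rewrite cards1 pow_1; apply: Rle_trans; apply: Pr_le => s /andP[eF].
by rewrite E subUset !sub1set !inE => /andP[-> ->]; rewrite inE in eF; rewrite eF.
Qed.

Lemma low_cherry_bound :
  Pr (fun s => low_cherry (sampled W s) k) <=
  nr * (nr * (nr * (K * y ^ 2 * (cdf n.-1 (k + 3) * cdf n.-1 (k + 3))))).
Proof.
set X := K * _ * _.
have X0 : 0 <= X.
  apply: Rmult_le_pos.
    apply: Rmult_le_pos; first exact/Rlt_le/exp_pos.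
    by apply: pow_le; apply: Rdiv_ge0; [have := pos_INR #|W|; lra | apply: pos_INR].
  have n0 : (0 < n)%nat by apply: leq_trans (leq_pred n); apply: ltnW.
  by rewrite -(card_star (Ordinal n0)) -Pr_lt; apply: Rmult_le_pos; apply: Pr_ge0.
have starn w : INR #|star w| <= nr by rewrite card_star; apply/le_INR/leP/leq_pred.
apply: Rle_trans (Pr_exists xpredT _) _.
rewrite -[X in INR X * _](card_ord n) -rsum_const; apply: rsum_le => w _.
apply: Rle_trans (Pr_le (B := fun s => [exists e, (e \in star w) && [exists e', ((e' \in star w) && (e != e')) &&
   [&& e \in sampled W s, e' \in sampled W s, (val e :\ w) :&: low (sampled W s) k != set0
     & (val e' :\ w) :&: low (sampled W s) k != set0]]]) _) _.
  move=> s /existsP[e /existsP[e' /andP[/and3P[h1 h2 h3] h4]]]; apply/existsP; exists e; rewrite h1 /=.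
  by apply/existsP; exists e'; rewrite h2 h3.
apply: Rle_trans (Pr_exists (fun e => e \in star w) _) _.
apply: Rle_trans (_ : \rsum_(e in star w) (nr * X) <= _); last first.
  rewrite rsum_const; apply: Rmult_le_compat_r; last exact: starn.
  by apply: Rmult_le_pos => //; apply: pos_INR.
apply: rsum_le => e ew.
apply: Rle_trans (Pr_exists (fun e' => (e' \in star w) && (e != e')) _) _.
apply: Rle_trans (_ : \rsum_(e' | (e' \in star w) && (e != e')) X <= _); last first.
  rewrite rsum_const; apply: Rmult_le_compat_r => //; apply: Rle_trans (starn w).
  by apply/le_INR/leP/subset_leq_card/subsetP => e'; rewrite unfold_in => /andP[].
apply: rsum_le => e' /andP[e'w ee'].
have we : w \in val e by move: ew; rewrite inE.
have we' : w \in val e' by move: e'w; rewrite inE.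
have [u uw E] := edge_other we; have [v vw E'] := edge_other we'.
have uv : u != v.
  by apply: contraNneq ee' => uv; apply/eqP/val_inj; rewrite E E' uv.
have c2 : #|[set e; e']| = 2%nat by rewrite cards2 ee'.
have := two_low uv (eq_leq c2); rewrite c2; apply: Rle_trans; apply: Pr_le => s.
have lowE z : z != w -> (([set w; z] : {set 'I_n}) :\ w) :&: low (sampled W s) k != set0 -> (deg (sampled W s) z < k)%nat.
  by move=> zw /set0Pn[t]; rewrite !inE => /andP[/andP[tw /orP[/eqP tE|/eqP ->]]] //; rewrite tE eqxx in tw.
rewrite E E' => /and4P[h1 h2 /(lowE _ uw) -> /(lowE _ vw) ->].
by rewrite subUset !sub1set h1 h2.
Qed.
End Fixed.
End Separation.

(** * Deterministic conclusions for a fixed ordering *)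

Section Deterministic.
Local Open Scope nat_scope.
Variable n : nat.
Hypothesis n2 : 1 < n.
Implicit Types (s : {perm edge n}) (W H : {set 'I_n}) (e : edge n) (u v w : 'I_n).

Lemma card_G s m : m <= 'C(n, 2) -> #|G s m| = m.
Proof. by move=> mN; rewrite G_sampled card_sampled card_win (minn_idPl mN). Qed.

Lemma einside_mono (F F' : {set edge n}) W : F \subset F' -> einside F W <= einside F' W.
Proof.
by move/subsetP=> sub; apply/subset_leq_card/subsetP => e; rewrite !inE => /andP[/sub -> ->].
Qed.

(** Edges are counted in [Gam_{j+1}], which contains every [G_m] of block [j], so that one event
    serves the whole block. *)
Definition small_sparse j k b s :=
  ~~ [exists H : {set 'I_n}, (#|H| <= b) && (k * #|H| < einside (G s (j.+1 * n.-1)) H)].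

Definition large_sparse j b s :=
  ~~ [exists W : {set 'I_n}, [&& b < #|W|, #|W| + b <= n &
        j * #|W|.-1 < einside (G s (j.+1 * n.-1)) W]].

Lemma T_ge_of_sparse s m j k b t k2 :
  m <= 'C(n, 2) -> j * n.-1 <= m -> m <= j.+1 * n.-1 -> t <= j -> t <= mindeg (G s m) ->
  k.*2 <= j -> small_sparse j k b s -> large_sparse j b s ->
  (forall v, deg (G s m) v < t + k.*2.+2 -> deg (G s (j.+1 * n.-1)) v < k2) ->
  ~~ low_edge (G s (j.+1 * n.-1)) k2 -> ~~ low_cherry (G s (j.+1 * n.-1)) k2 ->
  t <= T (G s m).
Proof.
move=> mN jm mj tj td kj sm la lowk nle nlc.
have sub : G s m \subset G s (j.+1 * n.-1) by apply: G_mono.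
have smP H : #|H| <= b -> einside (G s m) H <= k * #|H|.
  move=> Hb; rewrite leqNgt; apply: contra sm => H2; apply/existsP; exists H; rewrite Hb.
  exact: leq_trans H2 (einside_mono _ sub).
have laP W : b < #|W| -> #|W| + b <= n -> einside (G s m) W <= j * #|W|.-1.
  move=> h1 h2; rewrite leqNgt; apply: contra la => h3; apply/existsP; exists W; rewrite h1 h2.
  exact: leq_trans h3 (einside_mono _ sub).
apply: T_ge => //; apply: (@has_trees_of_expansion _ _ t j b) => //.
- exact: ltnW.
- by rewrite card_G.
- move=> W W0 Wn; have [Wb|bW] := leqP #|W| b; last exact: laP.
  have [W1|W1] := leqP #|W| 1.
    have -> : einside (G s m) W = 0; last by [].
    apply/eqP; rewrite einsideE -leqn0; apply: leq_trans (subset_leq_card (subsetIr _ _)) _.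
    by rewrite card_clique leqn0 -leqn0 leqNgt bin_gt0 -ltnNge.
  (* For [|W| >= 2], [k |W| <= 2 k (|W| - 1) <= j (|W| - 1)]; this is the use of [k.*2 <= j]. *)
  apply: leq_trans (smP W Wb) _; move: W1 kj; rewrite -mul2n; move: #|W| => x; nia.
move=> U Ub; apply: (@cut_of_sparse_low n (G s m) t k b [set v | deg (G s m) v < t + k.*2.+2]) => //.
- by move=> v; apply: leq_trans td (mindeg_le _ _).
- by move=> v; rewrite inE -leqNgt.
- move=> e eG; apply: contra nle => el; apply/existsP; exists e; rewrite (subsetP sub) //=.
  by apply: subset_trans el _; apply/subsetP => v; rewrite !inE; apply: lowk.
- move=> e e' w eG e'G wl we we' el e'l; apply/eqP; apply: contraNT nlc => ee'.
  have aux (x : {set 'I_n}) : x :&: [set v | deg (G s m) v < t + k.*2.+2] != set0 ->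
      (x :\ w) :&: low (G s (j.+1 * n.-1)) k2 != set0.
    case/set0Pn=> v; rewrite in_setI => /andP[vx vl]; apply/set0Pn; exists v.
    rewrite !in_setI in_setD1 vx andbT; apply/andP; split.
      by apply: contraNneq wl => <-.
    by move: vl; rewrite !inE; apply: lowk.
  apply/existsP; exists w; apply/existsP; exists e; apply/existsP; exists e'.
  apply/andP; split; first by rewrite ee' !inE we we'.
  apply/and4P; split; [exact: (subsetP sub) | exact: (subsetP sub) | exact: aux | exact: aux].
exact: ltnW.
Qed.

Lemma no_low_edge0 (F : {set edge n}) : ~~ low_edge F 0.
Proof.
apply/existsP => -[e /andP[_ /subsetP el]]; have [x [y [_ E]]] := edgeP e.
by have := el x; rewrite E set21 inE => /(_ isT).
Qed.

Lemma no_low_cherry0 (F : {set edge n}) : ~~ low_cherry F 0.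
Proof.
apply/existsP => -[w /existsP[e /existsP[e' /andP[_ /and4P[_ _ /set0Pn[x]]]]]].
by rewrite !inE ltn0 andbF.
Qed.

Lemma low_edge_mono (F : {set edge n}) k k' : k <= k' -> low_edge F k -> low_edge F k'.
Proof.
move=> kk /existsP[e /andP[eF el]]; apply/existsP; exists e; rewrite eF.
by apply: subset_trans el _; apply/subsetP => v; rewrite !inE => H; apply: leq_trans H kk.
Qed.

Lemma low_cherry_mono (F : {set edge n}) k k' : k <= k' -> low_cherry F k -> low_cherry F k'.
Proof.
move=> kk /existsP[w /existsP[e /existsP[e' /andP[h /and4P[h1 h2 h3 h4]]]]].
have lk : low F k \subset low F k'.
  by apply/subsetP => v; rewrite !inE => H; apply: leq_trans H kk.
have aux (A : {set 'I_n}) : A :&: low F k != set0 -> A :&: low F k' != set0.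
  by apply: contra => /eqP A0; rewrite -subset0 -A0 setIS.
apply/existsP; exists w; apply/existsP; exists e; apply/existsP; exists e'.
by apply/andP; split=> //; apply/and4P; split=> //; apply: aux.
Qed.

(* [k] absorbs the increase of a degree between [Gam_j] and [Gam_{j+1}]; a vertex of degree
   less than [t + 2 k + 2] in [G_m] has degree less than [t + 3 k + 2] in [Gam_{j+1}]. *)
Definition mid_good j k s :=
  (mindeg (G s (j.+1 * n.-1)) == 0) ||
  [&& ~~ low_edge (G s (j.+1 * n.-1)) (minn (mindeg (G s (j.+1 * n.-1))) j + 3 * k + 2),
      ~~ low_cherry (G s (j.+1 * n.-1)) (minn (mindeg (G s (j.+1 * n.-1))) j + 3 * k + 2) &
      ~~ [exists v, k < #|sampled (window n j) s :&: star v|]].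

(** Under this event no vertex has degree below [t + 2 k + 2] when [t <= j]: the low set is empty
    and the separation conditions hold with threshold 0. *)
Definition high_good j k s := ~~ [exists v, deg (G s (j * n.-1)) v <= j + k.*2.+1].

Lemma mindeg_mono (F F' : {set edge n}) : F \subset F' -> mindeg F <= mindeg F'.
Proof.
move=> sub; rewrite mindeg_deg ?(ltnW n2) //; apply/forallP => v.
exact: leq_trans (mindeg_le _ _) (deg_mono v sub).
Qed.

Lemma T_eq_min s m : m <= 'C(n, 2) ->
  minn (mindeg (G s m)) (m %/ n.-1) <= T (G s m) ->
  T (G s m) = minn (mindeg (G s m)) (m %/ n.-1).
Proof.
by move=> mN H; apply/eqP; rewrite eqn_leq H -{3}(card_G s mN) T_le_min.
Qed.

Lemma T_of_mid s m k b : let j := m %/ n.-1 in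
  m <= 'C(n, 2) -> k.*2 <= j -> small_sparse j k b s -> large_sparse j b s ->
  mid_good j k s -> T (G s m) = minn (mindeg (G s m)) j.
Proof.
move=> j mN kj sm la; have n1 : 0 < n.-1 by lia.
have jm : j * n.-1 <= m by apply: leq_trunc_div.
have mj : m <= j.+1 * n.-1 by apply: ltnW; apply: ltn_ceil.
have sub : G s m \subset G s (j.+1 * n.-1) by apply: G_mono.
have dle := mindeg_mono sub.
case/orP=> [/eqP d0 | /and3P[nle nlc gain]]; apply: T_eq_min => //.
  by move: dle; rewrite d0 leqn0 => /eqP ->; rewrite min0n.
apply: (T_ge_of_sparse mN jm mj _ _ kj sm la _ nle nlc); rewrite ?geq_minr ?geq_minl //.
move=> v dv; apply: leq_ltn_trans (deg_window _ _ _) _.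
have gv : #|sampled (window n j) s :&: star v| <= k.
  by rewrite leqNgt; apply: contra gain => H; apply/existsP; exists v.
have d1 := deg_mono v (G_mono s jm).
have d2 : minn (mindeg (G s m)) j <= minn (mindeg (G s (j.+1 * n.-1))) j by rewrite leq_min geq_minr geq_min dle.
move: dv; rewrite -mul2n; move: d1 d2 gv; lia.
Qed.

Lemma T_of_high s m k b : let j := m %/ n.-1 in
  m <= 'C(n, 2) -> k.*2 <= j -> small_sparse j k b s -> large_sparse j b s ->
  high_good j k s -> T (G s m) = minn (mindeg (G s m)) j.
Proof.
move=> j mN kj sm la; have n1 : 0 < n.-1 by lia.
have jm : j * n.-1 <= m by apply: leq_trunc_div.
have mj : m <= j.+1 * n.-1 by apply: ltnW; apply: ltn_ceil.
move=> hi; apply: T_eq_min => //.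
apply: (T_ge_of_sparse mN jm mj _ _ kj sm la _ (no_low_edge0 _) (no_low_cherry0 _)); rewrite ?geq_minr ?geq_minl //.
move=> v dv; case/existsP: hi; exists v.
have d1 := deg_mono v (G_mono s jm); have := geq_minr (mindeg (G s m)) j.
by move: dv d1; rewrite addnS ltnS => dv d1 tj; apply: leq_trans d1 (leq_trans dv _); rewrite leq_add2r.
Qed.
End Deterministic.

(** * Asymptotics *)

Definition evt (P : nat -> Prop) := exists N, forall n, (N <= n)%nat -> P n.

Lemma evt_and P Q : evt P -> evt Q -> evt (fun n => P n /\ Q n).
Proof.
case=> N HN [N' HN']; exists (maxn N N') => n; rewrite geq_max => /andP[h h'].
by split; [apply: HN | apply: HN'].
Qed.

Lemma evt_imp P Q : evt P -> (forall n, P n -> Q n) -> evt Q.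
Proof. by case=> N HN PQ; exists N => n /HN /PQ. Qed.

Lemma evt_ge N : evt (fun n => (N <= n)%nat).
Proof. by exists N. Qed.

Lemma evt_INR A : evt (fun n => A <= INR n).
Proof.
have [N HN] := INR_unbounded A; exists N => n /leP/le_INR; lra.
Qed.

Lemma ln_le_mono x y : 0 < x -> x <= y -> ln x <= ln y.
Proof. by move=> x0 [xy|->]; [apply/Rlt_le/ln_increasing | lra]. Qed.

Lemma evt_ln A : evt (fun n => A <= ln (INR n)).
Proof.
apply: evt_imp (evt_INR (exp A)) _ => n H; rewrite -(ln_exp A).
exact: ln_le_mono (exp_pos _) H.
Qed.

Lemma evt_poly A k c : 0 < c -> evt (fun n => A * ln (INR n) ^ k <= exp (c * ln (INR n))).
Proof.
move=> c0; apply: evt_imp (evt_and (evt_ln 0) (evt_ln (Rabs A * INR k.+1`! / c ^ k.+1))) _ => n [L0 L1].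
set L := ln (INR n) in L0 L1 *.
have cp : 0 < c ^ k.+1 by apply: pow_lt.
have u0 : 0 <= c * L by apply: Rmult_le_pos; lra.
have := pow_le_fact_exp k.+1 u0; rewrite Rpow_mult_distr => H.
have fp : 0 < INR k.+1`! by apply/lt_0_INR/ltP/fact_gt0.
have Lk : 0 <= L ^ k by apply: pow_le.
apply: Rle_trans (_ : Rabs A * L ^ k <= _); first by apply: Rmult_le_compat_r => //; apply: Rle_abs.
apply: (Rmult_le_reg_l (INR k.+1`!)) => //; apply: Rle_trans H.
have -> : INR k.+1`! * (Rabs A * L ^ k) = c ^ k.+1 * (Rabs A * INR k.+1`! / c ^ k.+1 * L ^ k) by field; lra.
apply: Rmult_le_compat_l; first lra.
by rewrite -tech_pow_Rmult; apply: Rmult_le_compat_r.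
Qed.

Lemma evt_small A k c c' : c' < c ->
  evt (fun n => A * ln (INR n) ^ k * exp (- (c * ln (INR n))) <= exp (- (c' * ln (INR n)))).
Proof.
move=> cc; have d0 : 0 < c - c' by lra.
apply: evt_imp (evt_poly A k d0) _ => n H.
have -> : - (c' * ln (INR n)) = (c - c') * ln (INR n) + - (c * ln (INR n)) by ring.
by rewrite exp_plus; apply: Rmult_le_compat_r => //; apply/Rlt_le/exp_pos.
Qed.

Lemma evt_vanish A k c eps : 0 < c -> 0 < eps ->
  evt (fun n => A * ln (INR n) ^ k * exp (- (c * ln (INR n))) <= eps).
Proof.
move=> c0 e0; have c2 : c / 2 < c by lra.
apply: evt_imp (evt_and (evt_small A k c2) (evt_ln (ln (/ eps) / (c / 2)))) _ => n [H1 H2].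
apply: Rle_trans H1 _; rewrite -[eps in _ <= eps]exp_ln //; apply: exp_le_mono.
rewrite ln_Rinv // in H2.
have : - ln eps <= c / 2 * ln (INR n); last lra.
have -> : - ln eps = c / 2 * (- ln eps / (c / 2)) by field; lra.
by apply: Rmult_le_compat_l; lra.
Qed.

Lemma aas_bad (A : forall n, pred {perm edge n}) (b : nat -> R) :
  evt (fun n => Pr (fun s => ~~ A n s) <= b n) ->
  (forall eps, 0 < eps -> evt (fun n => b n <= eps)) -> aas A.
Proof.
move=> H1 H2 eps e0; have [N HN] := evt_and H1 (H2 _ e0); exists N => n /HN[h1 h2].
by rewrite probE; rewrite PrC in h1; lra.
Qed.

Lemma aas_and (A B : forall n, pred {perm edge n}) :
  aas A -> aas B -> aas (fun n s => A n s && B n s).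
Proof.
move=> HA HB eps e0; have e2 : 0 < eps / 2 by lra.
have [N HN] := HA _ e2; have [N' HN'] := HB _ e2; exists (maxn N N') => n.
rewrite geq_max => /andP[/HN h /HN' h']; rewrite !probE in h h' *.
have := PrU (fun s => ~~ A n s) (fun s => ~~ B n s).
rewrite (eq_Pr (B := fun s => ~~ (A n s && B n s))) => [|s]; last by rewrite negb_and.
by rewrite !PrC; lra.
Qed.

Lemma aas_imp (A B : forall n, pred {perm edge n}) :
  aas A -> evt (fun n => forall s, A n s -> B n s) -> aas B.
Proof.
move=> HA [N' HN'] eps e0; have [N HN] := HA _ e0; exists (maxn N N') => n.
rewrite geq_max => /andP[/HN h /HN' h']; rewrite !probE in h *.
by apply: Rle_trans h _; apply: Pr_le.
Qed.

Lemma aas_block (lo hi : nat -> nat) (P : forall n, nat -> pred {perm edge n}) (b : nat -> R) :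
  evt (fun n => forall j, (lo n <= j < hi n)%nat -> Pr (fun s => ~~ P n j s) <= b n) ->
  (forall eps, 0 < eps -> evt (fun n => INR (hi n) * b n <= eps)) ->
  evt (fun n => 0 <= b n) ->
  aas (fun n s => [forall j : 'I_(hi n), (lo n <= j)%nat ==> P n j s]).
Proof.
move=> H1 H2 H3; apply: aas_bad H2; apply: evt_imp (evt_and H1 H3) _ => n [h b0].
apply: Rle_trans (Pr_le (B := fun s => [exists j : 'I_(hi n), (lo n <= j)%nat && ~~ P n j s]) _) _.
  move=> s; rewrite negb_forall => /existsP[j]; rewrite negb_imply => H.
  by apply/existsP; exists j.
apply: Rle_trans (Pr_exists (fun j : 'I_(hi n) => (lo n <= j)%nat) (fun j s => ~~ P n j s)) _.
apply: Rle_trans (_ : \rsum_(j : 'I_(hi n) | (lo n <= j)%nat) b n <= _).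
  by apply: rsum_le => j lj; apply: h; rewrite lj ltn_ord.
rewrite rsum_const; apply: Rmult_le_compat_r => //.
by apply/le_INR/leP; rewrite -[leqRHS]card_ord max_card.
Qed.

(** [up x] is the integer strictly above [x], so the value at an integer [x >= 0] is [x + 1]. *)
Definition natceil (x : R) := Z.to_nat (up x).

Lemma natceil_gt x : 0 <= x -> x < INR (natceil x).
Proof.
move=> x0; have [h _] := archimed x; rewrite /natceil INR_IZR_INZ Znat.Z2Nat.id; first lra.
by apply: le_IZR; lra.
Qed.

Lemma natceil_le x : 0 <= x -> INR (natceil x) <= x + 1.
Proof.
move=> x0; have [h h'] := archimed x; rewrite /natceil INR_IZR_INZ Znat.Z2Nat.id; first lra.
by apply: le_IZR; lra.
Qed.

Lemma le_of_lt_natceil j x : 0 <= x -> (j < natceil x)%nat -> INR j <= x.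
Proof.
by move=> x0 /leP/le_INR; rewrite S_INR; have := natceil_le x0; lra.
Qed.

Lemma ge_of_natceil_le j x : 0 <= x -> (natceil x <= j)%nat -> x <= INR j.
Proof. by move=> x0 /leP/le_INR; have := natceil_gt x0; lra. Qed.

Lemma exp_ln_INR n : (0 < n)%nat -> exp (ln (INR n)) = INR n.
Proof. by move=> n0; apply: exp_ln; apply/lt_0_INR/ltP. Qed.

(** * Estimates at one grid point *)

Lemma grid_card_win n j : (8 <= n)%nat -> (96 * j <= n)%nat ->
  #|win n (j * n.-1)| = (j * n.-1)%nat.
Proof.
move=> n8 jn; rewrite card_win; apply/minn_idPl.
by have := bin2_double n; move: 'C(n, 2) => B; case: n n8 jn => // m; rewrite /=; nia.
Qed.

Lemma grid_edges n : (8 <= n)%nat -> (4 * n.-1 <= #|{: edge n}|)%nat.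
Proof.
move=> n8; rewrite card_edge; have := bin2_double n; move: 'C(n, 2) => B.
by case: n n8 => // m; rewrite /=; nia.
Qed.

Lemma grid_win4 n j : (8 <= n)%nat -> (96 * j <= n)%nat ->
  (4 * #|win n (j * n.-1)| <= #|{: edge n}|)%nat.
Proof.
move=> n8 jn; rewrite grid_card_win // card_edge; have := bin2_double n; move: 'C(n, 2) => B.
by case: n n8 jn => // m; rewrite /=; nia.
Qed.

Section GridSecondMoment.
Variables n j k : nat.
Hypotheses (n8 : (8 <= n)%nat) (jn : (96 * j <= n)%nat) (kn : (40 * k <= n)%nat) (kj : (k <= j)%nat) (j0 : (0 < j)%nat).
Local Notation q := (hypergeom_cdf (win n (j * n.-1)) n.-1 k).

(** In [second_moment] the relative errors become [20 k / n] and [8 j / n]; [40 k <= n] and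
    [96 j <= n] are exactly the bounds [1/2] and [1/12] required there, and [168 = 40 + 128] since
    [k <= j]. *)
Lemma exists_low_degree : 0 < q ->
  Pr (fun s : {perm edge n} => ~~ [exists v, (deg (G s (j * n.-1)) v < k)%nat]) <=
  / (INR n * q) + 168 * INR j / INR n.
Proof.
move=> q0; have n8r : 8 <= INR n by have := le_INR _ _ (elimT leP n8); rewrite /=; lra.
have jnr : 96 * INR j <= INR n by have := le_INR _ _ (elimT leP jn); rewrite mult_INR /=; lra.
have knr : 40 * INR k <= INR n by have := le_INR _ _ (elimT leP kn); rewrite mult_INR /=; lra.
have kjr := le_INR _ _ (elimT leP kj); have k0 := pos_INR k.
have n1 : (1 < n)%nat by lia.
have M1 : INR (j * n.-1) = INR j * (INR n - 1) by rewrite mult_INR INR_pred.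
have Ne := INR_card_edge n.
have xE : 10 * INR k * INR n.-1 / INR #|{: edge n}| = 20 * INR k / INR n.
  by rewrite Ne INR_pred //; field; lra.
have yE : 4 * INR (j * n.-1) / INR #|{: edge n}| = 8 * INR j / INR n.
  by rewrite Ne M1; field; lra.
have := @second_moment _ (win n (j * n.-1)) 'I_n (@star n) n.-1 k (grid_edges n8) (grid_win4 n8 jn).
rewrite grid_card_win // xE.
move=> /(_ _ _ _ (@card_star n)) H.
have k1 : (k <= j * n.-1)%nat by case: n n8 => // m; rewrite /=; nia.
have k2 : (k <= n.-1)%nat by lia.
have k3 : (0 < n.-1)%nat by lia.
have {}H := H k1 k2 k3 (fun u v uv => card_starI uv).
rewrite yE card_ord in H.
rewrite (eq_Pr (B := fun s => [forall v, (k <= #|sampled (win n (j * n.-1)) s :&: star v|)%nat])); last first.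
  by move=> s; rewrite negb_exists; apply: eq_forallb => v; rewrite -leqNgt degsE.
have in0 : 0 < / INR n by apply: Rinv_0_lt_compat; lra.
apply: Rle_trans (H _ _ q0 _) _.
- apply: (Rmult_le_reg_r (INR n)); first lra.
  by rewrite /Rdiv Rmult_assoc Rinv_l; lra.
- apply: (Rmult_le_reg_r (INR n)); first lra.
  by rewrite /Rdiv Rmult_assoc Rinv_l; lra.
- exact: ltnW.
rewrite Rplus_assoc; apply: Rplus_le_compat_l.
have -> : 2 * (20 * INR k / INR n) + 16 * (8 * INR j / INR n) = (40 * INR k + 128 * INR j) / INR n by field; lra.
by apply: Rmult_le_compat_r; lra.
Qed.
End GridSecondMoment.

Lemma bernoulli_le u i : 0 <= u <= 1 -> 1 - INR i * u <= (1 - u) ^ i.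
Proof.
move=> u01; elim: i => [|i IH]; first by rewrite /=; lra.
rewrite S_INR -tech_pow_Rmult; have := pos_INR i => i0.
have p1 : 0 <= (1 - u) ^ i by apply: pow_le; lra.
nra.
Qed.

Section CdfLower.
Variables n j : nat.
Hypotheses (n8 : (8 <= n)%nat) (jn : (96 * j <= n)%nat) (j2n : (18 * j * j + 2 <= n)%nat) (j0 : (0 < j)%nat).
Local Notation W := (win n (j * n.-1)).
Local Notation N := (INR #|{: edge n}|).

Let n8r : 8 <= INR n. Proof. by have := le_INR _ _ (elimT leP n8); rewrite /=; lra. Qed.
Let j1 : 1 <= INR j. Proof. by have := le_INR _ _ (elimT leP j0). Qed.
Let n1 : (1 < n)%nat. Proof. by lia. Qed.
Let j2nr : 18 * INR j * INR j + 2 <= INR n.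
Proof. by have := le_INR _ _ (elimT leP j2n); rewrite plus_INR !mult_INR /=; lra. Qed.
Let WE : INR #|W| = INR j * (INR n - 1).
Proof. by rewrite grid_card_win // mult_INR INR_pred. Qed.

Lemma grid_pmf_lower i : (i < j)%nat ->
  ((INR n.-1 - INR i) * (INR #|W| - INR i) / N) ^ i * exp (- (2 * INR j + 1)) <= INR i`! * hypergeom_pmf W n.-1 i.
Proof.
move=> ij.
(* This is exactly [M / (N - a)] for [M = j (n - 1)] and [a = n - 1]. The condition
   [18 j^2 + 2 <= n] keeps [a (z + 2 z^2)] below [2 j + 1]. *)
pose z := 2 * INR j / (INR n - 2).
have z0 : 0 <= z by apply: Rdiv_ge0; lra.
have z1 : z <= / 2.
  apply: (Rmult_le_reg_r (INR n - 2)); first lra.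
  by rewrite /z /Rdiv Rmult_assoc Rinv_l; nra.
have Mz : INR #|W| <= z * (N - INR n.-1).
  by rewrite WE INR_card_edge INR_pred //; right; rewrite /z; field; lra.
have ijr := lt_INR _ _ (elimT ltP ij).
have := @pmf_lower _ W n.-1 i z; move=> H.
have h1 : (i <= n.-1)%nat by lia.
have h2 : (i <= #|W|)%nat.
  rewrite grid_card_win //; apply: leq_trans (ltnW ij) _; rewrite leq_pmulr //; lia.
have h3 : (n.-1 < #|{: edge n}|)%nat by have := grid_edges n8; lia.
apply: Rle_trans (H h1 h2 h3 z0 z1 Mz).
apply: Rmult_le_compat_l.
  apply: pow_le; apply: Rdiv_ge0; last exact: pos_INR.
  have := le_INR _ _ (elimT leP h1); have := le_INR _ _ (elimT leP h2) => *.
  by apply: Rmult_le_pos; lra.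
apply: exp_le_mono; apply: Ropp_le_contravar; rewrite INR_pred //.
  rewrite /z; set m := INR n - 2.
  have m0 : 0 < m by rewrite /m; lra.
  have -> : INR n - 1 = m + 1 by rewrite /m; ring.
  have -> : (m + 1) * (2 * INR j / m + 2 * INR j / m * (2 * INR j / m) * 2) =
      2 * INR j + (2 * INR j + 8 * INR j * INR j + 8 * INR j * INR j / m) / m.
    by field; lra.
  apply: Rplus_le_compat_l; apply: (Rmult_le_reg_r m) => //.
  rewrite /Rdiv (Rmult_assoc _ (/ m) m) Rinv_l ?Rmult_1_r ?Rmult_1_l; last lra.
  have jm : 18 * (INR j * INR j) <= m by rewrite /m; lra.
  have jj : INR j <= INR j * INR j by nra.
  have : 8 * INR j * INR j * / m <= 1; last lra.
  by apply: (Rmult_le_reg_r m) => //; rewrite Rmult_assoc Rinv_l; lra.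
Qed.

Lemma cdf_lower_isolated : exp (- (2 * INR j + 1)) <= hypergeom_cdf W n.-1 1.
Proof.
have := @grid_pmf_lower 0 j0; rewrite /= Rmult_1_l Rmult_1_l => H.
by rewrite cdfS {1}/hypergeom_cdf big_ord0 Rplus_0_l.
Qed.

(** The single term at [j - 1] already suffices: it is of Poisson size
    [(2 j)^(j-1) exp (- 2 j) / (j-1)!], which [fact_le] turns into [(2 / e)^j] up to a factor of
    order [j]. *)
Lemma cdf_lower_main : 2 ^ j * exp (- INR j) <= 4 * exp 2 * INR j * hypergeom_cdf W n.-1 j.
Proof.
have [i ij] : exists i, j = i.+1 by case: j j0 => // i _; exists i.
have iltj : (i < j)%nat by rewrite ij.
have H := grid_pmf_lower iltj.
have ir : INR i = INR j - 1 by rewrite ij S_INR; lra.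
have f0 : 0 < INR i`! by apply/lt_0_INR/ltP/fact_gt0.
have fj := fact_le j0.
rewrite {1}ij factS -ij mult_INR -tech_pow_Rmult in fj.
have fi : INR i`! * exp (INR j) <= exp 1 * INR j ^ j.
  by apply: (Rmult_le_reg_l (INR j)); lra.
set B := (_ * _ / N) in H.
have B1 : 2 * INR j * (1 - (1 + INR j) / INR n) <= B.
  rewrite /B WE INR_pred // INR_card_edge ir.
  apply: (Rmult_le_reg_r (INR n * (INR n - 1) / 2)); first by nra.
  rewrite /Rdiv (Rmult_assoc _ (/ _) (INR n * _ * _)) Rinv_l ?Rmult_1_r; last by nra.
  have -> : 2 * INR j * (1 - (1 + INR j) * / INR n) * (INR n * (INR n - 1) * / 2) =
     INR j * (INR n - 1) * (INR n - 1 - INR j) by field; lra.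
  nra.
have nj : INR j * (1 + INR j) / INR n <= / 2.
  apply: (Rmult_le_reg_r (INR n)); first lra.
  by rewrite /Rdiv Rmult_assoc Rinv_l; nra.
set u := (1 + INR j) / INR n.
have u0 : 0 <= u by apply: Rdiv_ge0; lra.
have uj : INR j * u <= / 2 by rewrite /u; lra.
have u1 : u <= 1 by nra.
have B2 : (2 * INR j) ^ i * / 2 <= B ^ i.
  apply: Rle_trans (_ : (2 * INR j * (1 - u)) ^ i <= _); last first.
    by apply: pow_incr; split => //; apply: Rmult_le_pos; lra.
  rewrite (Rpow_mult_distr _ (1 - u)); apply: Rmult_le_compat_l; first by apply: pow_le; lra.
  apply: Rle_trans (_ : 1 - INR i * u <= _); last by apply: bernoulli_le.
  rewrite ir; nra.
have E0 := exp_pos (- (2 * INR j + 1)).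
have H2 : (2 * INR j) ^ i * / 2 * exp (- (2 * INR j + 1)) <= INR i`! * hypergeom_pmf W n.-1 i.
  by apply: Rle_trans H; apply: Rmult_le_compat_r; lra.
have aU : (n.-1 <= #|{: edge n}|)%nat by have := grid_edges n8; lia.
have c1 : hypergeom_pmf W n.-1 i <= hypergeom_cdf W n.-1 j.
  rewrite {3}ij cdfS; have : 0 <= hypergeom_cdf W n.-1 i; last lra.
  by apply: rsum_ge0 => l _; apply: pmf_ge0.
have jp : 0 < INR j ^ i by apply: pow_lt; lra.
have ej := exp_pos (INR j).
have H3 : (2 * INR j) ^ i * / 2 * exp (- (2 * INR j + 1)) * exp (INR j) <= exp 1 * INR j ^ j * hypergeom_cdf W n.-1 j.
  apply: Rle_trans (_ : INR i`! * hypergeom_cdf W n.-1 j * exp (INR j) <= _).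
    apply: Rmult_le_compat_r; first lra.
    by apply: Rle_trans H2 _; apply: Rmult_le_compat_l; lra.
  have -> : INR i`! * hypergeom_cdf W n.-1 j * exp (INR j) = INR i`! * exp (INR j) * hypergeom_cdf W n.-1 j by ring.
  apply: Rmult_le_compat_r => //.
  by apply: rsum_ge0 => l _; apply: pmf_ge0.
have p2 : 2 ^ j = 2 * 2 ^ i by rewrite {1}ij.
have pj : INR j ^ j = INR j * INR j ^ i by rewrite {2}ij.
have eE : exp (- INR j) = exp 1 * (exp (- (2 * INR j + 1)) * exp (INR j)).
  by rewrite -!exp_plus; congr exp; ring.
have e2 : exp 2 = exp 1 * exp 1 by rewrite -exp_plus; congr exp; ring.
rewrite p2 eE e2; rewrite Rpow_mult_distr pj in H3.
apply: (Rmult_le_reg_l (INR j ^ i)) => //.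
have e1 := exp_pos 1.
have := Rmult_le_compat_l (4 * exp 1) _ _ (ltac:(lra)) H3.
by move=> H4; apply: Rle_trans (Rle_trans _ _ _ _ H4) _; right; field.
Qed.
End CdfLower.

Lemma last_below (P : nat -> Prop) J : P 0%nat -> (forall k, P k \/ ~ P k) ->
  exists k, [/\ (k <= J)%nat, P k & (k < J)%nat -> ~ P k.+1].
Proof.
move=> P0 dP; elim: J => [|J [k [kJ Pk nP]]]; first by exists 0%nat.
move: kJ; rewrite leq_eqVlt => /orP[/eqP kJ|kJ]; last first.
  by exists k; split=> //; [apply: leqW; apply: ltnW | move=> _; apply: nP].
have [PS|nPS] := dP J.+1; first by exists J.+1; split=> //; rewrite ltnn.
by exists k; split=> //; [rewrite kJ | move=> _; rewrite kJ].
Qed.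

(** * The middle range, with [j] of order [ln n] *)

Section Middle.
Variables n j k : nat.
Hypotheses (n8 : (8 <= n)%nat) (jn : (96 * j.+1 <= n)%nat) (j0 : (0 < j)%nat) (kj : (2 * k <= j)%nat).
Local Notation W := (win n (j.+1 * n.-1)).
Local Notation N := (INR #|{: edge n}|).
Local Notation nr := (INR n).
Local Notation q := (hypergeom_cdf W n.-1).

Let n8r : 8 <= nr. Proof. by have := le_INR _ _ (elimT leP n8); rewrite /=; lra. Qed.
Let j1 : 1 <= INR j. Proof. by have := le_INR _ _ (elimT leP j0). Qed.
Let n1 : (1 < n)%nat. Proof. by lia. Qed.
Let jnr : 96 * (INR j + 1) <= nr.
Proof. by have := le_INR _ _ (elimT leP jn); rewrite mult_INR (S_INR j) /=; lra. Qed.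
Let WE : INR #|W| = (INR j + 1) * (nr - 1).
Proof. by rewrite grid_card_win // mult_INR INR_pred // S_INR. Qed.
Let aU : (n.-1 <= #|{: edge n}|)%nat.
Proof. by have := grid_edges n8; lia. Qed.

Definition growth_factor := (INR (3 * k + 5) + 1) * (exp 9 ^ (3 * k + 5) * exp (4 * (INR j + 1) / exp 9)).

Lemma q_growth kst : q (kst.+1 + 3 * k + 5) <= growth_factor * q kst.+1.
Proof.
rewrite -addnA /growth_factor (Rplus_comm (INR _)).
have e9 : 1 <= exp 9 by have := exp_ineq1_le 9; lra.
apply: (@cdf_growth _ W n.-1 kst (3 * k + 5) (4 * (INR j + 1)) (exp 9)) => //; first lra.
  rewrite WE INR_card_edge INR_pred //.
  have jnr' := jnr; set J := INR j + 1 in jnr' *; have J0 : 1 <= J by rewrite /J; lra.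
  have -> : (nr - 1) * (J * (nr - 1)) = J * (nr - 1) * (nr - 1) by ring.
  have -> : 4 * J * (nr * (nr - 1) / 2 - J * (nr - 1) - (nr - 1)) = J * (nr - 1) * (2 * nr - 4 * J - 4) by field.
  by apply: Rmult_le_compat_l; [apply: Rmult_le_pos; lra | lra].
rewrite WE INR_card_edge INR_pred //.
have -> : nr * (nr - 1) / 2 - (INR j + 1) * (nr - 1) - (nr - 1) = (nr - 1) * (nr / 2 - INR j - 2) by field.
by apply: Rmult_lt_0_compat; lra.
Qed.

(** With [J = j + 1], the union bounds carry the factors [N y = 4 J (n - 1)] for edges and
    [n^3 y^2 = 64 J^2 n] for cherries, together at most [68 J^2 n]; [qi_const] is at most [e <= 3],
    whence 204. *)
Lemma sep_fail k2 : (k2 <= 3 * j + 2)%nat ->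
  Pr (fun s : {perm edge n} => low_edge (G s (j.+1 * n.-1)) k2) + Pr (fun s : {perm edge n} => low_cherry (G s (j.+1 * n.-1)) k2)
  <= 204 * (INR j + 1) * (INR j + 1) * nr * (q (k2 + 3) * q (k2 + 3)).
Proof.
move=> k2j.
have h1 : (k2 <= n.-1)%nat by lia.
have h2 : (k2 <= #|W|)%nat.
  rewrite grid_card_win //; apply: leq_trans k2j _; move: n8; rewrite -(ltn_predK n1); move: n.-1 => m; nia.
have h3 : (1 < n.-1)%nat by lia.
have L1 := low_edge_bound (grid_edges n8) (grid_win4 n8 jn) h2 h1 h3.
have L2 := low_cherry_bound (grid_edges n8) (grid_win4 n8 jn) h2 h1 h3.
have -> : Pr (fun s : {perm edge n} => low_edge (G s (j.+1 * n.-1)) k2) = Pr (fun s => low_edge (sampled W s) k2).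
  by apply: eq_Pr => s; rewrite G_sampled.
have -> : Pr (fun s : {perm edge n} => low_cherry (G s (j.+1 * n.-1)) k2) = Pr (fun s => low_cherry (sampled W s) k2).
  by apply: eq_Pr => s; rewrite G_sampled.
apply: Rle_trans (Rplus_le_compat _ _ _ _ L1 L2) _.
set Q := q (k2 + 3) * q (k2 + 3).
have Q0 : 0 <= Q.
  by apply: Rmult_le_pos; apply: rsum_ge0 => l _; apply: pmf_ge0.
have yE : 4 * INR #|W| / N = 8 * (INR j + 1) / nr by rewrite WE INR_card_edge; field; lra.
have K3 : qi_const #|{: edge n}| n.-1 k2 <= 3.
  apply: Rle_trans exp_le_3; apply: exp_le_mono; rewrite INR_pred // INR_card_edge.
  have -> : 10 * INR k2 * (nr - 1) / (nr * (nr - 1) / 2) = 20 * INR k2 / nr by field; lra.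
  apply: (Rmult_le_reg_r nr); first lra.
  rewrite /Rdiv Rmult_assoc Rinv_l; last lra.
  by have := le_INR _ _ (elimT leP k2j); rewrite plus_INR mult_INR /=; lra.
have K0 : 0 < qi_const #|{: edge n}| n.-1 k2 by apply: exp_pos.
rewrite yE INR_card_edge; set K := qi_const _ _ _ in K3 K0 *.
have jnr' := jnr; set J := INR j + 1 in jnr' *.
have J1 : 1 <= J by rewrite /J; lra.
have -> : nr * (nr - 1) / 2 * (K * (8 * J / nr) * Q) + nr * (nr * (nr * (K * (8 * J / nr) ^ 2 * Q))) =
  K * (Q * (4 * J * (nr - 1) + 64 * J * J * nr)) by field; lra.
have J2 : 4 * J * (nr - 1) + 64 * J * J * nr <= 68 * J * J * nr.
  have : J * (nr - 1) <= J * J * nr; last lra.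
  have : J * nr <= J * J * nr by apply: Rmult_le_compat_r; nra.
  lra.
apply: Rle_trans (_ : 3 * (Q * (68 * J * J * nr)) <= _); last by right; ring.
apply: Rmult_le_compat; [lra | | exact: K3 | exact: Rmult_le_compat_l].
apply: Rmult_le_pos => //; nra.
Qed.

(* [z] plays the role of [n^(1/8)], the expected number of vertices of degree below the
   threshold [kst]. *)
Lemma mid_fail z x : 0 < z <= nr -> 1 <= x ->
  Pr (fun s : {perm edge n} => ~~ mid_good j k s) <=
  / z + 168 * (INR j + 1) / nr
  + 204 * (INR j + 1) * (INR j + 1) * (growth_factor * growth_factor) * (z * z) / nr
  + nr * (exp (2 * (x - 1)) / x ^ k.+1).
Proof.
move=> z0 x1.
have gr0 : 0 <= nr * (exp (2 * (x - 1)) / x ^ k.+1).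
  by apply: Rmult_le_pos; [lra | apply: Rdiv_ge0; [apply/Rlt_le/exp_pos | apply: pow_le; lra]].
have gf0 : 0 <= growth_factor.
  have := pos_INR (3 * k + 5) => h; apply: Rmult_le_pos; first lra.
  by apply: Rmult_le_pos; [apply/pow_le/Rlt_le/exp_pos | apply/Rlt_le/exp_pos].
have sep0 : 0 <= 204 * (INR j + 1) * (INR j + 1) * (growth_factor * growth_factor) * (z * z) / nr.
  by apply: Rdiv_ge0; [apply: Rmult_le_pos; nra | lra].
(* If [kst < j], the expectation at [kst + 1] is at least [z], so the second moment gives a vertex
   of degree at most [kst]. If [kst = j], then [minn (mindeg _) j <= kst] holds trivially. *)
have [kst [kstj kP kN]] : exists kst, [/\ (kst <= j)%nat, nr * q kst < z & (kst < j)%nat -> ~ (nr * q kst.+1 < z)].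
  apply: last_below => [|m]; first by rewrite /hypergeom_cdf big_ord0; lra.
  by have [h|h] := Rlt_le_dec (nr * q m) z; [left | right; lra].
have low_fail : (kst < j)%nat ->
   Pr (fun s : {perm edge n} => ~~ [exists v, (deg (G s (j.+1 * n.-1)) v < kst.+1)%nat]) <= / z + 168 * (INR j + 1) / nr.
  move=> kj'; have {}kN : z <= nr * q kst.+1 by have := kN kj'; lra.
  have q0 : 0 < q kst.+1 by nra.
  have h1 : (40 * kst.+1 <= n)%nat by lia.
  have h2 : (kst.+1 <= j.+1)%nat by lia.
  have := exists_low_degree n8 jn h1 h2 isT q0; rewrite S_INR => H.
  apply: Rle_trans H _; apply: Rplus_le_compat_r.
  by apply: Rinv_le_contravar; lra.
have zp : 0 <= / z + 168 * (INR j + 1) / nr.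
  have : 0 < / z by apply: Rinv_0_lt_compat; lra.
  have : 0 <= 168 * (INR j + 1) / nr by apply: Rdiv_ge0; lra.
  lra.
have low_mindeg (s : {perm edge n}) m : [exists v, (deg (G s (j.+1 * n.-1)) v < m.+1)%nat] -> (mindeg (G s (j.+1 * n.-1)) <= m)%nat.
  by case/existsP=> v dv; apply: leq_trans (mindeg_le _ v) _.
(* For [kst = 0] the low vertex is isolated and [mid_good] holds by its first alternative. This case
   is separate because [q 0 = 0] gives nothing to compare with in [q_growth]. *)
have [kst0|kst0] := posnP kst.
  have kj' : (kst < j)%nat by rewrite kst0.
  apply: Rle_trans (Pr_le _) _; last apply: Rle_trans (low_fail kj') _; last lra.
  move=> s; apply: contra => /low_mindeg; rewrite kst0 leqn0 => d0.
  by rewrite /mid_good d0.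
have [ks ksE] : exists ks, kst = ks.+1 by case: kst kst0 {kstj kP kN low_fail} => // ks _; exists ks.
set k2 := (kst + 3 * k + 2)%nat.
have k2j : (k2 <= 3 * j + 2)%nat by rewrite /k2; lia.
pose E1 (s : {perm edge n}) := (kst < j)%nat && ~~ [exists v, (deg (G s (j.+1 * n.-1)) v < kst.+1)%nat].
pose E4 (s : {perm edge n}) := [exists v, (k.+1 <= #|sampled (window n j) s :&: star v|)%nat].
apply: Rle_trans (_ : Pr (fun s => E1 s || (low_edge (G s (j.+1 * n.-1)) k2 || low_cherry (G s (j.+1 * n.-1)) k2) || E4 s) <= _).
  apply: Pr_le => s; apply: contraNT; rewrite !negb_or => /andP[/andP[nE1 /andP[nle nlc]] nE4].
  have dk : (minn (mindeg (G s (j.+1 * n.-1))) j <= kst)%nat.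
    move: nE1; rewrite negb_and negbK -leqNgt => /orP[jk|/low_mindeg dk].
      by rewrite geq_min jk orbT.
    by rewrite geq_min dk.
  apply/orP; right; apply/and3P; split=> //.
    by apply: contra nle; apply: low_edge_mono; rewrite !leq_add2r.
  by apply: contra nlc; apply: low_cherry_mono; rewrite !leq_add2r.
apply: Rle_trans (PrU _ _) _; apply: Rplus_le_compat; last exact: window_gain.
apply: Rle_trans (PrU _ _) _; apply: Rplus_le_compat.
  have [kj'|jk] := boolP (kst < j)%nat.
    apply: Rle_trans (Pr_le _) (low_fail kj') => s; by case/andP.
  rewrite PrE (eq_Ex (Y := fun=> 0)) => [|s]; first by rewrite Ex1.
  by rewrite /E1 (negPf jk).
apply: Rle_trans (PrU _ _) _; apply: Rle_trans (sep_fail k2j) _.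
have g := q_growth ks; rewrite -ksE in g.
have -> : (k2 + 3 = kst + 3 * k + 5)%nat by rewrite /k2; lia.
have q0 m : 0 <= q m by apply: rsum_ge0 => l _; apply: pmf_ge0.
have qz : q (kst + 3 * k + 5) <= growth_factor * (z / nr).
  apply: Rle_trans g _; apply: Rmult_le_compat_l => //.
  apply: (Rmult_le_reg_r nr); first lra.
  by rewrite /Rdiv Rmult_assoc Rinv_l; lra.
have qq : q (kst + 3 * k + 5) * q (kst + 3 * k + 5) <= growth_factor * (z / nr) * (growth_factor * (z / nr)).
  exact: Rmult_le_compat.
apply: Rle_trans (Rmult_le_compat_l _ _ _ _ qq) _; first nra.
by right; field; lra.
Qed.
End Middle.

Local Notation lnn n := (ln (INR n)).

Lemma evt_grid c : 0 < c -> evt (fun n => [/\ 1 <= lnn n, (8 <= n)%nat, exp (lnn n) = INR n &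
  forall j, INR j <= c * lnn n -> (96 * j.+1 <= n)%nat /\ (18 * j.+1 * j.+1 + 2 <= n)%nat]).
Proof.
move=> c0.
apply: evt_imp (evt_and (evt_and (evt_ln 1) (evt_ge 8)) (evt_poly (18 * (c + 1) * (c + 1) + 96 * (c + 1) + 2) 2 Rlt_0_1)) _.
move=> n [[L1 n8] H]; rewrite Rmult_1_l in H.
have E := exp_ln_INR (ltac:(lia) : (0 < n)%nat).
split=> // j jL; rewrite E in H; set L := lnn n in L1 H jL.
have j1 : INR j.+1 <= (c + 1) * L by rewrite S_INR; lra.
have j0 := pos_INR j.+1.
have LL : L <= L ^ 2 by rewrite /=; nra.
have jj : INR j.+1 * INR j.+1 <= (c + 1) * (c + 1) * L ^ 2.
  have -> : (c + 1) * (c + 1) * L ^ 2 = (c + 1) * L * ((c + 1) * L) by ring.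
  exact: Rmult_le_compat.
have j2 : INR j.+1 <= (c + 1) * L ^ 2.
  by apply: Rle_trans j1 _; apply: Rmult_le_compat_l; lra.
have c2 : 0 <= (c + 1) * L ^ 2 by lra.
have c3 : 0 <= (c + 1) * (c + 1) * L ^ 2 by nra.
have i96 : INR 96 = 96 by rewrite /=; lra.
have i18 : INR 18 = 18 by rewrite /=; lra.
have i2 : INR 2 = 2 by rewrite /=; lra.
split; apply/leP/INR_le; first by rewrite mult_INR i96; lra.
by rewrite plus_INR !mult_INR i18 i2; nra.
Qed.

(** For [j] close to [ln n / 4] a vertex is isolated with probability at least [exp (- 2 j - 1)], of
    order [n^(-1/2)], so the expected number of isolated vertices tends to infinity. *)
Lemma aas_zero_degree :
  aas (fun n s => mindeg (G s (natceil (/ 4 * lnn n) * n.-1)) == 0%nat).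
Proof.
pose b n := exp 3 * lnn n ^ 0 * exp (- (/ 2 * lnn n)) + 168 * 2 * lnn n ^ 1 * exp (- (1 * lnn n)).
apply: (@aas_bad _ b).
  apply: evt_imp (evt_grid Rlt_0_1) _ => n [L1 n8 E gr].
  set L := lnn n in L1 E gr *; have L0 : 0 <= / 4 * L by lra.
  set J := natceil _; have Jgt := natceil_gt L0; have Jle := natceil_le L0; rewrite -/J in Jgt Jle.
  have J0 : (0 < J)%nat by apply/ltP/INR_lt; rewrite /=; lra.
  have [jn j2n] : (96 * J <= n)%nat /\ (18 * J * J + 2 <= n)%nat.
    have [] := gr J.-1; last by rewrite prednK.
    by have -> : INR J.-1 = INR J - 1; [rewrite -subn1 minus_INR //; apply/leP | lra].
  have n40 : (40 * 1 <= n)%nat by lia.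
  have q1 := cdf_lower_isolated n8 jn j2n J0.
  have e0 := exp_pos (- (2 * INR J + 1)).
  have n0 : 0 < INR n by rewrite -E; apply: exp_pos.
  apply: Rle_trans (Rle_trans _ _ _ (Pr_le _) (exists_low_degree n8 jn n40 J0 J0 (Rlt_le_trans _ _ _ e0 q1))) _.
    move=> s; apply: contra => /existsP[v dv]; rewrite -leqn0.
    by apply: leq_trans (mindeg_le _ v) _.
  apply: Rplus_le_compat.
    rewrite /b /= Rmult_1_r -exp_plus.
    apply: Rle_trans (_ : / exp (L - (2 * INR J + 1)) <= _).
      apply: Rinv_le_contravar; first exact: exp_pos.
      by rewrite /Rminus exp_plus E; apply: Rmult_le_compat_l; [lra | exact: q1].
    by rewrite -exp_Ropp; apply: exp_le_mono; rewrite -/L; lra.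
  rewrite /b pow_1 Rmult_1_l exp_Ropp E /Rdiv; apply: Rmult_le_compat_r; first exact/Rlt_le/Rinv_0_lt_compat.
  rewrite -/L; lra.
move=> eps e0; have e2 : 0 < eps / 2 by lra.
have h2 : 0 < / 2 by lra.
apply: evt_imp (evt_and (evt_vanish (exp 3) 0 h2 e2) (evt_vanish (168 * 2) 1 Rlt_0_1 e2)) _ => n [].
by rewrite /b; lra.
Qed.

Section GridEvents.
Variables D Q : nat.
Hypotheses (D_large : 20000 <= INR D) (Q_large : 2 * INR D * exp 3 <= INR Q).
Local Notation kap j := (j %/ D)%nat.
Local Notation lo n := (natceil (/ 4 * lnn n)).
Local Notation mid n := (natceil (20 * lnn n)).

Let D0 : (0 < D)%nat. Proof. by apply/ltP/INR_lt; rewrite /=; lra. Qed.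

Let kap_gt j : INR j < INR D * (INR (kap j) + 1).
Proof. by have := lt_INR _ _ (elimT ltP (ltn_ceil j D0)); rewrite mult_INR S_INR; lra. Qed.

Let kap_le j : INR D * INR (kap j) <= INR j.
Proof. by have := le_INR _ _ (elimT leP (leq_divM j D)); rewrite mult_INR; lra. Qed.

Let Q0 : 0 < INR Q.
Proof. by have := exp_pos 3; nra. Qed.

Lemma lo_kap c : evt (fun n => forall j, (lo n <= j)%nat -> c <= INR (kap j)).
Proof.
apply: evt_imp (evt_and (evt_ln 0) (evt_ln (4 * INR D * (c + 1)))) _ => n [L0 L1] j lj.
have L4 : 0 <= / 4 * lnn n by lra.
have := ge_of_natceil_le L4 lj; have := kap_gt j => h1 h2.
have : INR D * (c + 1) < INR D * (INR (kap j) + 1) by lra.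
by move/(Rmult_lt_reg_l _ _ _ (ltac:(lra) : 0 < INR D)); lra.
Qed.

Lemma lo_large c : evt (fun n => forall j, (lo n <= j)%nat -> c <= INR j).
Proof.
apply: evt_imp (evt_and (evt_ln 0) (evt_ln (4 * c))) _ => n [L0 L1] j lj.
have L4 : 0 <= / 4 * lnn n by lra.
by have := ge_of_natceil_le L4 lj; lra.
Qed.

Lemma lo_kap_ln : evt (fun n => forall j, (lo n <= j)%nat -> 3 * lnn n <= 2 * INR (kap j) * INR (kap j)).
Proof.
apply: evt_imp (evt_and (evt_ln (8 * INR D)) (evt_ln (96 * INR D * INR D))) _ => n [L0 L1] j lj.
have L4 : 0 <= / 4 * lnn n by lra.
have := ge_of_natceil_le L4 lj; have := kap_gt j => h1 h2.
set L := lnn n in L0 L1 L4 h2 *; set kk := INR (kap j) in h1 *.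
have h3 : L / 8 <= INR D * kk by lra.
have h4 : L / 8 * (L / 8) <= INR D * kk * (INR D * kk) by apply: Rmult_le_compat; lra.
have D2 : 0 < INR D * INR D by nra.
apply: (Rmult_le_reg_l (INR D * INR D)) => //; nra.
Qed.

Lemma small_bound eps : 0 < eps -> evt (fun n => INR n * (2 * exp (- (2 * lnn n))) <= eps).
Proof.
move=> e0; apply: evt_imp (evt_and (evt_vanish 2 0 Rlt_0_1 e0) (evt_ge 1)) _ => n [H n0].
apply: Rle_trans H; rewrite -{1}(exp_ln_INR n0) /=; right.
have -> : exp (lnn n) * (2 * exp (- (2 * lnn n))) = 2 * (exp (lnn n) * exp (- (2 * lnn n))) by ring.
by rewrite -exp_plus Rmult_1_r; congr (_ * exp _); ring.
Qed.

Lemma aas_small_sparse :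
  aas (fun n s => [forall j : 'I_n, (lo n <= j)%nat ==> small_sparse j (kap j) (n %/ Q) s]).
Proof.
apply: (@aas_block (fun n => lo n) (fun n => n) (fun n j s => small_sparse j (kap j) (n %/ Q) s)
  (fun n => 2 * exp (- (2 * lnn n)))); [|exact: small_bound|].
  apply: evt_imp (evt_and (evt_and (lo_kap 1) (lo_kap (ln (exp 1 * (2 * INR D) * exp 3)))) (evt_and lo_kap_ln (evt_ge 2))) _.
  move=> n [[k1 kb] [kL n2]] j /andP[lj jn]; have {}k1 := k1 _ lj; have {}kb := kb _ lj; have {}kL := kL _ lj.
  have k0 : (0 < kap j)%nat by apply/ltP/INR_lt; rewrite /=; lra.
  have c0 : 0 < 2 * INR D by lra.
  have n0 : (0 < n)%nat by lia.
  have E := exp_ln_INR n0.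
  have jc : INR j.+1 <= 2 * INR D * INR (kap j).
    have : (j.+1 <= D * 2 * kap j)%nat by have := ltn_ceil j D0; nia.
    by move/leP/le_INR; rewrite !mult_INR /=; lra.
  (* [2 D] bounds the ratio of [j + 1] to [j %/ D], and [Q] was chosen as at least [2 D exp 3] to
     make this inequality hold. *)
  have bQ : exp 1 * (2 * INR D) * INR (n %/ Q) <= exp (-2) * INR n.
    have h : INR (n %/ Q) * INR Q <= INR n by rewrite -mult_INR; apply/le_INR/leP/leq_divM.
    have h' : INR (n %/ Q) * (2 * INR D * exp 3) <= INR n.
      by apply: Rle_trans h; apply: Rmult_le_compat_l => //; apply: pos_INR.
    have -> : exp 1 = exp (-2) * exp 3 by rewrite -exp_plus; congr exp; ring.
    have := Rmult_le_compat_l _ _ _ (Rlt_le _ _ (exp_pos (-2))) h'; lra.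
  have eb : exp 1 * (2 * INR D) * exp 3 <= exp (INR (kap j)).
    have e1 := exp_pos 1; have e3 := exp_pos 3.
    rewrite -[X in X <= _]exp_ln; first exact: exp_le_mono.
    by apply: Rmult_lt_0_compat => //; apply: Rmult_lt_0_compat.
  rewrite (eq_Pr (B := fun s => [exists H : {set 'I_n}, (#|H| <= n %/ Q)%nat && (kap j * #|H| < einside (G s (j.+1 * n.-1)) H)%nat])); last first.
    by move=> s; rewrite negbK.
  apply: Rle_trans (dense_small_sets n2 c0 jc k0 bQ eb) _.
  have e3 : exp (- (2 * INR (kap j) * INR (kap j))) <= exp (- (3 * lnn n)) by apply: exp_le_mono; lra.
  have nr := n2r n2.
  have -> : exp (- (2 * lnn n)) = INR n * exp (- (3 * lnn n)) by rewrite -[X in _ = X * _]E -exp_plus; congr exp; ring.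
  have := exp_pos (- (3 * lnn n)) => e4.
  apply: Rle_trans (Rmult_le_compat_l _ _ _ _ e3) _; nra.
by exists 0%nat => n _; have := exp_pos (- (2 * lnn n)); lra.
Qed.

Lemma aas_large_sparse :
  aas (fun n s => [forall j : 'I_n, (lo n <= j)%nat ==> large_sparse j (n %/ Q) s]).
Proof.
apply: (@aas_block (fun n => lo n) (fun n => n) (fun n j s => large_sparse j (n %/ Q) s)
  (fun n => 2 * exp (- (2 * lnn n)))); [|exact: small_bound|]; last first.
  by exists 0%nat => n _; have := exp_pos (- (2 * lnn n)); lra.
pose c := / (2 * INR Q).
have c0 : 0 < c by apply: Rinv_0_lt_compat; lra.
have c3 : 0 < c * c * c by apply: Rmult_lt_0_compat => //; apply: Rmult_lt_0_compat.
have Q1 : 1 <= INR Q.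
  have : 1 <= exp 3 by have := exp_ineq1_le 3; lra.
  nra.
have c1 : c <= 1.
  apply: (Rmult_le_reg_r (2 * INR Q)); first lra.
  by rewrite /c Rinv_l; lra.
apply: evt_imp (evt_and (evt_and (lo_large (4 / c)) (lo_large (32 / (c * c * c))))
  (evt_and (evt_and (evt_INR (2 * INR Q)) (evt_ge 2)) (evt_poly 2 1 Rlt_0_1))) _.
move=> n [[j1 j2] [[nQ n2] nL]] j /andP[lj jn]; have {}j1 := j1 _ lj; have {}j2 := j2 _ lj.
have n0 : (0 < n)%nat by lia.
have E := exp_ln_INR n0; rewrite Rmult_1_l pow_1 E in nL.
have Qn : (0 < Q)%nat by apply/ltP/INR_lt; rewrite /=; lra.
have cb : c * INR n <= INR (n %/ Q).
  have := lt_INR _ _ (elimT ltP (ltn_ceil n Qn)); rewrite mult_INR S_INR => h.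
  apply: (Rmult_le_reg_r (2 * INR Q)); first lra.
  by rewrite /c (Rmult_comm (/ _)) Rmult_assoc Rinv_l; lra.
have cj : 4 <= c * INR j.
  have -> : 4 = c * (4 / c) by field; lra.
  by apply: Rmult_le_compat_l; lra.
have cj3 : 32 <= c * c * c * INR j.
  have {1}-> : 32 = c * c * c * (32 / (c * c * c)) by field; lra.
  by apply: Rmult_le_compat_l; lra.
rewrite (eq_Pr (B := fun s => [exists W : {set 'I_n}, [&& (n %/ Q < #|W|)%nat, (#|W| + n %/ Q <= n)%nat &
        (j * #|W|.-1 < einside (G s (j.+1 * n.-1)) W)%nat]])); last first.
  by move=> s; rewrite negbK.
apply: Rle_trans (dense_large_sets n2 (conj c0 c1) cb cj) _.
have nr := n2r n2.
have e0 := exp_pos (- (2 * lnn n)).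
apply: Rle_trans (_ : exp (- (2 * lnn n)) <= _); last lra.
apply: exp_le_mono.
have : 32 * INR n <= c * c * c * INR j * INR n by apply: Rmult_le_compat_r; lra.
lra.
Qed.

Lemma exp9_ge : 3800 <= exp 9.
Proof.
have h1 : 1 + / 8 <= exp (/ 8) by apply: exp_ineq1_le.
have h2 : 5 / 2 <= exp 1.
  have -> : exp 1 = exp (/ 8) ^ 8 by rewrite exp_mulnat; congr exp; rewrite /=; lra.
  apply: Rle_trans (_ : (1 + / 8) ^ 8 <= _); first lra.
  by apply: pow_incr; lra.
have -> : exp 9 = exp 1 ^ 9 by rewrite exp_mulnat; congr exp; rewrite /=; lra.
apply: Rle_trans (_ : (5 / 2) ^ 9 <= _); first lra.
by apply: pow_incr; lra.
Qed.

(** For [j <= 20 ln n] and [D >= 20000], [k <= ln n / 1000], so the factor [exp 9 ^ (3 k + 5)] has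
    exponent [0.027 ln n] up to a constant; [exp 9 >= 3800] makes the other exponent about
    [80 ln n / 3800]. Together they stay below [ln n / 20], leaving room for the factor of order
    [ln n]. *)
Lemma growth_factor_small :
  evt (fun n => forall j, INR j <= 20 * lnn n -> growth_factor j (kap j) <= exp (/ 8 * lnn n)).
Proof.
have c0 : 0 < / 8 - / 20 by lra.
apply: evt_imp (evt_and (evt_ln 1) (evt_poly (7 * exp 46) 1 c0)) _ => n [L1 H] j jL.
set L := lnn n in L1 H jL *; set kk := kap j.
have kD := kap_le j; rewrite -/kk in kD; have k0 := pos_INR kk; have j0 := pos_INR j.
have kL : INR kk <= L / 1000.
  have h : 20000 * INR kk <= INR D * INR kk by apply: Rmult_le_compat_r.
  lra.
rewrite /growth_factor exp_mulnat -exp_plus plus_INR mult_INR.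
have -> : INR 3 = 3 by rewrite /=; lra.
have -> : INR 5 = 5 by rewrite /=; lra.
have e9 := exp9_ge.
have ej : 4 * (INR j + 1) / exp 9 <= (80 * L + 4) / 3800.
  apply: Rmult_le_compat; [lra | apply/Rlt_le/Rinv_0_lt_compat; lra | lra |].
  by apply: Rinv_le_contravar; lra.
apply: Rle_trans (_ : 7 * L * exp (46 + / 20 * L) <= _).
  apply: Rmult_le_compat; [lra | exact/Rlt_le/exp_pos | lra |].
  by apply: exp_le_mono; lra.
have -> : exp (/ 8 * L) = exp ((/ 8 - / 20) * L) * exp (/ 20 * L) by rewrite -exp_plus; congr exp; ring.
rewrite exp_plus.
have -> : 7 * L * (exp 46 * exp (/ 20 * L)) = 7 * exp 46 * L ^ 1 * exp (/ 20 * L) by rewrite pow_1; ring.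
by apply: Rmult_le_compat_r; [exact/Rlt_le/exp_pos | exact: H].
Qed.

(** With [z = n^(1/8)] and growth factor at most [n^(1/8)], each of the four terms of [mid_fail] is
    at most a quarter of [n^(-1/16)], which suffices for order [ln n] grid points. *)
Lemma aas_mid_good :
  aas (fun n s => [forall j : 'I_(mid n), (lo n <= j)%nat ==> mid_good j (kap j) s]).
Proof.
apply: (@aas_block (fun n => lo n) (fun n => mid n) (fun n j s => mid_good j (kap j) s)
  (fun n => exp (- (/ 16 * lnn n)))).
(* [D (k + 1) > j >= ln n / 4] gives [x^(k+1) > n^2], so the union bound over the vertices leaves
   order [1 / n]. *)
- pose x := exp (8 * INR D); have x1 : 1 <= x by have := exp_ineq1_le (8 * INR D); rewrite /x; lra.
  have c1 : 0 < 20 by lra.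
  have h1 : / 16 < / 8 by lra.
  have h2 : / 16 < 1 by lra.
  have h3 : / 16 < / 2 by lra.
  apply: evt_imp (evt_and (evt_and (evt_grid c1) growth_factor_small)
   (evt_and (evt_and (evt_small 4 0 h1) (evt_small (4 * 168 * 21) 1 h2))
     (evt_and (evt_small (4 * 204 * 21 * 21) 2 h3) (evt_small (4 * exp (2 * (x - 1))) 0 h2)))) _.
  move=> n [[[L1 n8 E gr] gf] [[b1 b2] [b3 b4]]] j /andP[lj jm].
  set L := lnn n in L1 E gr gf b1 b2 b3 b4 *.
  have L20 : 0 <= 20 * L by lra.
  have L4 : 0 <= / 4 * L by lra.
  have jL := le_of_lt_natceil L20 jm; have Lj := ge_of_natceil_le L4 lj.
  have [jn _] := gr _ jL; have {}gf := gf _ jL.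
  have j0 : (0 < j)%nat by apply/ltP/INR_lt; rewrite /=; lra.
  have kj : (2 * kap j <= j)%nat.
    have D2 : (2 <= D)%nat by apply/leP/INR_le; rewrite /=; lra.
    by have := leq_divM j D; nia.
  have nE : exp (- (1 * L)) = / INR n by rewrite Rmult_1_l exp_Ropp E.
  have z0 : 0 < exp (/ 8 * L) <= INR n.
    by split; [exact: exp_pos | rewrite -E; apply: exp_le_mono; lra].
  apply: Rle_trans (mid_fail n8 jn j0 kj z0 x1) _.
  have n0 : 0 < INR n by rewrite -E; apply: exp_pos.
  have in0 : 0 < / INR n by apply: Rinv_0_lt_compat.
  have t1 : 4 * / exp (/ 8 * L) <= exp (- (/ 16 * L)).
    by rewrite -exp_Ropp; rewrite Rmult_1_r in b1.
  have t2 : 4 * (168 * (INR j + 1) / INR n) <= exp (- (/ 16 * L)).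
    apply: Rle_trans b2; rewrite nE pow_1 /Rdiv -Rmult_assoc; apply: Rmult_le_compat_r; lra.
  have t3 : 4 * (204 * (INR j + 1) * (INR j + 1) * (growth_factor j (kap j) * growth_factor j (kap j)) *
      (exp (/ 8 * L) * exp (/ 8 * L)) / INR n) <= exp (- (/ 16 * L)).
    apply: Rle_trans b3.
    have g0 : 0 <= growth_factor j (kap j).
      apply: Rmult_le_pos; first by have := pos_INR (3 * kap j + 5); lra.
      by apply: Rmult_le_pos; [apply/pow_le/Rlt_le/exp_pos | apply/Rlt_le/exp_pos].
    set g := growth_factor _ _ in gf g0 *; set z := exp (/ 8 * L) in gf z0 *.
    have jp := pos_INR j.
    have gg : g * g <= z * z by apply: Rmult_le_compat.
    have jj : (INR j + 1) * (INR j + 1) <= 21 * L * (21 * L) by apply: Rmult_le_compat; lra.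
    have e2 : exp (- (/ 2 * L)) = z * z * (z * z) / INR n.
      by rewrite /z -!exp_plus /Rdiv -nE -exp_plus; congr exp; field.
    rewrite e2.
    have -> : 4 * (204 * (INR j + 1) * (INR j + 1) * (g * g) * (z * z) / INR n) =
      4 * 204 * (((INR j + 1) * (INR j + 1)) * (g * g)) * (z * z / INR n) by field; lra.
    have -> : 4 * 204 * 21 * 21 * L ^ 2 * (z * z * (z * z) / INR n) =
      4 * 204 * ((21 * L * (21 * L)) * (z * z)) * (z * z / INR n) by field; lra.
    apply: Rmult_le_compat_r; first by apply: Rdiv_ge0; [apply: Rmult_le_pos; lra | lra].
    apply: Rmult_le_compat_l; first lra.
    by apply: Rmult_le_compat => //; apply: Rmult_le_pos; lra.
  have t4 : 4 * (INR n * (exp (2 * (x - 1)) / x ^ (kap j).+1)) <= exp (- (/ 16 * L)).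
    apply: Rle_trans b4; rewrite Rmult_1_r /x exp_mulnat -{1}E.
    have -> : 4 * (exp L * (exp (2 * (exp (8 * INR D) - 1)) / exp (INR (kap j).+1 * (8 * INR D)))) =
      4 * exp (2 * (exp (8 * INR D) - 1)) * (exp L / exp (INR (kap j).+1 * (8 * INR D))) by rewrite /Rdiv; ring.
    apply: Rmult_le_compat_l; first by have := exp_pos (2 * (exp (8 * INR D) - 1)); lra.
    rewrite /Rdiv -exp_Ropp -exp_plus; apply: exp_le_mono; rewrite S_INR.
    by have := kap_gt j; lra.
  lra.
- move=> eps e0; have e2 : 0 < eps by [].
  have h : 0 < / 16 by lra.
  apply: evt_imp (evt_and (evt_ln 1) (evt_vanish 21 1 h e0)) _ => n [L1 H].
  apply: Rle_trans H; apply: Rmult_le_compat_r; first exact/Rlt_le/exp_pos.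
  have L20 : 0 <= 20 * lnn n by lra.
  by have := natceil_le L20; rewrite pow_1; lra.
by exists 0%nat => n _; apply/Rlt_le/exp_pos.
Qed.
End GridEvents.

Lemma two_le_exp : 2 <= exp (3 / 4).
Proof.
have h1 : 1 + / 8 <= exp (/ 8) by apply: exp_ineq1_le.
have -> : exp (3 / 4) = exp (/ 8) ^ 6 by rewrite exp_mulnat; congr exp; rewrite /=; lra.
apply: Rle_trans (_ : (1 + / 8) ^ 6 <= _); first lra.
by apply: pow_incr; lra.
Qed.

Lemma low_degree_exp n j k : (1 < n)%nat -> (j <= n)%nat -> (j * n.-1 <= 'C(n, 2))%nat ->
  Pr (fun s : {perm edge n} => [exists v, (deg (G s (j * n.-1)) v <= k)%nat]) <=
  exp (lnn n) * 2 ^ k * exp (1 - INR j).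
Proof.
move=> n2 jn jN; apply: Rle_trans (low_degree n2 _ jN) _.
have n2' := n2r n2; have jnr := le_INR _ _ (elimT leP jn); have j0 := pos_INR j.
rewrite exp_ln_INR ?(ltnW n2) // Rmult_assoc; apply: Rmult_le_compat_l; first lra.
apply: Rmult_le_compat_l; first by apply: pow_le; lra.
apply: exp_le_mono.
have -> : INR j * (INR n - 1) / INR n = INR j - INR j / INR n by field; lra.
have : INR j / INR n <= 1; last lra.
by apply: (Rmult_le_reg_r (INR n)); [lra | rewrite /Rdiv Rmult_assoc Rinv_l; lra].
Qed.

(** Here [j + 2 k + 1 <= 1.1 j + 1], and [2 <= exp (3/4)] bounds the exponent by
    [ln n - 0.175 j + 1.75]. For [j >= 20 ln n] and [ln n >= 4] this is below [- 2 ln n], enough for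
    [n] grid points. *)
Lemma aas_high_good D : 20000 <= INR D ->
  aas (fun n s => [forall j : 'I_n, (natceil (20 * lnn n) <= j)%nat ==>
    ((j * n.-1 <= 'C(n, 2))%nat ==> high_good j (j %/ D) s)]).
Proof.
move=> D_large.
apply: (@aas_block (fun n => natceil (20 * lnn n)) (fun n => n)
  (fun n j s => (j * n.-1 <= 'C(n, 2))%nat ==> high_good j (j %/ D) s)
  (fun n => 2 * exp (- (2 * lnn n)))); [|exact: small_bound|]; last first.
  by exists 0%nat => n _; have := exp_pos (- (2 * lnn n)); lra.
apply: evt_imp (evt_and (evt_ln 4) (evt_ge 2)) _ => n [L4 n2] j /andP[lj jn].
have e0 := exp_pos (- (2 * lnn n)).
have [jN|nj] := leqP (j * n.-1) 'C(n, 2); last first.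
  by rewrite PrE (eq_Ex (Y := fun=> 0)) => [|s]; [rewrite Ex1; lra|].
rewrite (eq_Pr (B := fun s => [exists v, (deg (G s (j * n.-1)) v <= j + (j %/ D).*2.+1)%nat])); last first.
  by move=> s; rewrite /= negbK.
apply: Rle_trans (low_degree_exp _ n2 (ltnW jn) jN) _.
set L := lnn n in L4 e0 *; have L20 : 0 <= 20 * L by lra.
have Lj := ge_of_natceil_le L20 lj.
set k := (j + _)%nat.
have kD : INR D * INR (j %/ D) <= INR j.
  by have := le_INR _ _ (elimT leP (leq_divM j D)); rewrite mult_INR; lra.
have k0 := pos_INR (j %/ D).
have kr : INR k <= 11 / 10 * INR j + 1.
  rewrite /k plus_INR S_INR -mul2n mult_INR.
  have -> : INR 2 = 2 by rewrite /=; lra.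
  have : 20000 * INR (j %/ D) <= INR D * INR (j %/ D) by apply: Rmult_le_compat_r.
  lra.
have p2 : 2 ^ k <= exp (3 / 4 * INR k).
  rewrite Rmult_comm -exp_mulnat; apply: pow_incr; have := two_le_exp; lra.
apply: Rle_trans (_ : exp L * exp (3 / 4 * INR k) * exp (1 - INR j) <= _).
  by apply: Rmult_le_compat_r; [exact/Rlt_le/exp_pos | apply: Rmult_le_compat_l => //; exact/Rlt_le/exp_pos].
rewrite -!exp_plus; apply: Rle_trans (_ : exp (- (2 * L)) <= _); last lra.
by apply: exp_le_mono; lra.
Qed.

(** * The crossover between minimum degree and edge density *)

Definition lam := ln (exp 1 / 2).

Lemma lam_gt0 : 0 < lam.
Proof.
rewrite /lam -ln_1; apply: ln_increasing; first lra.
by have := exp_ineq1 1 (ltac:(lra)); lra.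
Qed.

(** This rate appears in both the upper and the lower bound for the probability of a degree at most
    about [j]. Hence [1 / lam = beta / 2] is the value of [j / ln n] at which [n exp (- lam j)]
    passes 1. *)
Lemma exp_lam j : 2 ^ j * exp (- INR j) = exp (- (lam * INR j)).
Proof.
have -> : exp (- (lam * INR j)) = exp (- lam) ^ j by rewrite exp_mulnat; congr exp; ring.
have e1 := exp_pos 1.
have -> : exp (- lam) = / (exp 1 / 2).
  by rewrite exp_Ropp /lam exp_ln //; apply: Rdiv_lt_0_compat; lra.
have -> : exp (- INR j) = exp (-1) ^ j by rewrite exp_mulnat; congr exp; ring.
rewrite -Rpow_mult_distr; congr (_ ^ _).
have -> : exp (-1) = / exp 1 by rewrite -exp_Ropp; congr exp; ring.
by field; lra.
Qed.

(** In this range [n exp (- lam j) >= n^(eps/2)], so by [cdf_lower_main] the expected number of such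
    vertices is still a positive power of [n] up to a factor of order [ln n]. *)
Lemma aas_exists_low eps : 0 < eps <= / 2 ->
  aas (fun n s => [forall j : 'I_(natceil ((1 - eps / 2) / lam * lnn n)), (1 <= j)%nat ==>
    [exists v, (deg (G s (j * n.-1)) v < j)%nat]]).
Proof.
move=> e01; have l0 := lam_gt0.
pose c := (1 - eps / 2) / lam; have c0 : 0 < c by apply: Rdiv_lt_0_compat; lra.
pose b n := 4 * exp 2 * c * lnn n ^ 1 * exp (- (eps / 2 * lnn n)) + 168 * c * lnn n ^ 1 * exp (- (1 * lnn n)).
apply: (@aas_block (fun n => 1%nat) (fun n => natceil (c * lnn n))
  (fun n j s => [exists v, (deg (G s (j * n.-1)) v < j)%nat]) b).
- apply: evt_imp (evt_grid c0) _ => n [L1 n8 E gr] j /andP[j0 jhi].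
  set L := lnn n in L1 E gr jhi *.
  have cL : 0 <= c * L by apply: Rmult_le_pos; lra.
  have jL := le_of_lt_natceil cL jhi; have [jn1 j2n1] := gr _ jL.
  have jn : (96 * j <= n)%nat by lia.
  have j2n : (18 * j * j + 2 <= n)%nat by nia.
  have jr : 1 <= INR j by have := le_INR _ _ (elimT leP j0).
  have H := cdf_lower_main n8 jn j2n j0; rewrite exp_lam in H.
  have e2 := exp_pos 2; have el := exp_pos (- (lam * INR j)).
  have q0 : 0 < hypergeom_cdf (win n (j * n.-1)) n.-1 j.
    apply: (Rmult_lt_reg_l (4 * exp 2 * INR j)); first by apply: Rmult_lt_0_compat; lra.
    by rewrite Rmult_0_r; apply: Rlt_le_trans el H.
  have n40 : (40 * j <= n)%nat by lia.
  apply: Rle_trans (exists_low_degree n8 jn n40 (leqnn j) j0 q0) _.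
  have n0 : 0 < INR n by rewrite -E; apply: exp_pos.
  have lj : lam * INR j <= (1 - eps / 2) * L.
    have -> : (1 - eps / 2) * L = lam * (c * L) by rewrite /c; field; lra.
    by apply: Rmult_le_compat_l; lra.
  apply: Rplus_le_compat.
    set q := hypergeom_cdf _ _ _ in H q0 *.
    have nq : exp (eps / 2 * L) <= 4 * exp 2 * INR j * (INR n * q).
      apply: Rle_trans (_ : exp L * exp (- (lam * INR j)) <= _).
        by rewrite -exp_plus; apply: exp_le_mono; lra.
      rewrite E; have := Rmult_le_compat_l _ _ _ (Rlt_le _ _ n0) H; lra.
    have nq0 : 0 < INR n * q by apply: Rmult_lt_0_compat.
    have ee := exp_pos (eps / 2 * L).
    rewrite -/L pow_1 exp_Ropp.
    apply: (Rmult_le_reg_r (INR n * q)) => //; rewrite Rinv_l; last lra.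
    apply: (Rmult_le_reg_r (exp (eps / 2 * L))) => //; rewrite Rmult_1_l.
    apply: Rle_trans nq _.
    have -> : 4 * exp 2 * c * L * / exp (eps / 2 * L) * (INR n * q) * exp (eps / 2 * L) =
      4 * exp 2 * (c * L) * (INR n * q) by field; lra.
    by apply: Rmult_le_compat_r; [lra | apply: Rmult_le_compat_l; lra].
  rewrite -/L pow_1 Rmult_1_l exp_Ropp E /Rdiv; apply: Rmult_le_compat_r; first exact/Rlt_le/Rinv_0_lt_compat.
  lra.
- move=> e e0; have e2 : 0 < e / 2 by lra.
  have h : 0 < eps / 2 by lra.
  apply: evt_imp (evt_and (evt_and (evt_ln 1) (evt_vanish ((c + 1) * (4 * exp 2 * c)) 2 h e2)) (evt_vanish ((c + 1) * (168 * c)) 2 Rlt_0_1 e2)) _.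
  move=> n [[L1 H1] H2]; set L := lnn n in L1 H1 H2 *.
  have cL : 0 <= c * L by apply: Rmult_le_pos; lra.
  have h1 := natceil_le cL.
  have b0 : 0 <= b n.
    have ex2 := exp_pos 2; have e1 := exp_pos (- (eps / 2 * L)); have e3 := exp_pos (- (1 * L)).
    rewrite /b -/L pow_1; apply: Rplus_le_le_0_compat; apply: Rmult_le_pos; try lra;
      by apply: Rmult_le_pos; try lra; apply: Rmult_le_pos; lra.
  apply: Rle_trans (_ : (c + 1) * L * b n <= _); first by apply: Rmult_le_compat_r => //; lra.
  rewrite /b -/L pow_1; move: H1 H2; rewrite /=; lra.
have ex2 := exp_pos 2.
apply: evt_imp (evt_ln 1) _ => n L1.
have e1 := exp_pos (- (eps / 2 * lnn n)); have e3 := exp_pos (- (1 * lnn n)).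
rewrite /b pow_1; apply: Rplus_le_le_0_compat; apply: Rmult_le_pos; try lra;
  by apply: Rmult_le_pos; try lra; apply: Rmult_le_pos; lra.
Qed.

Lemma aas_no_low eps : 0 < eps ->
  aas (fun n s => [forall j : 'I_(natceil (20 * lnn n)), (natceil ((1 + eps / 2) / lam * lnn n) <= j)%nat ==>
    ((j < n)%nat && (j * n.-1 <= 'C(n, 2))%nat ==> ~~ [exists v, (deg (G s (j * n.-1)) v <= j)%nat])]).
Proof.
move=> e0; have l0 := lam_gt0.
pose c := (1 + eps / 2) / lam; have c0 : 0 < c by apply: Rdiv_lt_0_compat; lra.
apply: (@aas_block (fun n => natceil (c * lnn n)) (fun n => natceil (20 * lnn n))
  (fun n j s => (j < n)%nat && (j * n.-1 <= 'C(n, 2))%nat ==> ~~ [exists v, (deg (G s (j * n.-1)) v <= j)%nat])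
  (fun n => exp 1 * exp (- (eps / 2 * lnn n)))).
- apply: evt_imp (evt_and (evt_ln 1) (evt_ge 2)) _ => n [L1 n2] j /andP[lj _].
  have b0 : 0 <= exp 1 * exp (- (eps / 2 * lnn n)) by apply: Rmult_le_pos; apply/Rlt_le/exp_pos.
  have [/andP[jn jN]|nj] := boolP ((j < n)%nat && (j * n.-1 <= 'C(n, 2))%nat); last first.
    by rewrite PrE (eq_Ex (Y := fun=> 0)) => [|s]; [rewrite Ex1 | ].
  rewrite (eq_Pr (B := fun s => [exists v, (deg (G s (j * n.-1)) v <= j)%nat])); last first.
    by move=> s; rewrite /= negbK.
  apply: Rle_trans (low_degree_exp _ n2 (ltnW jn) jN) _.
  set L := lnn n in L1 lj b0 *.
  have cL : 0 <= c * L by apply: Rmult_le_pos; lra.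
  have jr := ge_of_natceil_le cL lj.
  have lj' : (1 + eps / 2) * L <= lam * INR j.
    have -> : (1 + eps / 2) * L = lam * (c * L) by rewrite /c; field; lra.
    by apply: Rmult_le_compat_l; lra.
  have -> : exp L * 2 ^ j * exp (1 - INR j) = exp 1 * (exp L * (2 ^ j * exp (- INR j))).
    by rewrite /Rminus exp_plus; ring.
  rewrite exp_lam -(exp_plus L); apply: Rmult_le_compat_l; first exact/Rlt_le/exp_pos.
  by apply: exp_le_mono; lra.
- move=> e e1; have h : 0 < eps / 2 by lra.
  apply: evt_imp (evt_and (evt_ln 1) (evt_vanish (21 * exp 1) 1 h e1)) _ => n [L1 H].
  apply: Rle_trans H; have L20 : 0 <= 20 * lnn n by lra.
  have := natceil_le L20 => hh; rewrite pow_1.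
  have b0 : 0 <= exp 1 * exp (- (eps / 2 * lnn n)) by apply: Rmult_le_pos; apply/Rlt_le/exp_pos.
  have -> : 21 * exp 1 * lnn n * exp (- (eps / 2 * lnn n)) = 21 * lnn n * (exp 1 * exp (- (eps / 2 * lnn n))) by ring.
  by apply: Rmult_le_compat_r => //; lra.
by exists 0%nat => n _; apply: Rmult_le_pos; apply/Rlt_le/exp_pos.
Qed.

Lemma exists_parameters : exists D Q : nat, 20000 <= INR D /\ 2 * INR D * exp 3 <= INR Q.
Proof.
have [D HD] := INR_unbounded 20000; have [Q HQ] := INR_unbounded (2 * INR D * exp 3).
by exists D, Q; lra.
Qed.

Lemma block_lt n m : (1 < n)%nat -> (m <= 'C(n, 2))%nat -> (m %/ n.-1 < n)%nat.
Proof.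
move=> n2 mN; rewrite ltn_divLR; last lia.
by have := bin2_double n; move: mN; move: 'C(n, 2) => B; nia.
Qed.

Lemma forall_ordP (h : nat) (P : nat -> bool) (l : nat) :
  [forall j : 'I_h, (l <= j)%nat ==> P j] -> forall j, (l <= j)%nat -> (j < h)%nat -> P j.
Proof. by move=> /forallP H j lj jh; have /implyP := H (Ordinal jh); apply. Qed.

Lemma packing_all :
  aas (fun n s => [forall m : 'I_('C(n, 2)).+1,
          T (G s m) == minn (mindeg (G s m)) (m %/ n.-1)]).
Proof.
have [D [Q [D_large Q_large]]] := exists_parameters.
have A := aas_and (aas_and (aas_small_sparse D_large Q_large) (aas_large_sparse D_large Q_large))
  (aas_and (aas_zero_degree) (aas_and (aas_mid_good D_large) (aas_high_good D_large))).
apply: aas_imp A _; apply: evt_imp (evt_ge 2) _ => n n2 s.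
case/andP=> /andP[sm la] /and3P[/eqP z0 mi hi].
have {}sm := @forall_ordP n (fun j => small_sparse j (j %/ D) (n %/ Q) s) _ sm.
have {}la := @forall_ordP n (fun j => large_sparse j (n %/ Q) s) _ la.
have {}mi := @forall_ordP _ (fun j => mid_good j (j %/ D) s) _ mi.
have {}hi := @forall_ordP n (fun j => (j * n.-1 <= 'C(n, 2))%nat ==> high_good j (j %/ D) s) _ hi.
apply/forallP => m; apply/eqP; have mN : (m <= 'C(n, 2))%nat by rewrite -ltnS ltn_ord.
set j := (m %/ n.-1)%nat.
have jn : (j < n)%nat := block_lt n2 mN.
have kj : ((j %/ D).*2 <= j)%nat.
  have D2 : (2 <= D)%nat by apply/leP/INR_le; rewrite /=; lra.
  by have := leq_divM j D; rewrite -mul2n; nia.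
(* In the lowest blocks [G_m] is contained in a grid graph that still has an isolated vertex, so
   both sides are 0. *)
have [jlo|loj] := ltnP j (natceil (/ 4 * lnn n)).
  apply: T_eq_min => //.
  have : (mindeg (G s m) <= 0)%nat.
    apply: leq_trans (_ : mindeg (G s (natceil (/ 4 * lnn n) * n.-1)) <= 0)%nat; last by rewrite z0.
    apply: mindeg_mono => //; apply: G_mono.
    have n1 : (0 < n.-1)%nat by lia.
    apply: leq_trans (ltnW (ltn_ceil m n1)) _.
    by rewrite leq_mul2r jlo orbT.
  by rewrite leqn0 => /eqP ->; rewrite min0n.
have smj := sm j loj jn; have laj := la j loj jn.
have [jmid|midj] := ltnP j (natceil (20 * lnn n)).
  exact: (T_of_mid n2 mN kj smj laj (mi j loj jmid)).
have /implyP hij := hi j midj jn.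
by apply: (T_of_high n2 mN kj smj laj (hij _)); apply: leq_trans mN; apply: leq_divM.
Qed.

Lemma RlebP a b : Rleb a b -> a <= b.
Proof. by rewrite /Rleb; case: Rle_dec. Qed.

Lemma half_beta : beta / 2 = / lam.
Proof. by have := lam_gt0; rewrite /beta -/lam => l0; field; lra. Qed.

Lemma degree_below eps : 0 < eps <= / 2 ->
  aas (fun n s => [forall m : 'I_('C(n, 2)).+1,
    Rleb (INR m) ((1 - eps) * beta / 2 * INR n * lnn n) ==> (mindeg (G s m) <= m %/ n.-1)%nat]).
Proof.
move=> e01; apply: aas_imp (aas_exists_low e01) _; have l0 := lam_gt0.
apply: evt_imp (evt_and (evt_and (evt_ln 1) (evt_ln (4 * lam / eps))) (evt_and (evt_ge 2) (evt_INR (1 + 4 / eps)))) _.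
move=> n [[L1 L2] [n2 ne]] s H.
have {}H := @forall_ordP _ (fun j => [exists v, (deg (G s (j * n.-1)) v < j)%nat]) _ H; apply/forallP => m; apply/implyP => /RlebP.
have -> : (1 - eps) * beta / 2 * INR n * lnn n = (1 - eps) * (beta / 2) * INR n * lnn n by field.
rewrite half_beta; set L := lnn n in L1 L2 H *; set j := (m %/ n.-1)%nat => mle.
have n2' := n2r n2.
have jm : INR j * (INR n - 1) <= INR m.
  by rewrite -INR_pred // -mult_INR; apply/le_INR/leP; apply: leq_divM.
have e4 : 4 / eps > 0 by apply: Rdiv_lt_0_compat; lra.
have nn : (1 - eps) * INR n <= (1 - 3 / 4 * eps) * (INR n - 1).
  have h : 1 <= eps / 4 * (INR n - 1).
    apply: Rle_trans (_ : eps / 4 * (4 / eps) <= _); first by right; field; lra.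
    by apply: Rmult_le_compat_l; lra.
  nra.
have Ll : 0 < L / lam by apply: Rdiv_lt_0_compat; lra.
have jL : INR j <= (1 - 3 / 4 * eps) * (L / lam).
  apply: (Rmult_le_reg_r (INR n - 1)); first lra.
  apply: Rle_trans jm (Rle_trans _ _ _ mle _).
  have -> : (1 - eps) * / lam * INR n * L = (1 - eps) * INR n * (L / lam) by field; lra.
  have -> : (1 - 3 / 4 * eps) * (L / lam) * (INR n - 1) = (1 - 3 / 4 * eps) * (INR n - 1) * (L / lam) by ring.
  by apply: Rmult_le_compat_r; lra.
have e1 : 1 <= / 4 * eps * (L / lam).
  have -> : 1 = / 4 * eps * (4 * lam / eps / lam) by field; lra.
  apply: Rmult_le_compat_l; first lra.
  by apply: Rmult_le_compat_r => //; apply/Rlt_le/Rinv_0_lt_compat.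
have cL : 0 <= (1 - eps / 2) / lam * L.
  by apply: Rmult_le_pos; [apply: Rdiv_ge0|]; lra.
have jhi : (j.+1 < natceil ((1 - eps / 2) / lam * L))%nat.
  apply/ltP/INR_lt; apply: Rle_lt_trans (natceil_gt cL); rewrite S_INR.
  have -> : (1 - eps / 2) / lam * L = (1 - 3 / 4 * eps) * (L / lam) + / 4 * eps * (L / lam) by field; lra.
  lra.
(* The later grid point is used: a degree below [j + 1] in [Gam_{j+1}] bounds the degree in the
   smaller [G_m] by [j]. *)
have /existsP[v dv] := H j.+1 isT jhi.
apply: leq_trans (mindeg_le _ v) _; rewrite -ltnS; apply: leq_ltn_trans dv.
by apply/deg_mono/G_mono/ltnW/ltn_ceil; lia.
Qed.

Lemma degree_above eps : 0 < eps ->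
  aas (fun n s => [forall m : 'I_('C(n, 2)).+1,
    Rleb ((1 + eps) * beta / 2 * INR n * lnn n) (INR m) ==> (m %/ n.-1 < mindeg (G s m))%nat]).
Proof.
move=> e0; have [D [Q [D_large Q_large]]] := exists_parameters.
apply: aas_imp (aas_and (aas_no_low e0) (aas_high_good D_large)) _; have l0 := lam_gt0.
apply: evt_imp (evt_and (evt_and (evt_ln 1) (evt_ln (4 * lam / eps))) (evt_ge 2)) _.
move=> n [[L1 L2] n2] s /andP[H1 H2].
have {}H1 := @forall_ordP _ (fun j => (j < n)%nat && (j * n.-1 <= 'C(n, 2))%nat ==>
  ~~ [exists v, (deg (G s (j * n.-1)) v <= j)%nat]) _ H1.
have {}H2 := @forall_ordP n (fun j => (j * n.-1 <= 'C(n, 2))%nat ==> high_good j (j %/ D) s) _ H2; apply/forallP => m; apply/implyP => /RlebP.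
have -> : (1 + eps) * beta / 2 * INR n * lnn n = (1 + eps) * (beta / 2) * INR n * lnn n by field.
rewrite half_beta; set L := lnn n in L1 L2 H1 H2 *; set j := (m %/ n.-1)%nat => mle.
have n2' := n2r n2; have mN : (m <= 'C(n, 2))%nat by rewrite -ltnS ltn_ord.
have n1 : (0 < n.-1)%nat by lia.
have jm : INR m < (INR j + 1) * (INR n - 1).
  by rewrite -INR_pred // -S_INR -mult_INR; apply/lt_INR/ltP; apply: ltn_ceil.
have Ll : 0 < L / lam by apply: Rdiv_lt_0_compat; lra.
have jL : (1 + eps) * (L / lam) <= INR j + 1.
  apply: (Rmult_le_reg_r (INR n)); first lra.
  have -> : (1 + eps) * (L / lam) * INR n = (1 + eps) * / lam * INR n * L by field; lra.
  have := pos_INR j; nra.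
(* One unit pays for rounding [m / (n - 1)] down to [j], the other for [natceil]. *)
have e1 : 2 <= / 2 * eps * (L / lam).
  apply: Rle_trans (_ : / 2 * eps * (4 * lam / eps / lam) <= _); first by right; field; lra.
  apply: Rmult_le_compat_l; first lra.
  by apply: Rmult_le_compat_r => //; apply/Rlt_le/Rinv_0_lt_compat.
have cL : 0 <= (1 + eps / 2) / lam * L.
  by apply: Rmult_le_pos; [apply: Rdiv_ge0|]; lra.
have jlo : (natceil ((1 + eps / 2) / lam * L) <= j)%nat.
  apply/leP/INR_le; apply: Rle_trans (natceil_le cL) _.
  have -> : (1 + eps / 2) / lam * L = (1 + eps) * (L / lam) - / 2 * eps * (L / lam) by field; lra.
  lra.
have jn : (j < n)%nat := block_lt n2 mN.
have jmn : (j * n.-1 <= m)%nat by apply: leq_divM.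
have jN : (j * n.-1 <= 'C(n, 2))%nat by apply: leq_trans jmn mN.
have nolow : ~~ [exists v, (deg (G s (j * n.-1)) v <= j)%nat].
  have [jmid|midj] := ltnP j (natceil (20 * L)).
    by have /implyP := H1 j jlo jmid; apply; rewrite jn jN.
  have /implyP/(_ jN) := H2 j midj jn; apply: contra => /existsP[v dv].
  by apply/existsP; exists v; apply: leq_trans dv (leq_addr _ _).
rewrite mindeg_deg ?(ltnW n2) //; apply/forallP => v.
rewrite ltnNge; apply: contra nolow => dv; apply/existsP; exists v.
by apply: leq_trans (deg_mono _ (G_mono s jmn)) dv.
Qed.

(** Decreasing [eps] widens the range of [m] in the first half, so [degree_below] is applied with
    [eps] replaced by its minimum with [1/2]. *)
Lemma degree_crossover eps : 0 < eps ->
  aas (fun n s => [forall m : 'I_('C(n, 2)).+1,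
    (Rleb (INR m) ((1 - eps) * beta / 2 * INR n * lnn n) ==> (mindeg (G s m) <= m %/ n.-1)%nat) &&
    (Rleb ((1 + eps) * beta / 2 * INR n * lnn n) (INR m) ==> (m %/ n.-1 < mindeg (G s m))%nat)]).
Proof.
move=> e0; have m0 : 0 < Rmin eps (/ 2) <= / 2.
  by split; [apply: Rmin_glb_lt; lra | apply: Rmin_r].
apply: aas_imp (aas_and (degree_below m0) (degree_above e0)) _.
apply: evt_imp (evt_ln 0) _ => n L0 s /andP[/forallP H1 /forallP H2]; apply/forallP => m.
rewrite H2 andbT; apply/implyP => /RlebP h; have /implyP := H1 m; apply.
rewrite /Rleb; case: Rle_dec => // -[]; apply: Rle_trans h _.
rewrite /Rdiv !(Rmult_assoc _ beta) -/(beta / 2) half_beta.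
apply: Rmult_le_compat_r => //; apply: Rmult_le_compat_r; first exact: pos_INR.
apply: Rmult_le_compat_r; first exact/Rlt_le/Rinv_0_lt_compat/lam_gt0.
by have := Rmin_l eps (/ 2); lra.
Qed.


Local Close Scope R_scope.

Theorem theorem2p3 :
  aas (fun n s => [forall m : 'I_('C(n, 2)).+1,
          T (G s m) == minn (mindeg (G s m)) (m %/ n.-1)])
  /\
  (forall eps : R, (0 < eps)%R ->
     aas (fun n s => [forall m : 'I_('C(n, 2)).+1,
        (Rleb (INR m) ((1 - eps) * beta / 2 * INR n * ln (INR n))%R
           ==> (mindeg (G s m) <= m %/ n.-1)) &&
        (Rleb ((1 + eps) * beta / 2 * INR n * ln (INR n))%R (INR m)
           ==> (m %/ n.-1 < mindeg (G s m)))])).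
Proof.
split; [exact: packing_all | exact: degree_crossover].
Qed.
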